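(* Let $K$ be a union of finitely many disjoint simple smoothly closed (possibly linked or knotted) curves in $\mathbf{R}^{n}$ and let $\mu:K\to(0,\infty)$ be of class $C^3$. Let $\gamma:Domain(\gamma)\rightarrow K$ parametrize $K$ with unit speed and $\mu(s)=\mu(\gamma(s))$. If $TIR(K,\mu)<UR(K,\mu)$, then $K$ contains a circular arc of curvature $\kappa$ and positive length, along which $\mu=\frac{2}{\kappa r}\cos\left(\frac{\kappa s}{2}+a\right)$ for some $a\in\mathbf{R}$ and some $r<UR(K,\mu)$ (where $r>0$ and $s$ is arclength). In this case, $TIR(K,\mu)$ is equal to the infimum of such $r$. If $K$ has no such circular arc with a compatible $\mu$, that is, if the set of all $s\in Domain(\gamma)$ satisfying $$\left(\mu''+\tfrac14\kappa^{2}\mu\right)(s)=0,\quad \kappa'(s)=0\text{ with }\kappa(s)>0,\quad \gamma'''(s)+\kappa^{2}(s)\gamma'(s)=0,$$ $$\text{and}\quad (\mu')^{2}(s)-\mu\mu''(s)=\frac{1}{r^{2}}\in\mathbf{R}\ \text{ where } r<UR(K,\mu),$$ has no interior, then $TIR(K,\mu)=AIR(K,\mu)=UR(K,\mu)$.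
   Context: Setting. $K\subset\mathbf{R}^n$ is a compact $1$-dimensional submanifold with finitely many components. Parametrizations $\gamma$ of $K$ are with respect to arclength $s$; an onto parametrization is taken on each component as a periodic map with period the length of that component ($Domain(\gamma)$ is the disjoint union of the corresponding circles). Primes denote $d/ds$ and $\kappa(s)=\|\gamma''(s)\|$ is the curvature. $NK$ is the normal bundle of $K$, $NK_q$ the set of vectors normal to $K$ at $q$, and $D(r)=\{(q,w)\in NK:\|w\|<r\}$. The intrinsic gradient of $\mu$ is $\mathrm{grad}\,\mu(\gamma(s))=\mu'(s)\gamma'(s)$. Exponential map. $W=\{(q,w): q\in K,\ w\in NK_q,\ \|w\|\le \|\mathrm{grad}\,\mu(q)\|^{-1}\text{ when }\mathrm{grad}\,\mu(q)\ne0\}$ and $\exp^\mu:W\to\mathbf{R}^n$, $$\exp^{\mu}(q,w)=q-\mu(q)\|w\|^{2}\,\mathrm{grad}\,\mu(q)+\mu(q)\sqrt{1-\|\mathrm{grad}\,\mu(q)\|^{2}\|w\|^{2}}\;w .$$ Injectivity radii. $TIR(K,\mu)$ is the supremum of the $r$ such that $\exp^\mu$ restricted to $D(r)$ is a homeomorphism onto its image. $AIR(K,\mu)$ is the supremum of the $r$ for which there are an open dense subset $U(r)$ of $D(r)$ and an open subset $U_0(r)$ of $\mathbf{R}^n$ such that $\exp^\mu:U(r)\to U_0(r)$ is a homeomorphism. Double critical self distance. A pair $(q_1,q_2)\in K\times K$ with $q_1\ne q_2$ is a double critical pair for $(K,\mu)$ if it is a critical point of $\Sigma:K\times K\to\mathbf{R}$,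 $\Sigma(x,y)=\|x-y\|^2(\mu(x)+\mu(y))^{-2}$. Then $\tfrac12 DCSD(K,\mu)$ is the minimum of $\frac{\|q_1-q_2\|}{\mu(q_1)+\mu(q_2)}$ over all double critical pairs $(q_1,q_2)$. Upper radius. Put $\Lambda=\frac12(\mu^2)''+\frac12\kappa^2\mu^2+\kappa\mu\sqrt{\mu(\mu''+\frac14\kappa^2\mu)}$ where $\mu''+\frac14\kappa^2\mu\ge0$. For $K$ connected, $$FocRad^{-}(K,\mu)=\Big(\max\big[\sup\{\Lambda(s):(\mu''+\tfrac14\kappa^2\mu)(s)>0\},\ \max_s|\mu'(s)|^2\big]\Big)^{-1/2};$$ for several components one takes the minimum over the components. $UR(K,\mu)=\min(\tfrac12DCSD(K,\mu),FocRad^{-}(K,\mu))$. *)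

(* Defs.v *)
From HB Require Import structures.
From mathcomp Require Import all_boot all_order all_algebra.
From mathcomp Require Import all_classical all_reals all_analysis.

Set Implicit Arguments.
Unset Strict Implicit.
Unset Printing Implicit Defensive.

Import Order.TTheory GRing.Theory Num.Theory.
Import numFieldNormedType.Exports.

Local Open Scope ring_scope.
Local Open Scope classical_set_scope.

(* The library norm `|v| on 'rV[R]_n is the sup norm: it is used only for the
   topology and for derivatives, all lengths below are Euclidean. *)
Definition dotr (R : realType) (n : nat) (u v : 'rV[R]_n) : R :=
  \sum_(k < n) u 0 k * v 0 k.

Definition enorm (R : realType) (n : nat) (v : 'rV[R]_n) : R :=
  Num.sqrt (dotr v v).

Definition class_C (R : realType) (V : normedModType R) (k : nat)
    (f : R -> V) : Prop :=
  (forall (j : nat) (x : R), (j < k)%N -> derivable (derive1n j f) x 1) /\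
  continuous (derive1n k f).

Definition smooth (R : realType) (V : normedModType R) (f : R -> V) : Prop :=
  forall k, class_C k f.

(* The i-th component has length L i, and gamma i is its arclength
   parametrization, lifted from the circle R / (L i) Z to an (L i)-periodic
   function on R. *)
Record unit_speed_link (R : realType) (n m : nat) (L : 'I_m -> R)
    (gamma : 'I_m -> R -> 'rV[R]_n) : Prop := UnitSpeedLink {
  link_length_gt0 : forall i, 0 < L i ;
  link_smooth : forall i, smooth (gamma i) ;
  link_unit_speed : forall i s, enorm (derive1 (gamma i) s) = 1 ;
  link_periodic : forall i s, gamma i (s + L i) = gamma i s ;
  link_simple_disjoint : forall i j s t, gamma i s = gamma j t ->
    i = j /\ exists z : int, s - t = z%:~R * L i
}.

Section Link.
Context {R : realType} {n m : nat}.
Variables (gamma : 'I_m -> R -> 'rV[R]_n) (mu : 'rV[R]_n -> R).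

Definition carrier : set 'rV[R]_n := [set q | exists i s, q = gamma i s].

Definition mu_s (i : 'I_m) (s : R) : R := mu (gamma i s).

Definition curvature (i : 'I_m) (s : R) : R := enorm (derive1n 2 (gamma i) s).

Definition normal_bundle : set ('rV[R]_n * 'rV[R]_n) :=
  [set p | exists i s, p.1 = gamma i s /\ dotr p.2 (derive1 (gamma i) s) = 0].

Definition disc_bundle (r : R) : set ('rV[R]_n * 'rV[R]_n) :=
  normal_bundle `&` [set p | enorm p.2 < r].

(* For a simple link the set below is a singleton when q lies on the link, so
   that grad (gamma i s) = mu_i'(s) gamma_i'(s). *)
Definition grad (q : 'rV[R]_n) : 'rV[R]_n :=
  xget 0 [set v | exists i s, q = gamma i s /\
                    v = derive1 (mu_s i) s *: derive1 (gamma i) s].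

Definition exp_domain : set ('rV[R]_n * 'rV[R]_n) :=
  normal_bundle `&`
  [set p | grad p.1 != 0 -> enorm p.2 <= (enorm (grad p.1))^-1].

Definition exp_mu (p : 'rV[R]_n * 'rV[R]_n) : 'rV[R]_n :=
  p.1 - (mu p.1 * enorm p.2 ^+ 2) *: grad p.1
  + (mu p.1 * Num.sqrt (1 - enorm (grad p.1) ^+ 2 * enorm p.2 ^+ 2)) *: p.2.

End Link.

Definition homeo_between (T U : topologicalType) (A : set T) (B : set U)
    (f : T -> U) : Prop :=
  exists g : U -> T,
    [/\ set_fun A B f, set_fun B A g,
        {within A, continuous f}, {within B, continuous g}
      & (forall x, A x -> g (f x) = x) /\ (forall y, B y -> f (g y) = y)].

Section Radii.
Context {R : realType} {n m : nat}.
Variables (gamma : 'I_m -> R -> 'rV[R]_n) (mu : 'rV[R]_n -> R).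

Local Notation K := (carrier gamma).
Local Notation D := (disc_bundle gamma).
Local Notation W := (exp_domain gamma mu).
Local Notation expm := (exp_mu gamma mu).

(* exp_mu is meaningful on W only, hence the condition D r `<=` W. *)
Definition TIR : \bar R :=
  ereal_sup [set r%:E | r in
    [set r : R | D r `<=` W /\ homeo_between (D r) (expm @` D r) expm]].

Definition AIR : \bar R :=
  ereal_sup [set r%:E | r in
    [set r : R | D r `<=` W /\
       exists (U : set ('rV[R]_n * 'rV[R]_n)) (U0 : set 'rV[R]_n),
         [/\ (exists2 O, open O & U = O `&` D r),
             D r `<=` closure U, open U0 & homeo_between U U0 expm]]].

Definition Sigma (x y : 'rV[R]_n) : R :=
  enorm (x - y) ^+ 2 * (mu x + mu y) ^- 2.

(* Criticality on the surface K x K, read in the charts (gamma i, gamma j). *)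
Definition double_critical (q1 q2 : 'rV[R]_n) : Prop :=
  q1 <> q2 /\
  exists (i j : 'I_m) (s t : R), [/\ q1 = gamma i s, q2 = gamma j t
    & is_diff (s, t) (fun p : R * R => Sigma (gamma i p.1) (gamma j p.2))
        (fun=> 0 : R)].

Definition half_DCSD : \bar R :=
  ereal_inf [set x | exists q1 q2, double_critical q1 q2 /\
                       x = (enorm (q1 - q2) / (mu q1 + mu q2))%:E].

Local Notation mus := (mu_s gamma mu).
Local Notation kap := (curvature gamma).

Definition focal_disc (i : 'I_m) (s : R) : R :=
  derive1n 2 (mus i) s + 4^-1 * kap i s ^+ 2 * mus i s.

Definition Lambda (i : 'I_m) (s : R) : R :=
  2^-1 * derive1n 2 (fun t => mus i t ^+ 2) s
  + 2^-1 * kap i s ^+ 2 * mus i s ^+ 2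
  + kap i s * mus i s * Num.sqrt (mus i s * focal_disc i s).

Definition FocRadm_comp (i : 'I_m) : R :=
  (Num.sqrt (Num.max (sup [set Lambda i s | s in [set s | 0 < focal_disc i s]])
                     (sup (range (fun s => `|derive1 (mus i) s| ^+ 2)))))^-1.

Definition FocRadm : \bar R :=
  ereal_inf [set (FocRadm_comp i)%:E | i in [set: 'I_m]].

Definition UR : \bar R := Order.min half_DCSD FocRadm.

(* The arc is sigma on [s0, s1], with centre c, radius kappa^-1 and
   (e1, e2) an orthonormal frame of its plane; s is its arclength. *)
Definition compatible_arc (r : R) : Prop :=
  exists (kappa a s0 s1 : R) (c e1 e2 : 'rV[R]_n),
    let sigma s := c + kappa^-1 *: (cos (kappa * s) *: e1
                                    + sin (kappa * s) *: e2) in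
    [/\ 0 < kappa, s0 < s1,
        [/\ dotr e1 e1 = 1, dotr e2 e2 = 1 & dotr e1 e2 = 0]
      & forall s, s0 <= s <= s1 ->
          K (sigma s) /\
          mu (sigma s) = 2 / (kappa * r) * cos (kappa * s / 2 + a)].

Definition collapsing_radii : set R :=
  [set r | [/\ 0 < r, (r%:E < UR)%E & compatible_arc r]].

(* Lift to R of the part in the i-th circle of the set in the statement; the
   projection R -> R / (L i) Z being open, both have interior or neither. *)
Definition collapsing_set (i : 'I_m) : set R :=
  [set s | [/\ focal_disc i s = 0,
               derive1 (kap i) s = 0 /\ 0 < kap i s,
               derive1n 3 (gamma i) s + kap i s ^+ 2 *: derive1 (gamma i) s = 0
             & exists r : R, [/\ 0 < r, (r%:E < UR)%E &
                 derive1 (mus i) s ^+ 2 - mus i s * derive1n 2 (mus i) s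
                 = 1 / r ^+ 2]]].

End Radii.

(* Main.v *)
Require Import Defs.
From mathcomp Require Import all_boot all_order all_algebra.
From mathcomp Require Import all_classical all_reals all_analysis.
From mathcomp Require Import ring lra.

Set Implicit Arguments.
Unset Strict Implicit.
Unset Printing Implicit Defensive.

Import Order.TTheory GRing.Theory Num.Theory.
Import numFieldNormedType.Exports.

Local Open Scope ring_scope.
Local Open Scope classical_set_scope.

(** For a point [p] of space, consider on the curves the function
    [wsqdist p s = |p - pos s|^2 / weight s^2].  Its derivative is, up to a
    positive factor, [slope p s], and [p] is the image under the exponential map of a
    normal vector [w] at [q] exactly when [q] is a critical point of this function,
    with value [|w|^2] ([exp_at_critical], [exp_atK]).  The
    exponential map is therefore injective on the disc bundle of radius [r] iff
    every [p] has at most one critical point of value less than [r^2], and the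
    theorem is about pairs of critical points: how two of them can merge, and how
    the first pair appears when [r] grows.

    Merging.  With [u = |p - pos s|], the quotient [slope / u] is the Wronskian
    [u' weight - u weight'], and [u'' + kappa^2 u / 4 >= 0] holds whatever [p] is
    ([slope_sturm]).  Below the focal radius a critical point is either a
    nondegenerate minimum, or a point where [focal = weight'' + kappa^2 weight / 4]
    vanishes and near which [focal <= 0] ([critical_cases]).  In the second case
    Sturm comparison makes the Wronskian nondecreasing ([sturm_monotone]).  So
    either the slope changes sign once, strictly and uniformly in [p]
    ([slope_trapping]), and the critical point is a strict minimum which survives
    small moves of [p] ([strict_min_persists]); or [p] has a whole interval of
    critical points.  In that last case the interval is an arc of a circle on which
    [weight = 2 / (kappa r) cos (kappa s / 2 + a)] ([degenerate_collapse],
    [collapse_circle]).  Conversely all the points of such an arc are critical, with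
    value [r^2], for one point of space ([collapse_center]), so that the exponential
    map is not injective beyond [r].

    First pairs.  Let [r1] be at most the upper radius and suppose that no arc
    collapses below [r1].  For [rho < r1], the points [p] with two distinct critical
    points of values at most [rho^2] form a compact set, because two critical points
    cannot merge ([double_points_compact]).  Minimise there the larger of the two
    values.  Moving [p] towards the point which divides the segment between the
    two feet in the ratio of their weights decreases both weighted distances, and
    both critical points persist ([double_points_descent]).  Hence [p] is already
    that point and the two feet form a double critical pair, which is excluded below
    half of the double critical self distance.  The set is thus empty and the
    exponential map is injective below [r1] ([injective_below]); by compactness of
    the link its inverse is continuous ([injective_homeo]).

    Upper bounds.  The image of a disc bundle is open because every nearest point is
    critical ([image_open]), so [TIR <= AIR].  If a dense part of the disc bundle is
    mapped homeomorphically onto an open set, then by density every [(q, w)] of the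
    disc bundle has [q] as a nearest point of its image ([dense_homeo_minimizing]).
    This fails beyond the focal radius, where some critical point is a local
    maximum ([focal_nonmin]), and beyond half of the double critical self distance,
    where the point at equal weighted distance on the segment between a double
    critical pair can be pushed further ([double_critical_nonmin]); so [AIR <= UR].

    Altogether [min (UR, I) <= TIR <= AIR <= UR] and [TIR <= I], where [I] is the
    infimum of the collapsing radii, and all the claims follow. *)

(** * Euclidean inner product *)

Section Dot.
Context {R : realType} {n : nat}.
Implicit Types (u v w : 'rV[R]_n) (a : R).

Lemma dotrC u v : dotr u v = dotr v u.
Proof. by apply: eq_bigr => k _; rewrite mulrC. Qed.

Lemma dotrDl u v w : dotr (u + v) w = dotr u w + dotr v w.
Proof. by rewrite -big_split; apply: eq_bigr => k _; rewrite mxE mulrDl. Qed.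

Lemma dotrZl a u w : dotr (a *: u) w = a * dotr u w.
Proof. by rewrite /dotr mulr_sumr; apply: eq_bigr => k _; rewrite mxE mulrA. Qed.

Lemma dotrDr u v w : dotr u (v + w) = dotr u v + dotr u w.
Proof. by rewrite dotrC dotrDl 2![dotr _ u]dotrC. Qed.

Lemma dotrZr a u w : dotr u (a *: w) = a * dotr u w.
Proof. by rewrite dotrC dotrZl dotrC. Qed.

Lemma dotrNl u w : dotr (- u) w = - dotr u w.
Proof. by rewrite -scaleN1r dotrZl mulN1r. Qed.

Lemma dotrNr u w : dotr u (- w) = - dotr u w.
Proof. by rewrite dotrC dotrNl dotrC. Qed.

Lemma dotr0l w : dotr 0 w = 0.
Proof. by rewrite -(scale0r w) dotrZl mul0r. Qed.

Lemma dotr0r w : dotr w 0 = 0.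
Proof. by rewrite dotrC dotr0l. Qed.

Lemma dotr_ge0 u : 0 <= dotr u u.
Proof. by apply: sumr_ge0 => k _; rewrite -expr2 sqr_ge0. Qed.

Lemma dotr_eq0 u : dotr u u = 0 -> u = 0.
Proof.
move=> u0; apply/rowP => k; rewrite mxE.
have /psumr_eq0P : forall j : 'I_n, true -> 0 <= u 0 j * u 0 j.
  by move=> j _; rewrite -expr2 sqr_ge0.
by move=> /(_ u0 k isT)/eqP; rewrite mulf_eq0 orbb => /eqP.
Qed.

Lemma dotr_gt0 u : u != 0 -> 0 < dotr u u.
Proof.
by move=> u0; rewrite lt_def dotr_ge0 andbT; apply: contra_neq u0 => /dotr_eq0.
Qed.

Definition dotrE := (dotr0l, dotr0r, dotrDl, dotrDr, dotrNl, dotrNr, dotrZl, dotrZr).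

Lemma enorm_ge0 u : 0 <= enorm u.
Proof. exact: sqrtr_ge0. Qed.

Lemma enorm_sqr u : enorm u ^+ 2 = dotr u u.
Proof. by rewrite sqr_sqrtr// dotr_ge0. Qed.

Lemma enormZ a u : enorm (a *: u) = `|a| * enorm u.
Proof.
by rewrite /enorm dotrZl dotrZr mulrA -expr2 sqrtrM ?sqr_ge0// sqrtr_sqr.
Qed.

Lemma dotr_CauchySchwarz u v : dotr u v ^+ 2 <= dotr u u * dotr v v.
Proof.
have [->|v0] := eqVneq v 0.
  by rewrite dotrC dotr0l dotr0l expr0n mulr0.
have := dotr_ge0 (dotr v v *: u - dotr u v *: v).
have : 0 < dotr v v by exact: dotr_gt0.
rewrite !dotrE (dotrC v u) => vv H.
rewrite -subr_ge0 -(pmulr_rge0 _ vv); lra.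
Qed.

Lemma coord_le_enorm u (k : 'I_n) : `|u 0 k| <= enorm u.
Proof.
rewrite -sqrtr_sqr ler_wsqrtr// /dotr (bigD1 k)//= -expr2 lerDl.
by apply: sumr_ge0 => j _; rewrite -expr2 sqr_ge0.
Qed.

End Dot.

Lemma dotr_convex (R : realType) n (u v : 'rV[R]_n) (e : R) : 0 <= e <= 1 ->
  dotr ((1 - e) *: u + e *: v) ((1 - e) *: u + e *: v) <=
  (1 - e) * dotr u u + e * dotr v v.
Proof.
move=> /andP[e0 e1]; rewrite -subr_ge0.
have := dotr_ge0 (u - v); rewrite !dotrE (dotrC v u) => H.
have h : 0 <= e * (1 - e) by rewrite mulr_ge0// subr_ge0.
by have := mulr_ge0 h H; lra.
Qed.

(** * One-variable calculus *)

Section Derivation.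
Context {R : realType}.
Implicit Types (f g : R -> R) (s a b : R).

(** The derivation rules are restated for functions given pointwise, the form in
    which the formulas of differential geometry below are written. *)
Lemma derive_add f g s a b : is_derive s 1 f a -> is_derive s 1 g b ->
  is_derive s 1 (fun t => f t + g t) (a + b).
Proof. by move=> ? ?; apply: (@is_deriveD _ _ _ f g). Qed.

Lemma derive_opp f s a : is_derive s 1 f a -> is_derive s 1 (fun t => - f t) (- a).
Proof. by move=> ?; apply: (@is_deriveN _ _ _ f). Qed.

Lemma derive_mul f g s a b : is_derive s 1 f a -> is_derive s 1 g b ->
  is_derive s 1 (fun t => f t * g t) (a * g s + f s * b).
Proof.
move=> ? ?; have := @is_deriveM _ _ f g s 1 a b _ _.
by rewrite /GRing.scale/= addrC (mulrC a); exact.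
Qed.

Lemma derive_const a s : is_derive s 1 (fun _ : R => a) 0.
Proof. exact: is_derive_cst. Qed.

Lemma derive_self s : is_derive s (1 : R) (fun t : R => t) 1.
Proof. exact: is_derive_id. Qed.

Lemma derive_exp2 f s a : is_derive s 1 f a ->
  is_derive s 1 (fun t => f t ^+ 2) (2 * f s * a).
Proof.
move=> fa; have := derive_mul fa fa; rewrite (_ : a * _ + _ = 2 * f s * a)//.
by ring.
Qed.

Lemma derive_inv f s a : f s != 0 -> is_derive s 1 f a ->
  is_derive s 1 (fun t => (f t)^-1) (- (f s)^-2 * a).
Proof. by move=> f0 ?; exact: is_deriveV. Qed.

Lemma derive_scomp f g s a b : is_derive (g s) 1 f a -> is_derive s 1 g b ->
  is_derive s 1 (fun t => f (g t)) (a * b).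
Proof. by move=> ? ?; apply: (@is_derive1_comp _ f g). Qed.

Lemma derive_coord n (f : R -> 'rV[R]_n) (df : 'rV[R]_n) s k : is_derive s 1 f df ->
  is_derive s 1 (fun t => f t 0 k) (df 0 k).
Proof.
move=> [fd <-]; apply: DeriveDef; first exact: (derivable_mxP _ _ _).1.
by rewrite derive_mx// mxE.
Qed.

Lemma derive_row n (f : R -> 'rV[R]_n) (df : 'rV[R]_n) s :
  (forall k, is_derive s 1 (fun t => f t 0 k) (df 0 k)) -> is_derive s 1 f df.
Proof.
move=> H; have fd : derivable f s 1.
  by apply/derivable_mxP => i j; rewrite ord1; have [] := H j.
apply: DeriveDef => //.
by rewrite derive_mx//; apply/rowP => k; rewrite mxE; have [_ ->] := H k.
Qed.

Lemma derive_dotr n (f g : R -> 'rV[R]_n) (df dg : 'rV[R]_n) s :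
  is_derive s 1 f df -> is_derive s 1 g dg ->
  is_derive s 1 (fun t => dotr (f t) (g t)) (dotr df (g s) + dotr (f s) dg).
Proof.
move=> fd gd; rewrite /dotr -big_split/=.
have /(@is_derive_sum R _ _ n) H : forall k : 'I_n,
    is_derive s 1 (fun t => f t 0 k * g t 0 k)
      (df 0 k * g s 0 k + f s 0 k * dg 0 k).
  by move=> k; apply: derive_mul; exact: derive_coord.
move: H; congr (is_derive _ _ _ _).
by apply/funext => t; rewrite fct_sumE.
Qed.

Lemma derive_vadd n (f g : R -> 'rV[R]_n) s (a b : 'rV[R]_n) :
  is_derive s 1 f a -> is_derive s 1 g b ->
  is_derive s 1 (fun t => f t + g t) (a + b).
Proof. by move=> ? ?; apply: (@is_deriveD _ _ _ f g). Qed.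

Lemma derive_vopp n (f : R -> 'rV[R]_n) s (a : 'rV[R]_n) :
  is_derive s 1 f a -> is_derive s 1 (fun t => - f t) (- a).
Proof. by move=> ?; apply: (@is_deriveN _ _ _ f). Qed.

Lemma derive_vconst n (a : 'rV[R]_n) s : is_derive s (1 : R) (fun _ : R => a) 0.
Proof. exact: is_derive_cst. Qed.

Lemma derive_vscale n (f : R -> R) (g : R -> 'rV[R]_n) s a (b : 'rV[R]_n) :
  is_derive s 1 f a -> is_derive s 1 g b ->
  is_derive s 1 (fun t => f t *: g t) (a *: g s + f s *: b).
Proof.
move=> fa gb; apply: derive_row => k; rewrite !mxE.
have := derive_mul fa (derive_coord k gb); congr (is_derive _ _ _ _).
by apply/funext => t; rewrite mxE.
Qed.

Lemma derive_vcomp n (f : R -> 'rV[R]_n) (g : R -> R) s (a : 'rV[R]_n) b :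
  is_derive (g s) 1 f a -> is_derive s 1 g b ->
  is_derive s 1 (fun t => f (g t)) (b *: a).
Proof.
move=> fa gb; apply: derive_row => k; rewrite !mxE mulrC.
exact: derive_scomp (derive_coord k fa) gb.
Qed.

Lemma derive_cont (V : normedModType R) (f : R -> V) s (a : V) :
  is_derive s 1 f a -> f @ s --> f s.
Proof.
by move=> [fd _]; apply: differentiable_continuous; apply/derivable1_diffP.
Qed.

Lemma derive_uniq (V : normedModType R) (f : R -> V) s (a b : V) :
  is_derive s 1 f a -> is_derive s 1 f b -> a = b.
Proof. by move=> [_ <-] [_ <-]. Qed.

End Derivation.

Lemma derive_eq (R : realType) (V : normedModType R) (f : R -> V) (s : R)
    (a b : V) :
  is_derive s 1 f a -> a = b -> is_derive s 1 f b.
Proof. by move=> H <-. Qed.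

(** Applies the derivation rules guided by the syntax of the function, the
    derivative being an existential variable; [derive_eq] then replaces the
    derivative so computed by the expected one. *)
Ltac der :=
  repeat first
  [ eassumption
  | match goal with
      H : forall _, is_derive _ _ _ _ |- _ => eapply H end
  | eapply derive_const | eapply derive_vconst | eapply derive_self
  | eapply derive_add | eapply derive_opp | eapply derive_exp2
  | eapply derive_mul | eapply derive_dotr
  | eapply derive_vadd | eapply derive_vopp | eapply derive_vscale ].

Section MeanValue.
Context {R : realType}.
Implicit Types (f df : R -> R) (a b : R).

Lemma derive_MVT f df a b : a < b ->
  (forall x, a <= x <= b -> is_derive x 1 f (df x)) ->
  exists2 c, a < c < b & f b - f a = df c * (b - a).
Proof.
move=> ab fdf; have [||c cab fE] := @MVT R f df a b ab.
- by move=> x; rewrite in_itv/= => /andP[ax xb]; apply: fdf; rewrite !ltW.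
- apply: derivable_within_continuous => x; rewrite in_itv/= => xab.
  by have [] := fdf x xab.
- by exists c => //; rewrite in_itv/= in cab.
Qed.

Lemma derive_lt f df a b : a < b ->
  (forall x, a <= x <= b -> is_derive x 1 f (df x)) ->
  (forall x, a < x < b -> 0 < df x) -> f a < f b.
Proof.
move=> ab fdf df0; have [c cab fE] := derive_MVT ab fdf.
by rewrite -subr_gt0 fE mulr_gt0 ?df0// subr_gt0.
Qed.

Lemma derive_le f df a b : a <= b ->
  (forall x, a <= x <= b -> is_derive x 1 f (df x)) ->
  (forall x, a <= x <= b -> 0 <= df x) -> f a <= f b.
Proof.
rewrite le_eqVlt => /predU1P[->//|ab] fdf df0.
have [c /andP[ac cb] fE] := derive_MVT ab fdf.
by rewrite -subr_ge0 fE mulr_ge0 ?df0 ?subr_ge0 ?ltW.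
Qed.

Lemma derive0_cst f a b :
  (forall x, a < x < b -> is_derive x 1 f 0) ->
  forall s t, a < s < b -> a < t < b -> f s = f t.
Proof.
move=> f0; suff H s t : a < s < b -> a < t < b -> s < t -> f s = f t.
  move=> s t sab tab; have [st|ts|->//] := ltgtP s t; first exact: H.
  by apply/esym/H.
move=> /andP[a_s sb] /andP[at_ tb] st.
have [|c _] := @derive_MVT f (fun=> 0) s t st.
  by move=> x /andP[sx xt]; apply: f0; rewrite (lt_le_trans a_s)// (le_lt_trans xt).
by rewrite mul0r => /eqP; rewrite subr_eq0 => /eqP.
Qed.

Lemma derive0_vcst n (f : R -> 'rV[R]_n) a b :
  (forall x, a < x < b -> is_derive x 1 f 0) ->
  forall s t, a < s < b -> a < t < b -> f s = f t.
Proof.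
move=> f0 s t sab tab; apply/rowP => k.
apply: (@derive0_cst (fun t => f t 0 k) a b) => // x /f0 fx0.
by have := derive_coord k fx0; rewrite mxE.
Qed.

Lemma local_cst_derive (f : R -> R) a b c (d : R) : a < c < b ->
  (forall x, a < x < b -> f x = f c) -> is_derive c 1 f d -> d = 0.
Proof.
move=> cab fc dfc; apply: (@derive_uniq _ _ f c d 0) => //.
apply: near_eq_is_derive (derive_const (f c) c).
have cab' : c \in `]a, b[%R by rewrite in_itv.
by apply: filterS (near_in_itvoo cab') => x; rewrite /= in_itv/= => /fc.
Qed.

End MeanValue.

Lemma eq_on_derive (R : realType) (V : normedModType R) (f h : R -> V) (a b x : R)
    (df dh : V) : (forall y, a < y < b -> f y = h y) -> a < x < b ->
  is_derive x 1 f df -> is_derive x 1 h dh -> df = dh.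
Proof.
move=> fh xab fd hd; apply: derive_uniq hd.
have xab' : x \in `]a, b[%R by rewrite in_itv.
apply: near_eq_is_derive fd.
by apply: filterS (near_in_itvoo xab') => y; rewrite /= in_itv/=; exact: fh.
Qed.

Lemma near_itvP (R : realType) (x0 : R) (P : R -> Prop) : (\forall x \near x0, P x) ->
  exists2 e, 0 < e & forall x, x0 - e < x < x0 + e -> P x.
Proof.
move=> /nbhs_ballP[e e0 H]; exists e => // x /andP[x1 x2]; apply: H.
by rewrite /ball/= ltr_distlC; apply/andP; split; lra.
Qed.

Lemma polar_angle {R : realType} (x y : R) : x ^+ 2 + y ^+ 2 = 1 ->
  exists a, cos a = x /\ sin a = y.
Proof.
move=> xy; have x1 : -1 <= x <= 1.
  by rewrite -ler_norml -(@expr_le1 _ 2)// real_normK ?num_real// -xy lerDl sqr_ge0.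
have x1' : x \in `[-1, 1]%R by rewrite in_itv.
have yE : 1 - x ^+ 2 = y ^+ 2 by rewrite -xy; ring.
have [y0|y0] := leP 0 y.
  exists (acos x); rewrite acosK// sin_acos// yE sqrtr_sqr ger0_norm//.
exists (- acos x); rewrite cosN sinN acosK// sin_acos// yE sqrtr_sqr ltr0_norm//.
by rewrite opprK.
Qed.

Section Trig.
Context {R : realType}.
Implicit Types k s : R.

Lemma derive_cos_lin k s :
  is_derive s 1 (fun t : R => cos (k * t)) (- sin (k * s) * k).
Proof.
have dk : is_derive s 1 (fun t : R => k * t) k.
  by eapply derive_eq; [der|rewrite mul0r add0r mulr1].
exact: derive_scomp (is_derive_cos (k * s)) dk.
Qed.

Lemma derive_sin_lin k s :
  is_derive s 1 (fun t : R => sin (k * t)) (cos (k * s) * k).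
Proof.
have dk : is_derive s 1 (fun t : R => k * t) k.
  by eapply derive_eq; [der|rewrite mul0r add0r mulr1].
exact: derive_scomp (is_derive_sin (k * s)) dk.
Qed.
End Trig.

(** * Limits, compactness and partial derivatives *)

Lemma within_lt (R : realType) (T : topologicalType) (D : set T) (x : T)
    (f : T -> R) (a b : R) :
  f y @[y --> within D (nbhs x)] --> a -> a < b ->
  \forall y \near x, D y -> f y < b.
Proof. by move=> fa ab; have := cvgr_lt _ fa _ ab; exact. Qed.

Lemma within_gt (R : realType) (T : topologicalType) (D : set T) (x : T)
    (f : T -> R) (a b : R) :
  f y @[y --> within D (nbhs x)] --> a -> b < a ->
  \forall y \near x, D y -> b < f y.
Proof. by move=> fa ab; have := cvgr_gt _ fa _ ab; exact. Qed.

Lemma closure_le (R : realType) (T : topologicalType) (A : set T) (f : T -> R) z c :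
  closure A z -> f y @[y --> z] --> f z -> (forall y, A y -> f y <= c) -> f z <= c.
Proof.
move=> Az fz Ac; rewrite leNgt; apply/negP => cf.
have [y [Ay]] := Az _ (cvgr_gt _ fz _ cf).
by rewrite /= ltNge Ac.
Qed.

Lemma cvg_dotr {R : realType} {n : nat} {T : Type} (F : set_system T)
    (FF : Filter F) (f h : T -> 'rV[R]_n) (a b : 'rV[R]_n) :
  f x @[x --> F] --> a -> h x @[x --> F] --> b ->
  dotr (f x) (h x) @[x --> F] --> dotr a b.
Proof.
move=> fa hb; apply: cvg_big => [|k _]; first exact: add_continuous.
have cc (f' : T -> 'rV[R]_n) (c : 'rV[R]_n) : f' x @[x --> F] --> c ->
    f' x 0 k @[x --> F] --> c 0 k.
  by move=> f'c; exact: (continuous_cvg FF (@coord_continuous R 1 n 0 k c) f'c).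
by apply: cvgM; exact: cc.
Qed.

(** Closed and bounded: the sup norm, which defines the topology, is at most the
    Euclidean norm. *)
Lemma compact_dotr_le (R : realType) n (c : R) :
  compact [set v : 'rV[R]_n | dotr v v <= c].
Proof.
apply: bounded_closed_compact.
  exists (Num.sqrt c); split; first exact: num_real.
  move=> x cx v /= vc; apply: le_trans (ltW cx).
  rewrite /Num.Def.normr/= mx_normrE; apply: bigmax_le => [|[a k] _ /=].
    exact: sqrtr_ge0.
  rewrite ord1; apply: le_trans (coord_le_enorm v k) _.
  by rewrite ler_wsqrtr.
move=> v Av; apply: (closure_le (f := fun v => dotr v v) Av) => //.
have vv : u @[u --> v] --> v by exact: cvg_id.
exact: (cvg_dotr _ vv vv).
Qed.

(** The tube lemma for a segment. *)
Lemma near_segment {R : realType} {n : nat} (f : 'rV[R]_n -> R -> R) (a b : R)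
    (p0 : 'rV[R]_n) :
  (forall t, a <= t <= b -> f z.1 z.2 @[z --> (p0, t)] --> f p0 t) ->
  (forall t, a <= t <= b -> 0 < f p0 t) ->
  \forall p \near p0, forall t, a <= t <= b -> 0 < f p t.
Proof.
move=> fc f0.
have [] := @compact_near_coveringP R `[a, b]; move=> /(_ (@segment_compact _ a b)).
move=> /(_ _ (nbhs p0) (fun p t => 0 < f p t) _) H _.
have {}H : \forall p \near p0, `[a, b] `<=` (fun t => 0 < f p t).
  apply: H => t; rewrite /= in_itv/= => tab.
  have [[A B] /= [nA nB] AB] := cvgr_gt _ (fc t tab) _ (f0 t tab).
  by exists (B, A) => // -[t' p'] /= [Bt Ap]; exact: (AB (p', t')).
by apply: filterS H => p H t tab; apply: H; rewrite /= in_itv.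
Qed.

Section Partials.
Context {R : realType}.
Variables (F : R * R -> R) (s t : R).

Lemma partial1 : differentiable F (s, t) ->
  is_derive s 1 (fun u => F (u, t)) ('d F (s, t) (1, 0)).
Proof.
move=> dF; have D1 : is_diff s (fun u : R => (u, t)) (fun h : R => (h, 0 : R)).
  exact: (@is_diff_pair _ _ _ _ id id (cst t) (fun=> 0)).
have D2 : is_diff s (F \o (fun u : R => (u, t))) ('d F (s, t) \o (fun h : R => (h, 0 : R))).
  by apply: is_diff_comp; exact: DiffDef.
have [d2 e2] := D2; apply: DeriveDef; first exact/derivable1_diffP.
by rewrite deriveE// [fun u => F (u, t)](_ : _ = F \o (fun u => (u, t)))// e2.
Qed.

Lemma partial2 : differentiable F (s, t) ->
  is_derive t 1 (fun u => F (s, u)) ('d F (s, t) (0, 1)).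
Proof.
move=> dF; have D1 : is_diff t (fun u : R => (s, u)) (fun h : R => (0 : R, h)).
  exact: (@is_diff_pair _ _ _ _ (cst s) (fun=> 0) id id).
have D2 : is_diff t (F \o (fun u : R => (s, u))) ('d F (s, t) \o (fun h : R => (0 : R, h))).
  by apply: is_diff_comp; exact: DiffDef.
have [d2 e2] := D2; apply: DeriveDef; first exact/derivable1_diffP.
by rewrite deriveE// [fun u => F (s, u)](_ : _ = F \o (fun u => (s, u)))// e2.
Qed.

Lemma is_diff0P a b : differentiable F (s, t) ->
  is_derive s 1 (fun u => F (u, t)) a -> is_derive t 1 (fun u => F (s, u)) b ->
  is_diff (s, t) F (fun=> 0) <-> a = 0 /\ b = 0.
Proof.
move=> dF da db.
have aE := derive_uniq da (partial1 dF); have bE := derive_uniq db (partial2 dF).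
split=> [[_ dF0]|[a0 b0]]; first by rewrite aE bE dF0.
apply: DiffDef => //; apply/funext => -[h k].
have -> : (h, k) = h *: (1, 0) + k *: (0, 1) :> R * R.
  by congr pair; rewrite /= /GRing.scale/= !mulr1 !mulr0 ?addr0 ?add0r.
by rewrite linearD !linearZ/= -aE -bE a0 b0 !scaler0 addr0.
Qed.

End Partials.

Lemma ereal_between (R : realType) (x y : \bar R) : (0 <= x)%E -> (x < y)%E ->
  exists2 r : R, (x < r%:E)%E & (r%:E < y)%E.
Proof.
case: x => [x| |] //= x0; case: y => [y| |] //= xy.
  rewrite lte_fin in xy.
  by exists ((x + y) / 2); rewrite lte_fin; lra.
by exists (x + 1); rewrite ?ltry// lte_fin; lra.
Qed.

(** * Weighted distance to a weighted curve *)

(** A closed curve with a positive weight.  The derivatives are separate fields so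
    that algebraic computations treat them as independent symbols. *)
Record weighted_curve (R : realType) (n : nat) : Type := WeightedCurve {
  pos : R -> 'rV[R]_n ; pos1 : R -> 'rV[R]_n ; pos2 : R -> 'rV[R]_n ;
  pos3 : R -> 'rV[R]_n ;
  weight : R -> R ; weight1 : R -> R ; weight2 : R -> R ;
  period : R ;
  derive_pos : forall s : R, is_derive s 1 pos (pos1 s) ;
  derive_pos1 : forall s : R, is_derive s 1 pos1 (pos2 s) ;
  derive_pos2 : forall s : R, is_derive s 1 pos2 (pos3 s) ;
  derive_weight : forall s : R, is_derive s 1 weight (weight1 s) ;
  derive_weight1 : forall s : R, is_derive s 1 weight1 (weight2 s) ;
  continuous_weight2 : continuous weight2 ;
  unit_speed : forall s, dotr (pos1 s) (pos1 s) = 1 ;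
  weight_gt0 : forall s, 0 < weight s ;
  period_gt0 : 0 < period ;
  pos_periodic : forall s, pos (s + period) = pos s ;
  weight_periodic : forall s, weight (s + period) = weight s }.

Section Curve.
Context {R : realType} {n : nat}.
Variable C : weighted_curve R n.
Implicit Types (p : 'rV[R]_n) (s t : R).

Local Notation g := (pos C).
Local Notation g1 := (pos1 C).
Local Notation g2 := (pos2 C).
Local Notation g3 := (pos3 C).
Local Notation m := (weight C).
Local Notation m1 := (weight1 C).
Local Notation m2 := (weight2 C).

Definition sqdist p s : R := dotr (p - g s) (p - g s).

Definition wsqdist p s : R := sqdist p s / m s ^+ 2.

(** Half of [weight^3] times the derivative of [wsqdist p]: it has no denominator
    and the same zeros and signs. *)
Definition slope p s : R := - (dotr (p - g s) (g1 s) * m s + sqdist p s * m1 s).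

Definition dslope p s : R :=
  m s - m s * dotr (p - g s) (g2 s) + m1 s * dotr (p - g s) (g1 s)
  - sqdist p s * m2 s.

(** The defect of the weight in the equation [y'' + (kappa / 2)^2 y = 0], which governs
    the comparison in [slope_sturm]. *)
Definition focal s : R := m2 s + 4^-1 * dotr (g2 s) (g2 s) * m s.

Let Dg := derive_pos C.
Let Dg1 := derive_pos1 C.
Let Dg2 := derive_pos2 C.
Let Dm := derive_weight C.
Let Dm1 := derive_weight1 C.
Let m_gt0 := weight_gt0 C.
Let speed := unit_speed C.

Lemma dotr_g12 s : dotr (g1 s) (g2 s) = 0.
Proof.
have : is_derive s 1 (fun t => dotr (g1 t) (g1 t))
   (dotr (g2 s) (g1 s) + dotr (g1 s) (g2 s)) by der.
rewrite (_ : (fun _ => _) = fun=> 1); last by apply/funext.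
by move/(derive_uniq (derive_const 1 s)); rewrite dotrC; lra.
Qed.

Lemma derive_sqdist p s :
  is_derive s 1 (sqdist p) (- 2 * dotr (p - g s) (g1 s)).
Proof.
rewrite /sqdist; eapply derive_eq; first by der.
by cbv beta; move: (p - g s) => d; rewrite !dotrE (dotrC (g1 s)); ring.
Qed.

Lemma derive_wsqdist p s :
  is_derive s 1 (wsqdist p) (2 * slope p s / m s ^+ 3).
Proof.
have mN0 : m s ^+ 2 != 0 by rewrite expf_neq0// gt_eqF.
have De := derive_sqdist p s.
have Di := derive_inv (f := fun t => m t ^+ 2) mN0 (derive_exp2 (Dm s)).
apply: derive_eq (derive_mul De Di) _.
by rewrite /slope; field; rewrite gt_eqF.
Qed.

Lemma derive_slope p s : is_derive s 1 (slope p) (dslope p s).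
Proof.
have De := derive_sqdist p s.
rewrite /slope; eapply derive_eq.
  by eapply derive_opp, derive_add; [eapply derive_mul; [der|exact: Dm]|eapply derive_mul;
    [exact: De|exact: Dm1]].
cbv beta; rewrite /dslope; move: (p - g s) (sqdist p s) => d e; rewrite !dotrE speed; ring.
Qed.

Lemma sqdist_ge0 p s : 0 <= sqdist p s. Proof. exact: dotr_ge0. Qed.

Lemma wsqdist_ge0 p s : 0 <= wsqdist p s.
Proof. by rewrite divr_ge0 ?sqdist_ge0// sqr_ge0. Qed.

Lemma sqdistE p s : sqdist p s = wsqdist p s * m s ^+ 2.
Proof. by rewrite /wsqdist divfK// expf_neq0// gt_eqF. Qed.

Definition normal_part p s : 'rV[R]_n := (p - g s) - dotr (p - g s) (g1 s) *: g1 s.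

(** With [u = |p - pos s|], the left side is [u^3] times the derivative of the
    Wronskian [slope / u = u' weight - u weight'], and the square is
    [u^3 (u'' + kappa^2 u / 4)].  So [u] is always a supersolution of the
    equation of which [focal] measures the defect for the weight. *)
Lemma slope_sturm p s :
  dslope p s * sqdist p s + slope p s * dotr (p - g s) (g1 s) =
  m s * dotr (normal_part p s - (sqdist p s / 2) *: g2 s)
             (normal_part p s - (sqdist p s / 2) *: g2 s) - sqdist p s ^+ 2 * focal s.
Proof.
rewrite /normal_part /dslope /slope /focal /sqdist; move: (p - g s) => d.
rewrite !dotrE speed dotr_g12 !(dotrC _ d) (dotrC (g2 s) (g1 s)) dotr_g12.
by field.
Qed.

End Curve.

(** * Degenerate critical points *)

Section Critical.
Context {R : realType} {n : nat}.
Variable C : weighted_curve R n.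
Implicit Types (p : 'rV[R]_n) (s t : R).

Local Notation g := (pos C).
Local Notation g1 := (pos1 C).
Local Notation g2 := (pos2 C).
Local Notation g3 := (pos3 C).
Local Notation m := (weight C).
Local Notation m1 := (weight1 C).
Local Notation m2 := (weight2 C).

Let m_gt0 := weight_gt0 C.
Let speed := unit_speed C.

Definition curv2 s : R := dotr (g2 s) (g2 s).

(** The function [Lambda] of the focal radius, as a sum of squares. *)
Definition focal_sqr s : R :=
  m1 s ^+ 2 + (2^-1 * enorm (g2 s) * m s + Num.sqrt (m s * focal C s)) ^+ 2.

(** The value of [focal_sqr] where [focal = 0]; it is [1 / r^2] along an arc
    collapsing at the distance [r]. *)
Definition collapse_sqr s : R := m1 s ^+ 2 + 4^-1 * curv2 s * m s ^+ 2.

Lemma wsqdist_lt p s (r : R) :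
  (wsqdist C p s < r) = (sqdist C p s < r * m s ^+ 2).
Proof. by rewrite /wsqdist ltr_pdivrMr// exprn_gt0. Qed.

Lemma wsqdist_gt0 p s : (0 < wsqdist C p s) = (0 < sqdist C p s).
Proof. by rewrite /wsqdist pmulr_lgt0// invr_gt0 exprn_gt0. Qed.

Lemma slope0 p s : slope C p s = 0 ->
  dotr (p - g s) (g1 s) = - (wsqdist C p s * m s * m1 s).
Proof.
rewrite /slope sqdistE => H.
apply: (mulIf (lt0r_neq0 (m_gt0 s))); apply/eqP; rewrite -subr_eq0; apply/eqP.
by move: H; lra.
Qed.

Lemma dotr_normal_part p s :
  dotr (normal_part C p s) (normal_part C p s) = sqdist C p s - dotr (p - g s) (g1 s) ^+ 2.
Proof.
rewrite /normal_part /sqdist; move: (p - g s) => d.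
by rewrite !dotrE speed (dotrC (g1 s)); ring.
Qed.

Lemma normal_part_tangent p s : dotr (normal_part C p s) (g1 s) = 0.
Proof.
by rewrite /normal_part; move: (p - g s) => d; rewrite !dotrE speed; ring.
Qed.

Lemma dslope_le0 p s : slope C p s = 0 -> dslope C p s <= 0 ->
  m s * dotr (normal_part C p s - (sqdist C p s / 2) *: g2 s)
             (normal_part C p s - (sqdist C p s / 2) *: g2 s)
    <= sqdist C p s ^+ 2 * focal C s.
Proof.
move=> s0 ds0; have := slope_sturm C p s; rewrite s0.
rewrite mul0r addr0 -subr_le0 => <-.
by rewrite mulr_le0_ge0// sqdist_ge0.
Qed.

Lemma slope0_sqdist_gt0 p s : dslope C p s <= 0 -> 0 < sqdist C p s.
Proof.
move=> ds0; rewrite lt_def sqdist_ge0 andbT; apply/eqP => e0.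
have /eqP := dotr_eq0 e0; rewrite subr_eq0 => /eqP pg; move: ds0.
rewrite /dslope e0 pg subrr !dotr0l !mulr0 mul0r subr0 addr0 subr0.
by rewrite leNgt m_gt0.
Qed.

(** At a critical point [slope_sturm] reads [dslope * sqdist] equals a nonnegative
    term minus [sqdist^2 * focal]; so degeneracy requires [focal >= 0]. *)
Lemma focal_ge0 p s : slope C p s = 0 -> dslope C p s <= 0 -> 0 <= focal C s.
Proof.
move=> s0 ds0; have e0 := slope0_sqdist_gt0 ds0.
have H := dslope_le0 s0 ds0.
rewrite -(pmulr_rge0 _ (exprn_gt0 2 e0)); apply: le_trans H.
by rewrite mulr_ge0 ?dotr_ge0// ltW.
Qed.

(** Equality case of [focal_ge0]: the square in [slope_sturm] vanishes. *)
Lemma collapse_normal_part p s : slope C p s = 0 -> dslope C p s <= 0 ->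
  focal C s = 0 -> normal_part C p s = (sqdist C p s / 2) *: g2 s.
Proof.
move=> s0 ds0 f0; have := dslope_le0 s0 ds0; rewrite f0 mulr0.
rewrite pmulr_rle0// => H; apply/eqP; rewrite -subr_eq0; apply/eqP/dotr_eq0.
by apply/eqP; rewrite eq_le H dotr_ge0.
Qed.

Lemma collapse_radius p s : slope C p s = 0 -> dslope C p s <= 0 ->
  focal C s = 0 -> wsqdist C p s * collapse_sqr s = 1.
Proof.
move=> s0 ds0 f0; have e0 := slope0_sqdist_gt0 ds0.
have := dotr_normal_part p s; rewrite slope0// collapse_normal_part// !dotrE -/(curv2 s).
move: e0; rewrite -wsqdist_gt0 sqdistE /collapse_sqr.
move: (m_gt0 s); move: (wsqdist C p s) (m s) (m1 s) (curv2 s).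
move=> w mm a k mm0 w0 H.
have : w * mm ^+ 2 * (w * (a ^+ 2 + 4^-1 * k * mm ^+ 2) - 1) = 0.
  transitivity (w * mm ^+ 2 / 2 * (w * mm ^+ 2 / 2 * k)
      - (w * mm ^+ 2 - (- (w * mm * a)) ^+ 2)); last by rewrite H subrr.
  by field.
have wN0 : w * mm ^+ 2 != 0 by rewrite mulf_neq0 ?expf_neq0 ?gt_eqF.
move=> /eqP; rewrite mulf_eq0 (negPf wN0)/= subr_eq0 => /eqP.
by [].
Qed.

(** Bounds from below the distance to a critical point which is not a nondegenerate
    minimum.  By [slope_sturm] the normal part of [p -
      pos s] is [sqdist / 2 *: pos2] up to an error of norm at
    most [sqdist * sqrt (focal / weight)], and the triangle inequality bounds the
    norm of the normal part, which the criticality of [s] determines. *)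
Lemma focal_sqrP p s : slope C p s = 0 -> dslope C p s <= 0 ->
  0 < focal C s -> 1 <= wsqdist C p s * focal_sqr s.
Proof.
move=> s0 ds0 f0; have e0 := slope0_sqdist_gt0 ds0.
have := dslope_le0 s0 ds0; set v := _ - _ => H.
have w0 := e0; rewrite -wsqdist_gt0 in w0.
have nE : normal_part C p s = v + (sqdist C p s / 2) *: g2 s by rewrite /v subrK.
clearbody v.
have := dotr_normal_part p s; rewrite slope0// nE !dotrE (dotrC (g2 s)).
have := dotr_CauchySchwarz v (g2 s); rewrite -(enorm_sqr v) -(enorm_sqr (g2 s)).
move: H; rewrite -(enorm_sqr v) /focal_sqr.
have S0 : 0 <= m s * focal C s by rewrite mulr_ge0// ltW.
have SE := sqr_sqrtr S0.
move: SE w0; rewrite sqdistE.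
move: (m_gt0 s) (sqrtr_ge0 (m s * focal C s)) (enorm_ge0 v) (enorm_ge0 (g2 s)).
move: (Num.sqrt (m s * focal C s)) => S.
move: (enorm v) (enorm (g2 s)) (dotr v (g2 s)) (focal C s) f0.
move: (m s) (m1 s) (wsqdist C p s).
move=> mm a w x k d f f0 mm0 S0' x0 k0 SE w0 H1 H2 H3.
have xS : mm * x <= w * mm ^+ 2 * S.
  have [mmW wW] := (ltW mm0, ltW w0).
  rewrite -ler_sqr ?nnegrE ?mulr_ge0 ?exprn_ge0//.
  rewrite [leRHS]exprMn SE [leLHS](_ : _ = mm * (mm * x ^+ 2)); last by ring.
  by rewrite [leRHS](_ : _ = mm * ((w * mm ^+ 2) ^+ 2 * f)) ?ler_pM2l//; ring.
have dk : d <= x * k.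
  rewrite -exprMn in H2; apply: le_trans (ler_norm d) _.
  by rewrite -ler_sqr ?nnegrE ?mulr_ge0// real_normK// num_real.
have N2 : w * mm ^+ 2 - (w * mm * a) ^+ 2 <= (x + w * mm ^+ 2 / 2 * k) ^+ 2.
  have -> : w * mm ^+ 2 - (w * mm * a) ^+ 2 =
    x ^+ 2 + w * mm ^+ 2 * d + (w * mm ^+ 2 / 2 * k) ^+ 2.
    move: H3; rewrite sqrrN => <-; by field.
  have wm : 0 < w * mm ^+ 2 by rewrite mulr_gt0 ?exprn_gt0.
  have : w * mm ^+ 2 * d <= w * mm ^+ 2 * (x * k) by rewrite ler_pM2l.
  by move=> ?; rewrite sqrrD; lra.
have N3 : (mm * (x + w * mm ^+ 2 / 2 * k)) ^+ 2 <= (w * mm ^+ 2 * (2^-1 * k * mm + S)) ^+ 2.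
  have wm : 0 <= w * mm ^+ 2 by rewrite mulr_ge0 ?(ltW w0) ?exprn_ge0 ?(ltW mm0).
  have h2 : (0:R) <= 2^-1 by rewrite invr_ge0.
  rewrite ler_sqr ?nnegrE; first by lra.
    by rewrite !(mulr_ge0,addr_ge0)// ltW.
  by rewrite !(mulr_ge0,addr_ge0)// ltW.
have W : 0 < w * mm ^+ 4 by rewrite mulr_gt0 ?exprn_gt0.
have m20 : 0 < mm ^+ 2 by rewrite exprn_gt0.
have {}N2 : mm ^+ 2 * (w * mm ^+ 2 - (w * mm * a) ^+ 2) <=
    (mm * (x + w * mm ^+ 2 / 2 * k)) ^+ 2.
  by rewrite [leRHS]exprMn ler_pM2l.
have N4 := le_trans N2 N3; rewrite -subr_ge0 in N4.
rewrite -subr_ge0 -(pmulr_rge0 _ W). apply: le_trans N4 _.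
by rewrite le_eqVlt; apply/orP; left; apply/eqP; field.
Qed.

Lemma collapse_le_focal s : collapse_sqr s <= focal_sqr s.
Proof.
rewrite /collapse_sqr /focal_sqr lerD2l /curv2 -enorm_sqr.
rewrite (_ : _ * _ = (2^-1 * enorm (g2 s) * m s) ^+ 2); last by field.
have h : 0 <= 2^-1 * enorm (g2 s) * m s.
  by rewrite !mulr_ge0 ?enorm_ge0 ?invr_ge0// ltW.
by rewrite ler_sqr ?nnegrE ?addr_ge0 ?sqrtr_ge0// lerDl sqrtr_ge0.
Qed.

(** Sturm comparison: the Wronskian of [|p - pos s|] and the weight is nondecreasing
    where [focal <= 0]. *)
Lemma sturm_monotone p (a b : R) : a <= b ->
  (forall x, a <= x <= b -> 0 < sqdist C p x /\ focal C x <= 0) ->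
  slope C p a / Num.sqrt (sqdist C p a) <= slope C p b / Num.sqrt (sqdist C p b).
Proof.
move=> ab H.
pose dk s := (dslope C p s * sqdist C p s + slope C p s * dotr (p - g s) (g1 s))
   / (sqdist C p s * Num.sqrt (sqdist C p s)).
apply: (@derive_le _ (fun s => slope C p s / Num.sqrt (sqdist C p s)) dk) => // s /H[e0 f0].
  have De := derive_sqdist C p s.
  have Ds := derive_scomp (is_derive1_sqrt e0) De.
  have q0 : 0 < Num.sqrt (sqdist C p s) by rewrite sqrtr_gt0.
  have qN0 : Num.sqrt (sqdist C p s) != 0 by rewrite gt_eqF.
  have Di := derive_inv (f := fun t => Num.sqrt (sqdist C p t)) qN0 Ds.
  apply: derive_eq (derive_mul (derive_slope C p s) Di) _.
  rewrite /dk; cbv beta; move: qN0 (esym (sqr_sqrtr (ltW e0))).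
  move: (Num.sqrt _) (slope C p s) (dslope C p s) (dotr _ _) => q sl dsl u.
  by move: (sqdist C p s) => E qN0 ->; field.
rewrite /dk slope_sturm divr_ge0 ?mulr_ge0 ?sqrtr_ge0 ?sqdist_ge0// subr_ge0.
apply: (@le_trans _ _ 0); first by rewrite mulr_ge0_le0// sqr_ge0.
by rewrite mulr_ge0 ?dotr_ge0// ltW.
Qed.

End Critical.

(** * Persistence of strict minima *)

Section Persistence.
Context {R : realType} {n : nat}.
Variable C : weighted_curve R n.
Implicit Types (p : 'rV[R]_n) (s t : R).

Local Notation g := (pos C).
Local Notation g1 := (pos1 C).
Local Notation g2 := (pos2 C).
Local Notation m := (weight C).
Local Notation m1 := (weight1 C).
Local Notation m2 := (weight2 C).

Let m_gt0 := weight_gt0 C.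

Section Continuity.
Context {T : Type} (F : set_system T) (FF : Filter F).
Variables (P : T -> 'rV[R]_n) (S : T -> R) (p0 : 'rV[R]_n) (s0 : R).
Hypotheses (Pp : P z @[z --> F] --> p0) (Ss : S z @[z --> F] --> s0).

Lemma cvg_along (V : normedModType R) (f : R -> V) (df : V) :
  is_derive s0 1 f df -> f (S z) @[z --> F] --> f s0.
Proof. by move=> /derive_cont fc; apply: continuous_cvg Ss. Qed.

Lemma cvg_chord : P z - g (S z) @[z --> F] --> p0 - g s0.
Proof. by apply: cvgB => //; exact: cvg_along (derive_pos C s0). Qed.

Lemma cvg_sqdist : sqdist C (P z) (S z) @[z --> F] --> sqdist C p0 s0.
Proof. by apply: cvg_dotr; exact: cvg_chord. Qed.

Lemma cvg_wsqdist : wsqdist C (P z) (S z) @[z --> F] --> wsqdist C p0 s0.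
Proof.
have mz := cvg_along (derive_weight C s0).
apply: cvgM; first exact: cvg_sqdist.
by apply: cvgV; [rewrite expf_neq0// gt_eqF|apply: cvgM].
Qed.

Lemma cvg_slope : slope C (P z) (S z) @[z --> F] --> slope C p0 s0.
Proof.
apply: cvgN; apply: cvgD; apply: cvgM.
- by apply: cvg_dotr; [exact: cvg_chord|exact: cvg_along (derive_pos1 C s0)].
- exact: cvg_along (derive_weight C s0).
- exact: cvg_sqdist.
- exact: cvg_along (derive_weight1 C s0).
Qed.

Lemma cvg_dslope : dslope C (P z) (S z) @[z --> F] --> dslope C p0 s0.
Proof.
have m2z : m2 (S z) @[z --> F] --> m2 s0.
  by apply: continuous_cvg Ss; exact: continuous_weight2.
have mz := cvg_along (derive_weight C s0).
have chord := cvg_chord.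
apply: cvgB; last by apply: cvgM => //; exact: cvg_sqdist.
apply: cvgD; last first.
  apply: cvgM; first exact: cvg_along (derive_weight1 C s0).
  by apply: cvg_dotr => //; exact: cvg_along (derive_pos1 C s0).
apply: cvgB => //; apply: cvgM => //.
by apply: cvg_dotr => //; exact: cvg_along (derive_pos2 C s0).
Qed.

Lemma cvg_collapse_sqr : collapse_sqr C (S z) @[z --> F] --> collapse_sqr C s0.
Proof.
have m1z := cvg_along (derive_weight1 C s0).
have mz := cvg_along (derive_weight C s0).
have g2z := cvg_along (derive_pos2 C s0).
apply: cvgD; first by apply: cvgM.
apply: cvgM; last by apply: cvgM.
by apply: cvgM; [exact: cvg_cst|exact: cvg_dotr].
Qed.

Lemma cvg_focal_sqr : focal_sqr C (S z) @[z --> F] --> focal_sqr C s0.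
Proof.
have m2z : m2 (S z) @[z --> F] --> m2 s0.
  by apply: continuous_cvg Ss; exact: continuous_weight2.
have m1z := cvg_along (derive_weight1 C s0).
have mz := cvg_along (derive_weight C s0).
have g2z := cvg_along (derive_pos2 C s0).
have sqrt_cvg (f : T -> R) a : f z @[z --> F] --> a ->
    Num.sqrt (f z) @[z --> F] --> Num.sqrt a.
  by move=> fa; apply: continuous_cvg fa; exact: sqrt_continuous.
have foc : focal C (S z) @[z --> F] --> focal C s0.
  apply: cvgD => //; apply: cvgM => //; apply: cvgM; first exact: cvg_cst.
  exact: cvg_dotr.
have root_cvg : 2^-1 * enorm (g2 (S z)) * m (S z) + Num.sqrt (m (S z) * focal C (S z))
    @[z --> F] --> 2^-1 * enorm (g2 s0) * m s0 + Num.sqrt (m s0 * focal C s0).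
  apply: cvgD.
    apply: cvgM => //; apply: cvgM; first exact: cvg_cst.
    by apply: sqrt_cvg; exact: cvg_dotr.
  by apply: sqrt_cvg; exact: cvgM.
by apply: cvgD; apply: cvgM.
Qed.

End Continuity.

(** For all points near [p0], the slope near [s0] changes sign at most once and from
    negative to positive; in particular there is at most one critical point
    near [s0]. *)
Definition trapping p0 s0 := exists U e, [/\ nbhs p0 U, 0 < e &
  forall p, U p -> forall s t, s0 - e < s -> s < t -> t < s0 + e ->
    0 <= slope C p s -> 0 < slope C p t].

Lemma near_box p0 s0 (A : 'rV[R]_n -> R -> Prop) :
  (\forall z \near (p0, s0), A z.1 z.2) ->
  exists U e, [/\ nbhs p0 U, 0 < e &
    forall p s, U p -> s0 - e < s < s0 + e -> A p s].
Proof.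
move=> [[U V] /= [nU /nbhs_ballP[e /= e0 eV]] UV].
exists U, e; split => // p s Up /andP[s1 s2]; apply: (UV (p, s)); split => //=.
by apply: eV; rewrite /ball/= ltr_distlC; apply/andP; split; lra.
Qed.

(** The nondegenerate case: the slope is increasing near [(p0, s0)]. *)
Lemma dslope_trapping p0 s0 : 0 < dslope C p0 s0 -> trapping p0 s0.
Proof.
move=> ds0.
have [|U [e [nU e0 H]]] := @near_box p0 s0 (fun p s => 0 < dslope C p s).
  have H : dslope C z.1 z.2 @[z --> (p0, s0)] --> dslope C p0 s0.
    by apply: cvg_dslope; [exact: cvg_fst|exact: cvg_snd].
  exact: cvgr_gt _ H _ ds0.
exists U, e; split => // p Up s t s1 st t1; move/le_lt_trans; apply.
apply: (@derive_lt _ (slope C p) (dslope C p)) => // x; first by move=> _; exact: derive_slope.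
by move=> /andP[sx xt]; apply: H => //; apply/andP; split; lra.
Qed.

Definition no_collapse (r : R) := forall p a b, a < b ->
  (forall x, a <= x <= b -> slope C p x = 0 /\ wsqdist C p x < r ^+ 2) -> False.

Definition focal_bound (r : R) := forall s, 0 < focal C s ->
  focal_sqr C s * r ^+ 2 <= 1.

(** Where [focal > 0], the focal bound and [collapse_le_focal] would force
    [collapse_sqr * r^2 <= 1], which fails near [s0]. *)
Lemma focal_le0_near s0 (r : R) : focal_bound r ->
  1 < collapse_sqr C s0 * r ^+ 2 ->
  \forall s \near s0, focal C s <= 0.
Proof.
move=> fr q0; have cq : collapse_sqr C s * r ^+ 2 @[s --> s0] -->
    collapse_sqr C s0 * r ^+ 2.
  by apply: cvgM; [apply: cvg_collapse_sqr; exact: cvg_id|exact: cvg_cst].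
apply: filterS (cvgr_gt _ cq _ q0) => s; rewrite leNgt; apply: contraTN => f0.
rewrite -leNgt; apply: le_trans (fr s f0).
by rewrite ler_wpM2r ?sqr_ge0// collapse_le_focal.
Qed.

(** The alternative to a nondegenerate minimum below the focal radius.  A positive
    [focal] contradicts [focal_sqrP]; so [focal = 0] and [collapse_radius] puts
    [s0] in the scope of [focal_le0_near]. *)
Lemma critical_cases p0 s0 (r : R) : focal_bound r ->
  slope C p0 s0 = 0 -> wsqdist C p0 s0 < r ^+ 2 -> dslope C p0 s0 <= 0 ->
  [/\ focal C s0 = 0, wsqdist C p0 s0 * collapse_sqr C s0 = 1 &
      \forall s \near s0, focal C s <= 0].
Proof.
move=> fr sl0 wr ds0; have e0 := slope0_sqdist_gt0 ds0.
rewrite -wsqdist_gt0 in e0.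
have f0 : focal C s0 = 0.
  apply/eqP; rewrite eq_le (focal_ge0 sl0 ds0) andbT leNgt; apply/negP => f0.
  have q1 := focal_sqrP sl0 ds0 f0; have q2 := fr _ f0.
  have q0 : 0 < focal_sqr C s0.
    by rewrite -(pmulr_rgt0 _ e0) (lt_le_trans _ q1).
  suff : wsqdist C p0 s0 * focal_sqr C s0 < 1 by rewrite ltNge q1.
  by apply: lt_le_trans q2; rewrite mulrC ltr_pM2l.
have q1 := collapse_radius sl0 ds0 f0; split => //.
apply: focal_le0_near fr _; rewrite -q1 mulrC ltr_pM2l//.
by rewrite -(pmulr_rgt0 _ e0) q1.
Qed.

(** In the degenerate case the Wronskian [slope / |p - pos s|] is nondecreasing near
    [s0]; if it vanished at two points it would vanish between them, and [p] would
    have an interval of critical points. *)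
Lemma slope_trapping p0 s0 (r : R) : focal_bound r -> no_collapse r ->
  slope C p0 s0 = 0 -> wsqdist C p0 s0 < r ^+ 2 -> trapping p0 s0.
Proof.
move=> fr nr sl0 wr; have [ds0|ds0] := ltP 0 (dslope C p0 s0).
  exact: dslope_trapping.
have [f0 q1 fn] := critical_cases fr sl0 wr ds0.
have [|U [e [nU e0 H]]] := @near_box p0 s0
  (fun p s => [/\ 0 < sqdist C p s, wsqdist C p s < r ^+ 2 & focal C s <= 0]).
  have H1 : \forall z \near (p0, s0), 0 < sqdist C z.1 z.2.
    have H : sqdist C z.1 z.2 @[z --> (p0, s0)] --> sqdist C p0 s0.
      by apply: cvg_sqdist; [exact: cvg_fst|exact: cvg_snd].
    exact: cvgr_gt _ H _ (slope0_sqdist_gt0 ds0).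
  have H2 : \forall z \near (p0, s0), wsqdist C z.1 z.2 < r ^+ 2.
    have H : wsqdist C z.1 z.2 @[z --> (p0, s0)] --> wsqdist C p0 s0.
      by apply: cvg_wsqdist; [exact: cvg_fst|exact: cvg_snd].
    exact: cvgr_lt _ H _ wr.
  have H3 : \forall z \near (p0, s0), focal C z.2 <= 0.
    by apply: (cvg_snd (F := nbhs p0) (G := nbhs s0)) fn.
  near=> z; split; near: z; [exact: H1|exact: H2|exact: H3].
exists U, e; split => // p Up s t s1 st t1 sls.
have mono a b : s <= a -> a <= b -> b <= t ->
    slope C p a / Num.sqrt (sqdist C p a) <=
    slope C p b / Num.sqrt (sqdist C p b).
  move=> sa ab bt; apply: sturm_monotone => // x /andP[ax xb].
  by have [] := H p x Up; [apply/andP; split; lra|].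
have q0 x : s <= x -> x <= t -> 0 < (Num.sqrt (sqdist C p x))^-1.
  move=> sx xt; rewrite invr_gt0 sqrtr_gt0.
  by have [] := H p x Up; [apply/andP; split; lra|].
have slge x : s <= x -> x <= t -> 0 <= slope C p x.
  move=> sx xt; have := mono s x (lexx _) sx xt.
  rewrite -(pmulr_lge0 _ (q0 x sx xt)); apply: le_trans.
  by rewrite mulr_ge0// ltW// q0// ltW.
have := slge t (ltW st) (lexx _); rewrite le_eqVlt => /predU1P[slt|//].
exfalso; apply: (nr p s t st) => x /andP[sx xt]; split; last first.
  by have [] := H p x Up; [apply/andP; split; lra|].
apply/eqP; rewrite eq_le slge// andbT.
by have := mono x t sx xt (lexx _); rewrite -slt mul0r pmulr_lle0 ?q0.
Unshelve. all: by end_near. Qed.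

Lemma min_slope0 p a b c : a < c < b ->
  (forall t, a < t < b -> wsqdist C p c <= wsqdist C p t) -> slope C p c = 0.
Proof.
move=> acb minc.
have ab : a <= b by case/andP: acb => ? ?; lra.
have : is_derive c 1 (wsqdist C p) 0.
  apply: (derive1_at_min ab) => [t _||t].
  - by have [] := derive_wsqdist C p t.
  - by rewrite in_itv.
  - by rewrite in_itv/=; exact: minc.
move/(derive_uniq (derive_wsqdist C p c))/eqP.
rewrite mulf_eq0 invr_eq0 expf_eq0/= (gt_eqF (m_gt0 c)) orbF.
by rewrite mulf_eq0 pnatr_eq0/= => /eqP.
Qed.

(** Trapping makes [s0] a strict minimum on a window; for [p] near [p0] the values at
    the ends of the window still exceed the value at [s0], so that the minimum
    over the window is interior, hence critical. *)
Lemma strict_min_persists p0 s0 : slope C p0 s0 = 0 -> trapping p0 s0 -> forall d, 0 < d ->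
  \forall p \near p0, exists s, [/\ s0 - d < s < s0 + d, slope C p s = 0 &
     wsqdist C p s <= wsqdist C p s0].
Proof.
move=> sl0 [U [e [nU e0 H]]] d d0.
have Up0 := nbhs_singleton nU.
(* A window inside both the prescribed one and the one where trapping holds. *)
pose h := Num.min d e / 2.
have [h0 hd he] : [/\ 0 < h, h < d & h < e].
  rewrite /h; have : 0 < Num.min d e by rewrite lt_min d0.
  have : Num.min d e <= d by rewrite ge_min lexx.
  have : Num.min d e <= e by rewrite ge_min lexx orbT.
  by split; lra.
have m30 s : 0 < m s ^+ 3 by rewrite exprn_gt0.
have wa : wsqdist C p0 s0 < wsqdist C p0 (s0 - h).
  rewrite -ltrN2; apply: (@derive_lt _ (fun s => - wsqdist C p0 s)
    (fun s => - (2 * slope C p0 s / m s ^+ 3))); first by lra.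
    by move=> x _; apply: derive_opp; exact: derive_wsqdist.
  move=> x /andP[x1 x2]; rewrite oppr_gt0 pmulr_llt0 ?invr_gt0// pmulr_rlt0//.
  rewrite ltNge; apply/negP => slx.
  suff : 0 < slope C p0 s0 by rewrite sl0 ltxx.
  by apply: (H p0 Up0 x s0) => //; lra.
have wb : wsqdist C p0 s0 < wsqdist C p0 (s0 + h).
  apply: (@derive_lt _ (wsqdist C p0)
    (fun s => (2 * slope C p0 s / m s ^+ 3))); first by lra.
    by move=> x _; exact: derive_wsqdist.
  move=> x /andP[x1 x2]; rewrite divr_gt0// pmulr_rgt0//.
  by apply: (H p0 Up0 s0 x); rewrite ?sl0//; lra.
have near_lt t : wsqdist C p0 s0 < wsqdist C p0 t ->
    \forall p \near p0, wsqdist C p s0 < wsqdist C p t.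
  rewrite -subr_gt0 => dw.
  have cw x : wsqdist C p x @[p --> p0] --> wsqdist C p0 x.
    by apply: (@cvg_wsqdist _ (nbhs p0) _ id (fun=> x)); [exact: cvg_id|exact: cvg_cst].
  by apply: filterS (cvgr_gt _ (cvgB (cw t) (cw s0)) _ dw) => p /=; rewrite subr_gt0.
near=> p.
have pa : wsqdist C p s0 < wsqdist C p (s0 - h) by near: p; exact: near_lt.
have pb : wsqdist C p s0 < wsqdist C p (s0 + h) by near: p; exact: near_lt.
have [||c] := @EVT_min R (wsqdist C p) (s0 - h) (s0 + h); first by lra.
  apply: derivable_within_continuous => x _.
  by have [] := derive_wsqdist C p x.
rewrite in_itv/= => /andP[c1 c2] minc.
have wc : wsqdist C p c <= wsqdist C p s0.
  by apply: minc; rewrite in_itv/=; apply/andP; split; lra.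
have [c1' c2'] : s0 - h < c /\ c < s0 + h.
  rewrite !lt_neqAle c1 c2 !andbT; split; apply/eqP => cE.
    by move: pa wc; rewrite -cE; lra.
  by move: pb wc; rewrite -cE; lra.
exists c; split => //; first by apply/andP; split; lra.
apply: (@min_slope0 _ (s0 - h) (s0 + h)); first by rewrite c1'.
by move=> t /andP[t1 t2]; apply: minc; rewrite in_itv/= !ltW.
Unshelve. all: by end_near. Qed.

End Persistence.

(** * Collapsing arcs *)

Section Collapse.
Context {R : realType} {n : nat}.
Variable C : weighted_curve R n.
Implicit Types (p : 'rV[R]_n) (s t k r : R).

Local Notation g := (pos C).
Local Notation g1 := (pos1 C).
Local Notation g2 := (pos2 C).
Local Notation g3 := (pos3 C).
Local Notation m := (weight C).
Local Notation m1 := (weight1 C).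
Local Notation m2 := (weight2 C).

Let Dg := derive_pos C.
Let Dg1 := derive_pos1 C.
Let Dg2 := derive_pos2 C.
Let Dm := derive_weight C.
Let Dm1 := derive_weight1 C.
Let m_gt0 := weight_gt0 C.
Let speed := unit_speed C.

Definition grad_bound r := forall s, m1 s ^+ 2 * r ^+ 2 <= 1.

(** The differential equations of an arc of curvature [k] with weight
    [2 / (k r) cos (k s / 2 + a)]; the last one fixes the amplitude. *)
Definition collapse_on k r (a b : R) := [/\ 0 < k, 0 < r, a < b &
  forall s, a < s < b -> [/\ curv2 C s = k ^+ 2, g3 s = - k ^+ 2 *: g1 s,
    m2 s = - (k ^+ 2 / 4) * m s & collapse_sqr C s = (r ^+ 2)^-1]].

(** An interval of critical points is degenerate at each of its points, hence
    [focal = 0] and [collapse_sqr] is the inverse of the constant value of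
    [wsqdist p].  Differentiating the latter shows that the curvature is constant.
    By [collapse_normal_part], [p] is a combination of [pos], [pos1] and [pos2], and
    differentiating this expression gives [pos3 = - kappa^2 pos1]. *)
Lemma degenerate_collapse p (a b r : R) : focal_bound C r -> grad_bound r ->
  0 < r -> a < b ->
  (forall x, a <= x <= b -> slope C p x = 0 /\ wsqdist C p x < r ^+ 2) ->
  exists k r', r' < r /\ collapse_on k r' a b.
Proof.
move=> fr gr r0 ab H.
have slx x : a < x < b -> slope C p x = 0.
  by move=> /andP[/ltW ax /ltW xb]; have [] := H x; rewrite ?ax.
have wx x : a < x < b -> wsqdist C p x < r ^+ 2.
  by move=> /andP[/ltW ax /ltW xb]; have [] := H x; rewrite ?ax.
have dslx x : a < x < b -> dslope C p x = 0.
  move=> xab; apply: (local_cst_derive xab _ (derive_slope C p x)).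
  by move=> y yab; rewrite !slx.
have mid : a < (a + b) / 2 < b by apply/andP; split; lra.
pose c := (a + b) / 2; pose w := wsqdist C p c.
have wE x : a < x < b -> wsqdist C p x = w.
  move=> xab; apply: (derive0_cst (a := a) (b := b)) => // y yab.
  apply: derive_eq (derive_wsqdist C p y) _.
  by rewrite slx// mulr0 mul0r.
have crit x : a < x < b -> [/\ focal C x = 0, w * collapse_sqr C x = 1 &
    normal_part C p x = (w * m x ^+ 2 / 2) *: g2 x].
  move=> xab; have ds : dslope C p x <= 0 by rewrite dslx.
  have [f0 q1 _] := critical_cases fr (slx x xab) (wx x xab) ds.
  rewrite -(wE x xab); split => //.
  by rewrite (collapse_normal_part (slx x xab) ds f0) sqdistE.
have w0 : 0 < w.
  rewrite lt_def wsqdist_ge0 andbT; apply/eqP => wz.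
  by have [_ + _] := crit c mid; rewrite wz mul0r; lra.
have m2E x : a < x < b -> m2 x = - (curv2 C x / 4) * m x.
  move=> /crit[+ _ _]; rewrite /focal -/(curv2 C x); lra.
have qE x : a < x < b -> collapse_sqr C x = w^-1.
  move=> /crit[_ q1 _]; apply: (mulfI (lt0r_neq0 w0)).
  by rewrite q1 divff// gt_eqF.
have dcurv (x : R) : is_derive x 1 (curv2 C) (2 * dotr (g2 x) (g3 x)).
  by eapply derive_eq; [rewrite /curv2; der|rewrite (dotrC (g3 x)); ring].
have g23 x : a < x < b -> 2 * dotr (g2 x) (g3 x) = 0.
  move=> xab; have dc := dcurv x.
  have dq : is_derive x 1 (collapse_sqr C) (4^-1 * (2 * dotr (g2 x) (g3 x)) * m x ^+ 2).
    eapply derive_eq; first by rewrite /collapse_sqr; der.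
    by cbv beta; rewrite m2E//; move: (_ * dotr _ _) => z; field.
  have /eqP := local_cst_derive xab (fun y yab => etrans (qE y yab) (esym (qE x xab))) dq.
  rewrite mulf_eq0 expf_eq0/= (gt_eqF (m_gt0 x)) orbF.
  by rewrite mulf_eq0 invr_eq0 pnatr_eq0/= => /eqP.
pose K := curv2 C c.
have KE x : a < x < b -> curv2 C x = K.
  move=> xab; apply: (derive0_cst (a := a) (b := b)) => // y yab.
  exact: derive_eq (dcurv y) (g23 y yab).
have K0 : 0 < K.
  (* With zero curvature, weight1^2 would be 1/w > 1/r^2, against the gradient bound. *)
  rewrite lt_def dotr_ge0 andbT; apply/eqP => Kz.
  have [_ + _] := crit c mid; rewrite /collapse_sqr -/K Kz mulr0 mul0r addr0 mulrC.
  move=> q1; have := gr c; apply/negP; rewrite -ltNge -q1.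
  have m10 : 0 < m1 c ^+ 2 by rewrite -(pmulr_lgt0 _ w0) q1.
  by rewrite ltr_pM2l// wx.
exists (Num.sqrt K), (Num.sqrt w).
have wS : Num.sqrt w ^+ 2 = w by rewrite sqr_sqrtr// ltW.
have KS : Num.sqrt K ^+ 2 = K by rewrite sqr_sqrtr// ltW.
split.
  rewrite -ltr_sqr ?nnegrE ?sqrtr_ge0 ?ltW// wS; exact: wx.
split; rewrite ?sqrtr_gt0// => x xab; rewrite KS wS KE// qE// m2E// KE//.
split => //.
pose P y : 'rV[R]_n := g y + (- (w * (m y * m1 y))) *: g1 y + (w / 2 * m y ^+ 2) *: g2 y.
(* The point p, recovered from its tangential and normal parts at each y. *)
have PE y : a < y < b -> P y = p.
  move=> yab; have [_ _] := crit y yab; rewrite /normal_part slope0 ?slx// wE// => nE.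
  apply/esym/eqP; rewrite -subr_eq0 /P -!addrA opprD addrA opprD addrA.
  rewrite -[w * m y * m1 y]mulrA in nE.
  by rewrite nE -mulrA (mulrC (m y ^+ 2)) mulrA subrr.
have dP : is_derive x 1 P (g1 x + (- (w * (m1 x ^+ 2 + m x * m2 x)) *: g1 x
     + (- (w * (m x * m1 x))) *: g2 x) + ((w * m x * m1 x) *: g2 x + (w / 2 * m x ^+ 2) *: g3 x)).
  eapply derive_eq; first by rewrite /P; der.
  by cbv beta; apply/rowP => j; rewrite !mxE; field.
have P0 : is_derive x 1 P 0.
  have xab' : x \in `]a, b[%R by rewrite in_itv.
  apply: near_eq_is_derive (derive_vconst p x).
  by apply: filterS (near_in_itvoo xab') => y; rewrite /= in_itv/= => /PE.
have := derive_uniq dP P0 => dE.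
have cN0 : w / 2 * m x ^+ 2 != 0 by rewrite mulf_neq0 ?expf_neq0 ?gt_eqF// divr_gt0.
apply: (scalerI cN0); rewrite scalerA; apply/eqP; rewrite -subr_eq0; apply/eqP.
rewrite -dE; have q1 : w * collapse_sqr C x = 1 by have [] := crit x xab.
rewrite m2E// KE//; apply/rowP => j.
move: q1; rewrite /collapse_sqr KE// => /(congr1 ( *%R (g1 x 0 j))).
by rewrite !mxE; lra.
Qed.

(** The point reconstructed from the frame as in [degenerate_collapse] does not
    depend on the parameter. *)
Lemma collapse_center k r (a b : R) : collapse_on k r a b ->
  exists p, forall s, a < s < b -> slope C p s = 0 /\ wsqdist C p s = r ^+ 2.
Proof.
move=> [k0 r0 ab H].
pose w := r ^+ 2.
have wN0 : w != 0 by rewrite expf_neq0// gt_eqF.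
pose P y : 'rV[R]_n := g y + (- (w * (m y * m1 y))) *: g1 y + (w / 2 * m y ^+ 2) *: g2 y.
have P0 x : a < x < b -> is_derive x 1 P 0.
  move=> xab; have [kE gE mE qE] := H x xab.
  have q1 : w * collapse_sqr C x = 1 by rewrite qE divff.
  eapply derive_eq; first by rewrite /P; der.
  cbv beta; rewrite mE gE; apply/rowP => j.
  move: q1; rewrite /collapse_sqr kE => /(congr1 ( *%R (g1 x 0 j))).
  by rewrite !mxE; lra.
have mid : a < (a + b) / 2 < b by apply/andP; split; lra.
exists (P ((a + b) / 2)) => s sab.
rewrite (derive0_vcst P0 mid sab).
have [kE _ _ qE] := H s sab.
have PgE : P s - g s = (- (w * (m s * m1 s))) *: g1 s + (w / 2 * m s ^+ 2) *: g2 s.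
  by rewrite /P; apply/rowP => j; rewrite !mxE; ring.
have tE : dotr (P s - g s) (g1 s) = - (w * m s * m1 s).
  by rewrite PgE !dotrE speed (dotrC (g2 s)) dotr_g12; ring.
have eE : sqdist C (P s) s = w * m s ^+ 2.
  rewrite /sqdist PgE !dotrE speed (dotrC (g2 s)) dotr_g12 -/(curv2 C s) kE.
  have q1 : w * collapse_sqr C s = 1 by rewrite qE divff.
  by move: q1; rewrite /collapse_sqr kE => /(congr1 ( *%R (w * m s ^+ 2))); lra.
split; first by rewrite /slope tE eE; ring.
by rewrite /wsqdist eE mulfK// expf_neq0// gt_eqF.
Qed.

(** Variation of constants: the centre, the frame and the two amplitudes of the
    weight are solved for from the expected expressions, and their derivatives
    vanish. *)
Lemma collapse_circle k r (a b : R) : collapse_on k r a b ->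
  exists a0 (c e1 e2 : 'rV[R]_n), [/\ dotr e1 e1 = 1, dotr e2 e2 = 1, dotr e1 e2 = 0 &
  forall s, a < s < b -> g s = c + k^-1 *: (cos (k * s) *: e1 + sin (k * s) *: e2) /\
    m s = 2 / (k * r) * cos (k * s / 2 + a0)].
Proof.
move=> [k0 r0 ab H].
have kN0 : k != 0 by rewrite gt_eqF.
have rN0 : r != 0 by rewrite gt_eqF.
have kN2 : k ^+ 2 != 0 by rewrite expf_neq0.
pose CC s : 'rV[R]_n := g s + (k ^- 2) *: g2 s.
pose E1 s : 'rV[R]_n := (- (cos (k * s) / k)) *: g2 s + (- sin (k * s)) *: g1 s.
pose E2 s : 'rV[R]_n := (- (sin (k * s) / k)) *: g2 s + cos (k * s) *: g1 s.
pose A s : R := m s * cos (k / 2 * s) - 2 / k * m1 s * sin (k / 2 * s).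
pose B s : R := m s * sin (k / 2 * s) + 2 / k * m1 s * cos (k / 2 * s).
have dc := derive_cos_lin k; have ds := derive_sin_lin k.
have dc2 := derive_cos_lin (k / 2); have ds2 := derive_sin_lin (k / 2).
have C0 x : a < x < b -> is_derive x 1 CC 0.
  move=> /H[_ gE _ _]; eapply derive_eq; first by rewrite /CC; der.
  by cbv beta; rewrite gE; apply/rowP => j; rewrite !mxE; field.
have E10 x : a < x < b -> is_derive x 1 E1 0.
  move=> /H[_ gE _ _]; eapply derive_eq; first by rewrite /E1; der.
  by cbv beta; rewrite gE; apply/rowP => j; rewrite !mxE; field.
have E20 x : a < x < b -> is_derive x 1 E2 0.
  move=> /H[_ gE _ _]; eapply derive_eq; first by rewrite /E2; der.
  by cbv beta; rewrite gE; apply/rowP => j; rewrite !mxE; field.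
have A0 x : a < x < b -> is_derive x 1 A 0.
  move=> /H[_ _ mE _]; eapply derive_eq; first by rewrite /A; der.
  by cbv beta; rewrite mE; field.
have B0 x : a < x < b -> is_derive x 1 B 0.
  move=> /H[_ _ mE _]; eapply derive_eq; first by rewrite /B; der.
  by cbv beta; rewrite mE; field.
pose c := (a + b) / 2.
have mid : a < c < b by apply/andP; split; rewrite /c; lra.
have [kE _ _ qE] := H c mid.
pose amp := 2 / (k * r).
have ampN0 : amp != 0 by rewrite mulf_neq0 ?invr_eq0 ?mulf_neq0.
have cs x : cos x ^+ 2 + sin x ^+ 2 = 1 :> R by exact: cos2Dsin2.
(* A and B are the amplitudes of the cosine and of the sine in the weight. *)
have [|a0 [a01 a02]] := @polar_angle R (A c / amp) (- B c / amp).
  have := cs (k / 2 * c); move: qE; rewrite /collapse_sqr kE /A /B /amp.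
  move: (cos _) (sin _) => co si qE csE.
  transitivity (r ^+ 2 * (m1 c ^+ 2 + 4^-1 * k ^+ 2 * m c ^+ 2) * (co ^+ 2 + si ^+ 2)).
    by field; rewrite kN0 rN0.
  by rewrite csE qE mulr1 divff// expf_neq0.
exists a0, (CC c), (E1 c), (E2 c).
have g2c : dotr (g2 c) (g2 c) = k ^+ 2 by exact: kE.
have frame x y : dotr (x *: g2 c + y *: g1 c) (x *: g2 c + y *: g1 c)
    = k ^+ 2 * x ^+ 2 + y ^+ 2.
  by rewrite !dotrE speed (dotrC (g2 c)) dotr_g12 g2c; ring.
split.
- rewrite /E1 frame -[RHS](cs (k * c)); field; exact: kN0.
- rewrite /E2 frame -[RHS](cs (k * c)); field; exact: kN0.
- rewrite /E1 /E2 !dotrE speed (dotrC (g2 c)) dotr_g12 g2c; field; exact: kN0.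
move=> s sab; rewrite (derive0_vcst C0 mid sab) (derive0_vcst E10 mid sab).
rewrite (derive0_vcst E20 mid sab); split.
  rewrite /CC /E1 /E2; apply/rowP => j; rewrite !mxE.
  have := cs (k * s); move: (cos _) (sin _) => co si csE.
  transitivity (g s 0 j + k ^- 2 * g2 s 0 j * (1 - (co ^+ 2 + si ^+ 2))
     ); first by rewrite csE subrr mulr0 addr0.
  by field.
rewrite cosD a01 a02 (derive0_cst A0 mid sab) (derive0_cst B0 mid sab).
rewrite (_ : k * s / 2 = k / 2 * s); last by field.
have := cs (k / 2 * s); rewrite /A /B -/amp.
move: (cos _) (sin _) => co si csE.
transitivity (m s * (co ^+ 2 + si ^+ 2)); first by rewrite csE mulr1.
by field; rewrite ?kN0 ?rN0 ?ampN0.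
Qed.

End Collapse.

(** * Reading a circular arc in the arclength of a curve *)

Section CircleArc.
Context {R : realType} {n : nat}.
Variables (k : R) (c e1 e2 : 'rV[R]_n).
Hypothesis k0 : 0 < k.
Hypotheses (e11 : dotr e1 e1 = 1) (e22 : dotr e2 e2 = 1) (e12 : dotr e1 e2 = 0).

Definition circle (s : R) : 'rV[R]_n :=
  c + k^-1 *: (cos (k * s) *: e1 + sin (k * s) *: e2).
Definition circle1 (s : R) : 'rV[R]_n := (- sin (k * s)) *: e1 + cos (k * s) *: e2.
Definition circle2 (s : R) : 'rV[R]_n := (- k) *: (cos (k * s) *: e1 + sin (k * s) *: e2).

Let kN0 : k != 0. Proof. by rewrite gt_eqF. Qed.
Let dc := derive_cos_lin k.
Let ds := derive_sin_lin k.

Lemma derive_circle (s : R) : is_derive s 1 circle (circle1 s).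
Proof.
eapply derive_eq; first by rewrite /circle; der.
by cbv beta; rewrite /circle1; apply/rowP => j; rewrite !mxE; field.
Qed.

Lemma derive_circle1 (s : R) : is_derive s 1 circle1 (circle2 s).
Proof.
eapply derive_eq; first by rewrite /circle1; der.
by cbv beta; rewrite /circle2; apply/rowP => j; rewrite !mxE; ring.
Qed.

Lemma derive_circle2 (s : R) : is_derive s 1 circle2 (- k ^+ 2 *: circle1 s).
Proof.
eapply derive_eq; first by rewrite /circle2; der.
by cbv beta; rewrite /circle1; apply/rowP => j; rewrite !mxE; ring.
Qed.

Lemma dotr_circle1 s : dotr (circle1 s) (circle1 s) = 1.
Proof.
rewrite /circle1 !dotrE e11 e22 (dotrC e2) e12.
by have := cos2Dsin2 (k * s); lra.
Qed.

Lemma dotr_circle2 s : dotr (circle2 s) (circle2 s) = k ^+ 2.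
Proof.
rewrite /circle2 !dotrE e11 e22 (dotrC e2) e12.
by have /(congr1 ( *%R (k ^+ 2))) := cos2Dsin2 (k * s); lra.
Qed.

End CircleArc.

Section ArcCurve.
Context {R : realType} {n : nat}.
Variable C : weighted_curve R n.

(** The factor [d], which is 1 or -1, allows for opposite orientations of the curve and
    of the arc; it cancels in the equations, which are of even order or quadratic. *)
Lemma arc_collapse (k r a0 : R) (c e1 e2 : 'rV[R]_n) (a b d s0 : R) :
  0 < k -> 0 < r -> a < b ->
  dotr e1 e1 = 1 -> dotr e2 e2 = 1 -> dotr e1 e2 = 0 -> d ^+ 2 = 1 ->
  (forall x, a < x < b -> pos C x = circle k c e1 e2 (d * x + s0) /\
     weight C x = 2 / (k * r) * cos (k * (d * x + s0) / 2 + a0)) ->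
  collapse_on C k r a b.
Proof.
move=> k0 r0 ab e11 e22 e12 d2 H.
have kN0 : k != 0 by rewrite gt_eqF.
have rN0 : r != 0 by rewrite gt_eqF.
pose h (x : R) := d * x + s0.
have Dh (x : R) : is_derive x 1 h d.
  by rewrite /h; eapply derive_eq; [der|rewrite mul0r add0r mulr1 addr0].
have H1 x : a < x < b -> pos1 C x = d *: circle1 k e1 e2 (h x).
  move=> xab; have H0 y : a < y < b -> pos C y = circle k c e1 e2 (h y).
    by move=> /H[].
  apply: (eq_on_derive H0 xab (derive_pos C x)).
  exact: (derive_vcomp (f := circle k c e1 e2) (g := h) (derive_circle c e1 e2 k0 (h x)) (Dh x)).
have H2 x : a < x < b -> pos2 C x = circle2 k e1 e2 (h x).
  move=> xab; apply: (eq_on_derive H1 xab (derive_pos1 C x)).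
  have D1 := derive_vcomp (f := circle1 k e1 e2) (g := h) (derive_circle1 k e1 e2 (h x)) (Dh x).
  apply: derive_eq (derive_vscale (derive_const d x) D1) _.
  by rewrite scale0r add0r scalerA -expr2 d2 scale1r.
have H3 x : a < x < b -> pos3 C x = - k ^+ 2 *: pos1 C x.
  move=> xab; rewrite H1//.
  apply: (eq_on_derive H2 xab (derive_pos2 C x)).
  apply: derive_eq (derive_vcomp (f := circle2 k e1 e2) (g := h) (derive_circle2 k e1 e2 (h
    x)) (Dh x)) _.
  by rewrite !scalerA mulrC.
pose u (x : R) := k / 2 * h x + a0.
have Du (x : R) : is_derive x 1 u (k / 2 * d).
  have D := Dh; rewrite /u; eapply derive_eq; first by der.
  by cbv beta; rewrite mul0r add0r addr0.
have Dcos (x : R) : is_derive x 1 (fun x => cos (u x)) (- sin (u x) * (k / 2 * d)).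
  exact: derive_scomp (is_derive_cos (u x)) (Du x).
have Dsin (x : R) : is_derive x 1 (fun x => sin (u x)) (cos (u x) * (k / 2 * d)).
  exact: derive_scomp (is_derive_sin (u x)) (Du x).
have W0 x : a < x < b -> weight C x = 2 / (k * r) * cos (u x).
  by move=> /H[_ ->]; congr (_ * cos _); rewrite /u /h; field.
have W1 x : a < x < b -> weight1 C x = - (d / r) * sin (u x).
  move=> xab; apply: (eq_on_derive W0 xab (derive_weight C x)).
  eapply derive_eq; first by der.
  by cbv beta; field; rewrite kN0 rN0.
have W2 x : a < x < b -> weight2 C x = - (k ^+ 2 / 4) * weight C x.
  move=> xab; rewrite W0//; apply: (eq_on_derive W1 xab (derive_weight1 C x)).
  eapply derive_eq; first by der.
  cbv beta; rewrite mul0r add0r.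
  transitivity (- (k / (2 * r) * d ^+ 2) * cos (u x)); first by field.
  by rewrite d2; field; rewrite kN0 rN0.
split => // x xab; have kE : curv2 C x = k ^+ 2.
  by rewrite /curv2 H2// dotr_circle2.
split => //; [exact: H3|exact: W2|].
rewrite /collapse_sqr kE W0// W1//.
have := cos2Dsin2 (u x); move: (cos _) (sin _) => co si cs.
transitivity ((r ^+ 2)^-1 * (d ^+ 2 * si ^+ 2 + co ^+ 2)).
  by field; rewrite kN0 rN0.
by rewrite d2 mul1r addrC cs mulr1.
Qed.

(** Two unit speed parametrizations of the same arc differ by an affine change of
    parameter.  The correspondence [th] is merely continuous at one point; it is
    differentiable because the coordinate of the curve along its tangent has a
    differentiable local inverse, its derivative has square 1, and its sign is
    locally constant. *)
Lemma arc_param (k : R) (c e1 e2 : 'rV[R]_n) (th : R -> R) (t0 e : R) :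
  0 < k -> dotr e1 e1 = 1 -> dotr e2 e2 = 1 -> dotr e1 e2 = 0 -> 0 < e ->
  th s @[s --> t0] --> th t0 ->
  (forall s, t0 - e < s < t0 + e -> pos C (th s) = circle k c e1 e2 s) ->
  exists d s0 a b, [/\ d ^+ 2 = 1, a < b &
    forall x, a < x < b -> pos C x = circle k c e1 e2 (d * x + s0) /\
      t0 - e < d * x + s0 < t0 + e].
Proof.
move=> k0 e11 e22 e12 e0 thc thE.
pose x0 := th t0; pose T := pos1 C x0.
pose b (x : R) := dotr (pos C x) T; pose db (x : R) := dotr (pos1 C x) T.
have Db (x : R) : is_derive x 1 b (db x).
  have D := derive_pos C; rewrite /b /db; eapply derive_eq; first by der.
  by rewrite dotr0r addr0.
have db0 : db x0 = 1 by rewrite /db /T unit_speed.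
have dbc : db x @[x --> x0] --> db x0.
  have D := derive_pos1 C; have : is_derive x0 1 db (dotr (pos2 C x0) T).
    by rewrite /db; eapply derive_eq; [der|rewrite dotr0r addr0].
  by move/derive_cont.
have [del /= del0 Hdel] : exists2 del, 0 < del & forall x, x0 - del < x < x0 + del -> 0 < db x.
  have lt01 : 0 < db x0 by rewrite db0.
  by apply: near_itvP; exact: cvgr_gt _ dbc _ lt01.
have binc x y : x0 - del < x -> x < y -> y < x0 + del -> b x < b y.
  move=> xd xy yd; apply: (derive_lt xy (fun x _ => Db x)) => z /andP[z1 z2].
  by apply: Hdel; apply/andP; split; lra.
(* Local inverse of the tangential coordinate b. *)
pose G y := xget x0 [set x | x0 - del < x < x0 + del /\ b x = y].
have GK x : x0 - del < x < x0 + del -> G (b x) = x.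
  move=> xd; have [/andP[g1 g2] gE] : x0 - del < G (b x) < x0 + del /\ b (G (b x)) = b x.
    apply: (@xgetPex _ x0 [set y | x0 - del < y < x0 + del /\ b y = b x]).
    by exists x.
  case/andP: xd => x1 x2.
  have [lt|lt|//] := ltgtP (G (b x)) x.
    by have := binc _ _ g1 lt x2; rewrite gE ltxx.
  by have := binc _ _ x1 lt g2; rewrite gE ltxx.
have DG x : x0 - del < x < x0 + del -> is_derive (b x) 1 G (db x)^-1.
  move=> xd; have xd' : x \in `]x0 - del, x0 + del[%R by rewrite in_itv.
  apply: (@is_derive_inverse R b G (db x) x) => //; last by rewrite gt_eqF// Hdel.
    by apply: filterS (near_in_itvoo xd') => y; rewrite /= in_itv/=; exact: GK.
  by apply: filterE => y; exact: derive_cont (Db y).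
pose v (s : R) := dotr (circle1 k e1 e2 s) T.
have [e' [e'0 e'e Hth]] : exists e', [/\ 0 < e', e' <= e &
    forall s, t0 - e' < s < t0 + e' -> x0 - del < th s < x0 + del].
  have n1 : \forall s \near t0, x0 - del < th s by apply: cvgr_gt _ thc _ _; rewrite /x0; lra.
  have n2 : \forall s \near t0, th s < x0 + del by apply: cvgr_lt _ thc _ _; rewrite /x0; lra.
  have [a a0 Ha] := near_itvP (filterI n1 n2).
  exists (Num.min a e); split; first by rewrite lt_min a0 e0.
    by rewrite ge_min lexx orbT.
  have h1 : Num.min a e <= a by rewrite ge_min lexx.
  move=> s /andP[s1 s2]; have [] : (fun s => x0 - del < th s /\ th s < x0 + del) s.
    by apply: Ha; apply/andP; split; lra.
  by move=> -> ->.
have thE' s : t0 - e' < s < t0 + e' -> pos C (th s) = circle k c e1 e2 s.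
  by move=> /andP[s1 s2]; apply: thE; apply/andP; split; lra.
have Dth s : t0 - e' < s < t0 + e' -> is_derive s 1 th ((db (th s))^-1 * v s).
  move=> sd; have sd' : s \in `]t0 - e', t0 + e'[%R by rewrite in_itv.
  have Da : is_derive s 1 (fun s => dotr (circle k c e1 e2 s) T) (v s).
    have D := derive_circle c e1 e2 k0; eapply derive_eq; first by der.
    by rewrite dotr0r addr0.
  have DGs : is_derive (dotr (circle k c e1 e2 s) T) 1 G (db (th s))^-1.
    by rewrite -(thE' s sd); exact: DG (Hth s sd).
  apply: near_eq_is_derive (derive_scomp (g := fun s => dotr (circle k c e1 e2 s) T) DGs Da).
  apply: filterS (near_in_itvoo sd') => y; rewrite /= in_itv/= => yd.
  by rewrite -(thE' y yd); exact: GK (Hth y yd).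
have dth2 s : t0 - e' < s < t0 + e' -> ((db (th s))^-1 * v s) ^+ 2 = 1.
  move=> sd; have E := eq_on_derive thE' sd (derive_vcomp (f := pos C) (derive_pos C (th
    s)) (Dth s sd))
    (derive_circle c e1 e2 k0 s).
  have := dotr_circle1 k e11 e22 e12 s; rewrite -E dotrZl dotrZr unit_speed mulr1.
  by rewrite -expr2.
have t0d : t0 - e' < t0 < t0 + e' by apply/andP; split; lra.
pose d := v t0.
have d2 : d ^+ 2 = 1 by have := dth2 t0 t0d; rewrite -/x0 db0 invr1 mul1r.
have vc : v s * d @[s --> t0] --> v t0 * d.
  have D := derive_circle1 k e1 e2.
  have Dv : is_derive t0 1 v (dotr (circle2 k e1 e2 t0) T).
    by rewrite /v; eapply derive_eq; [der|rewrite dotr0r addr0].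
  by apply: cvgM; [exact: derive_cont Dv|exact: cvg_cst].
have [e2' [e2'0 e2'e Hv]] : exists e2', [/\ 0 < e2', e2' <= e' &
    forall s, t0 - e2' < s < t0 + e2' -> 0 < v s * d].
  have lt01 : 0 < v t0 * d by rewrite -/d -expr2 d2.
  have [a a0 Ha] : exists2 a, 0 < a & forall s, t0 - a < s < t0 + a -> 0 < v s * d.
    by apply: near_itvP; exact: cvgr_gt _ vc _ lt01.
  exists (Num.min a e'); split; first by rewrite lt_min a0 e'0.
    by rewrite ge_min lexx orbT.
  have h1 : Num.min a e' <= a by rewrite ge_min lexx.
  by move=> s /andP[s1 s2]; apply: Ha; apply/andP; split; lra.
have sub s : t0 - e2' < s < t0 + e2' -> t0 - e' < s < t0 + e'.
  by move=> /andP[s1 s2]; apply/andP; split; lra.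
have dthE s : t0 - e2' < s < t0 + e2' -> (db (th s))^-1 * v s = d.
  move=> sd; have := dth2 s (sub s sd); set y := _ * _ => y2.
  have yd : 0 < y * d.
    by rewrite /y -mulrA mulr_gt0 ?Hv// invr_gt0 Hdel// Hth// sub.
  have : (y - d) * (y + d) = 0 by rewrite -subr_sqr y2 d2 subrr.
  move/eqP; rewrite mulf_eq0 subr_eq0 => /orP[/eqP//|].
  by rewrite addr_eq0 => /eqP yE; move: yd; rewrite yE mulNr -expr2 d2; lra.
have thL s : t0 - e2' < s < t0 + e2' -> th s = x0 + d * (s - t0).
  move=> sd; have Dl (y : R) : t0 - e2' < y < t0 + e2' ->
      is_derive y 1 (fun s => th s - d * s) 0.
    move=> yd; have D := Dth y (sub y yd); rewrite dthE// in D.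
    by eapply derive_eq; [der|rewrite mul0r add0r mulr1 subrr].
  have t0d' : t0 - e2' < t0 < t0 + e2' by apply/andP; split; lra.
  by have := derive0_cst Dl sd t0d'; rewrite -/x0 => E; lra.
exists d, (t0 - d * x0), (x0 - e2'), (x0 + e2'); split => //; first by lra.
move=> x /andP[xd1 xd2].
have d1 : `|d| = 1.
  by apply/eqP; rewrite -(@eqrXn2 _ 2)// ?expr1n ?real_normK ?num_real// d2.
have xs : t0 - e2' < d * x + (t0 - d * x0) < t0 + e2'.
  have : `|d * (x - x0)| < e2'.
    by rewrite normrM d1 mul1r ltr_norml; apply/andP; split; lra.
  by rewrite ltr_norml mulrBr => /andP[? ?]; apply/andP; split; lra.
have xE : th (d * x + (t0 - d * x0)) = x.
  rewrite thL// -[RHS](_ : x0 + d ^+ 2 * (x - x0) = x); last by rewrite d2; ring.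
  by ring.
split; first by rewrite -thE' ?xE// sub.
by case/andP: xs => ? ?; apply/andP; split; lra.
Qed.

End ArcCurve.

(** * The exponential map of one curve *)

Section Exp.
Context {R : realType} {n : nat}.
Variable C : weighted_curve R n.
Implicit Types (p w : 'rV[R]_n) (s t k r : R).

Local Notation g := (pos C).
Local Notation g1 := (pos1 C).
Local Notation g2 := (pos2 C).
Local Notation m := (weight C).
Local Notation m1 := (weight1 C).

Let m_gt0 := weight_gt0 C.
Let speed := unit_speed C.

Definition exp_factor s (x : R) : R := Num.sqrt (1 - m1 s ^+ 2 * x).

(** The exponential map in the parameter [s], where the gradient of the weight is
    [weight1 *: pos1]. *)
Definition exp_at s w : 'rV[R]_n :=
  g s - (m s * dotr w w) *: (m1 s *: g1 s) + (m s * exp_factor s (dotr w w)) *: w.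

Lemma exp_factor_sqr s x : m1 s ^+ 2 * x <= 1 -> exp_factor s x ^+ 2 = 1 - m1 s ^+ 2 * x.
Proof. by move=> mx; rewrite sqr_sqrtr// subr_ge0. Qed.

Lemma exp_atB s w : exp_at s w - g s =
  - (m s * dotr w w * m1 s) *: g1 s + (m s * exp_factor s (dotr w w)) *: w.
Proof. by rewrite /exp_at; apply/rowP => j; rewrite !mxE; ring. Qed.

Lemma exp_at_critical s w : dotr w (g1 s) = 0 -> m1 s ^+ 2 * dotr w w <= 1 ->
  slope C (exp_at s w) s = 0 /\ wsqdist C (exp_at s w) s = dotr w w.
Proof.
move=> wg mw; have cE := exp_factor_sqr mw.
have tE : dotr (exp_at s w - g s) (g1 s) = - (m s * dotr w w * m1 s).
  by rewrite exp_atB !dotrE speed wg; ring.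
have eE : sqdist C (exp_at s w) s = dotr w w * m s ^+ 2.
  rewrite /sqdist exp_atB !dotrE speed (dotrC (g1 s)) wg.
  move: cE; move: (exp_factor _ _) => c cE.
  transitivity (m s ^+ 2 * dotr w w * (m1 s ^+ 2 * dotr w w + c ^+ 2)); first by ring.
  by rewrite cE; ring.
split; first by rewrite /slope tE eE; ring.
by rewrite /wsqdist eE mulfK// expf_neq0// gt_eqF.
Qed.

Lemma normal_part_exp_at s w : dotr w (g1 s) = 0 ->
  normal_part C (exp_at s w) s = (m s * exp_factor s (dotr w w)) *: w.
Proof.
move=> wg; rewrite /normal_part exp_atB !dotrE speed wg.
by apply/rowP => j; rewrite !mxE; ring.
Qed.

(** The normal vector which [exp_at s] sends to [p], when [s] is critical for [p]. *)
Definition log_at p s : 'rV[R]_n :=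
  (m s * exp_factor s (wsqdist C p s))^-1 *: normal_part C p s.

Lemma exp_factor_gt0 s x : m1 s ^+ 2 * x < 1 -> 0 < exp_factor s x.
Proof. by move=> mx; rewrite sqrtr_gt0 subr_gt0. Qed.

Lemma log_atK s w : dotr w (g1 s) = 0 -> m1 s ^+ 2 * dotr w w < 1 ->
  log_at (exp_at s w) s = w.
Proof.
move=> wg mw; have [sl ww] := exp_at_critical wg (ltW mw).
rewrite /log_at ww normal_part_exp_at// scalerA mulVf ?scale1r//.
by rewrite mulf_neq0 ?gt_eqF// exp_factor_gt0.
Qed.

Lemma exp_atK p s : slope C p s = 0 -> m1 s ^+ 2 * wsqdist C p s < 1 ->
  [/\ exp_at s (log_at p s) = p, dotr (log_at p s) (g1 s) = 0 &
      dotr (log_at p s) (log_at p s) = wsqdist C p s].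
Proof.
move=> sl mw; have c0 := exp_factor_gt0 mw; have cE := exp_factor_sqr (ltW mw).
have mN0 : m s != 0 by rewrite gt_eqF.
have cN0 : exp_factor s (wsqdist C p s) != 0 by rewrite gt_eqF.
have lE : dotr (log_at p s) (log_at p s) = wsqdist C p s.
  rewrite /log_at dotrZl dotrZr dotr_normal_part slope0// sqdistE.
  move: cE cN0; move: (exp_factor _ _) => c cE cN0.
  transitivity ((m s * c)^-1 ^+ 2 * (m s ^+ 2 * wsqdist C p s *
      (1 - m1 s ^+ 2 * wsqdist C p s))); first by field; rewrite mN0 cN0.
  by rewrite -cE; field; rewrite mN0 cN0.
split => //; last by rewrite /log_at dotrZl normal_part_tangent mulr0.
rewrite /exp_at lE /log_at [X in _ + X]scalerA divff ?mulf_neq0// scale1r /normal_part slope0//.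
by apply/rowP => j; rewrite !mxE; ring.
Qed.

(** A nondegenerate local maximum. *)
Lemma dslope_nonmin p s : slope C p s = 0 -> dslope C p s < 0 ->
  exists t, wsqdist C p t < wsqdist C p s.
Proof.
move=> sl ds.
have [|U [e [nU e0 H]]] := @near_box _ _ p s (fun p s => dslope C p s < 0).
  have H : dslope C z.1 z.2 @[z --> (p, s)] --> dslope C p s.
    by apply: cvg_dslope; [exact: cvg_fst|exact: cvg_snd].
  exact: cvgr_lt _ H _ ds.
have Up := nbhs_singleton nU.
exists (s + e / 2); rewrite -ltrN2.
apply: (@derive_lt _ (fun s => - wsqdist C p s)
    (fun s => - (2 * slope C p s / m s ^+ 3))); first by lra.
  by move=> x _; apply: derive_opp; exact: derive_wsqdist.
move=> x /andP[x1 x2]; rewrite oppr_gt0 pmulr_llt0 ?invr_gt0 ?exprn_gt0//.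
rewrite pmulr_rlt0// -sl -ltrN2.
apply: (@derive_lt _ (fun s => - slope C p s) (fun s => - dslope C p s)) => //.
  by move=> y _; apply: derive_opp; exact: derive_slope.
by move=> y /andP[y1 y2]; rewrite oppr_gt0; apply: H => //; apply/andP; split; lra.
Qed.

(** Sharpness of [focal_sqrP]: on the ray along the principal normal, with
    [y = exp_factor / |w|], the identity [slope_sturm] gives [dslope < 0] exactly for
    [|y - kappa weight / 2| < sqrt (weight focal)], while [|w| < r] means
    [y > sqrt (1 / r^2 - weight1^2)].  Since [focal_sqr > 1 / r^2], the upper end of
    the former interval satisfies the latter condition. *)
Lemma focal_nonmin s r (nu : 'rV[R]_n) : 0 < r -> m1 s ^+ 2 * r ^+ 2 <= 1 ->
  0 < focal C s -> 1 < focal_sqr C s * r ^+ 2 ->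
  dotr nu nu = 1 -> dotr nu (g1 s) = 0 -> g2 s = enorm (g2 s) *: nu ->
  exists w, [/\ dotr w (g1 s) = 0, dotr w w < r ^+ 2, m1 s ^+ 2 * dotr w w <= 1 &
     dslope C (exp_at s w) s < 0].
Proof.
move=> r0 mr f0 q1 nu1 nug kE; pose k := enorm (g2 s).
have k0 : 0 <= k := enorm_ge0 _.
pose S := Num.sqrt (m s * focal C s).
have mf : 0 < m s * focal C s by rewrite mulr_gt0.
have S0 : 0 < S by rewrite sqrtr_gt0.
have SE : S ^+ 2 = m s * focal C s by rewrite sqr_sqrtr// ltW.
pose Y := 2^-1 * k * m s + S.
have r20 : 0 < r ^+ 2 by rewrite exprn_gt0.
have Y0 : 0 < Y by rewrite ltr_wpDl// !mulr_ge0 ?invr_ge0// ltW.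
pose y1 := Num.sqrt ((r ^+ 2)^-1 - m1 s ^+ 2).
have y1a : 0 <= (r ^+ 2)^-1 - m1 s ^+ 2.
  by rewrite subr_ge0 -(ler_pM2r r20) mulVf// gt_eqF.
have y1E : y1 ^+ 2 = (r ^+ 2)^-1 - m1 s ^+ 2 by rewrite sqr_sqrtr.
have y1Y : y1 < Y.
  rewrite -ltr_sqr ?nnegrE ?sqrtr_ge0 ?(ltW Y0)// y1E ltrBlDl.
  rewrite -(ltr_pM2r r20) mulVf ?gt_eqF//.
(* Strictly between the two lower bounds for y and the upper one. *)
pose y := (Num.max y1 (2^-1 * k * m s - S) + Y) / 2.
have [yY yy1 yk] : [/\ y < Y, y1 < y & 2^-1 * k * m s - S < y].
  have h1 : Num.max y1 (2^-1 * k * m s - S) < Y.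
    by rewrite gt_max y1Y/= /Y; lra.
  have h2 : y1 <= Num.max y1 (2^-1 * k * m s - S) by rewrite le_max lexx.
  have h3 : 2^-1 * k * m s - S <= Num.max y1 (2^-1 * k * m s - S).
    by rewrite le_max lexx orbT.
  by rewrite /y; split; lra.
have y0 : 0 < y by rewrite (le_lt_trans _ yy1)// sqrtr_ge0.
pose z := y ^+ 2 + m1 s ^+ 2.
have z0 : 0 < z by rewrite ltr_wpDr ?sqr_ge0// exprn_gt0.
have zr : (r ^+ 2)^-1 < z.
  by rewrite /z -ltrBlDr -y1E ltr_sqr ?nnegrE ?sqrtr_ge0// ltW.
pose rho := Num.sqrt z^-1.
have rhoE : rho ^+ 2 = z^-1 by rewrite sqr_sqrtr// invr_ge0 ltW.
have wwE : dotr (rho *: nu) (rho *: nu) = z^-1.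
  by rewrite dotrZl dotrZr nu1 mulr1 -expr2.
have mz : 1 - m1 s ^+ 2 * z^-1 = (rho * y) ^+ 2.
  rewrite exprMn rhoE /z; field; exact: lt0r_neq0.
have wg : dotr (rho *: nu) (g1 s) = 0 by rewrite dotrZl nug mulr0.
have mz1 : m1 s ^+ 2 * dotr (rho *: nu) (rho *: nu) <= 1.
  by rewrite wwE -subr_ge0 mz sqr_ge0.
exists (rho *: nu); split => //.
  by rewrite wwE -[ltRHS]invrK ltf_pV2// posrE invr_gt0.
have [sl ww] := exp_at_critical wg mz1.
have := slope_sturm C (exp_at s (rho *: nu)) s.
rewrite sl mul0r addr0 normal_part_exp_at// sqdistE ww wwE.
have -> : exp_factor s z^-1 = rho * y.
  by rewrite /exp_factor mz sqrtr_sqr ger0_norm// mulr_ge0 ?sqrtr_ge0// ltW.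
have -> : (m s * (rho * y)) *: (rho *: nu) - (z^-1 * m s ^+ 2 / 2) *: g2 s
    = (m s * z^-1 * (y - 2^-1 * k * m s)) *: nu.
  by rewrite kE -/k -rhoE; apply/rowP => j; rewrite !mxE; field.
rewrite dotrZl dotrZr nu1 mulr1 => dE.
have zm : 0 < z^-1 * m s ^+ 2 by rewrite mulr_gt0 ?invr_gt0 ?exprn_gt0.
rewrite -(pmulr_llt0 _ zm) dE subr_lt0.
have mz0 : 0 < m s ^+ 3 * z^-1 ^+ 2.
  by rewrite mulr_gt0// exprn_gt0// invr_gt0.
rewrite [ltLHS](_ : _ = m s ^+ 3 * z^-1 ^+ 2 * (y - 2^-1 * k * m s) ^+ 2); last by ring.
rewrite [ltRHS](_ : _ = m s ^+ 3 * z^-1 ^+ 2 * (m s * focal C s)); last by ring.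
rewrite ltr_pM2l// -SE -[ltLHS]real_normK ?num_real// ltr_sqr ?nnegrE ?normr_ge0 ?(ltW S0)//.
by rewrite ltr_norml; apply/andP; split; move: yY yk; rewrite /Y; lra.
Qed.

End Exp.

Section TwoBalls.
Context {R : realType} {n : nat}.
Variables C D : weighted_curve R n.

(** The two curves are at equal weighted distance from the point dividing the segment
    between them in the ratio of the weights.  Lengthening [w] by the factor [x] moves
    the point across: to first order in [x^2 - 1] the distance to [D] grows less than
    the length of [w], and the deviation of the point from the segment contributes
    only the second order term [(x c1 - cx)^2]. *)
Lemma double_critical_nonmin s t (w : 'rV[R]_n) (e : R) :
  dotr w (pos1 C s) = 0 -> 0 < dotr w w -> weight1 C s ^+ 2 * dotr w w < 1 ->
  (weight C s + weight D t) *: (exp_at C s w - pos C s) = weight C s *: (pos D t - pos C s) ->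
  1 < e ->
  exists x : R, [/\ 1 < x, x ^+ 2 < e, weight1 C s ^+ 2 * dotr (x *: w) (x *: w) <= 1 &
    wsqdist D (exp_at C s (x *: w)) t < dotr (x *: w) (x *: w)].
Proof.
move=> wg w0 mw seg e1.
have a0 := weight_gt0 C s; have b0 := weight_gt0 D t.
pose u := dotr w w; pose b := weight1 C s ^+ 2 * u.
have c10 := exp_factor_gt0 mw; pose c1 := exp_factor C s u; have c1E := exp_factor_sqr (ltW mw).
(* x^2 = 1 + eta stays below e and in the domain of the exponential map, and the
   third bound makes the second order term negligible. *)
pose eta := Num.min (Num.min (e - 1) (1 - b)) (weight D t * c1 ^+ 2 / weight C s) / 2.
have b1 : b < 1 by [].
have bt : 0 < weight D t * c1 ^+ 2 / weight C s.
  by rewrite divr_gt0// mulr_gt0// exprn_gt0.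
have [eta0 etae etab etac] : [/\ 0 < eta, eta < e - 1, eta < 1 - b &
    eta < weight D t * c1 ^+ 2 / weight C s].
  have h0 : 0 < Num.min (Num.min (e - 1) (1 - b)) (weight D t * c1 ^+ 2 / weight C s).
    by rewrite !lt_min bt !subr_gt0 e1 b1.
  have h1 : Num.min (Num.min (e - 1) (1 - b)) (weight D t * c1 ^+ 2 / weight C s) <= e - 1.
    by rewrite !ge_min lexx.
  have h2 : Num.min (Num.min (e - 1) (1 - b)) (weight D t * c1 ^+ 2 / weight C s) <= 1 - b.
    by rewrite !ge_min lexx orbT.
  have h3 : Num.min (Num.min (e - 1) (1 - b)) (weight D t * c1 ^+ 2 / weight C s)
     <= weight D t * c1 ^+ 2 / weight C s by rewrite !ge_min lexx orbT.
  by rewrite /eta; split; lra.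
pose x := Num.sqrt (1 + eta).
have xE : x ^+ 2 = 1 + eta by rewrite sqr_sqrtr//; lra.
have x0 : 0 <= x by exact: sqrtr_ge0.
have x1 : 1 < x by rewrite -(@ltr_sqr _ 1 x) ?nnegrE// expr1n xE; lra.
have b0' : 0 <= b by rewrite mulr_ge0 ?sqr_ge0// ltW.
have uxE : dotr (x *: w) (x *: w) = x ^+ 2 * u.
  by rewrite dotrZl dotrZr -/u; ring.
have bx : weight1 C s ^+ 2 * (x ^+ 2 * u) <= 1.
  rewrite mulrCA -/b xE; nra.
move: (x) xE x0 x1 uxE bx => {}x xE x0 x1 uxE bx.
have wxg : dotr (x *: w) (pos1 C s) = 0 by rewrite dotrZl wg mulr0.
exists x; split; rewrite ?uxE//; first by lra.
have bx' : weight1 C s ^+ 2 * dotr (x *: w) (x *: w) <= 1 by rewrite uxE.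
have [_ wE] := exp_at_critical wxg bx'.
rewrite wsqdist_lt /sqdist.
have dE : pos D t - pos C s = ((weight C s + weight D t) / weight C s) *: (exp_at C s w - pos C s).
  rewrite mulrC -scalerA seg scalerA mulVf ?scale1r// gt_eqF//.
have -> : exp_at C s (x *: w) - pos D t =
    (exp_at C s (x *: w) - pos C s) - (pos D t - pos C s).
  by rewrite opprB addrA subrK.
rewrite dE !exp_atB uxE -/u -/c1.
have cxE := exp_factor_sqr bx; have cx0 : 0 <= exp_factor C s (x ^+ 2 * u) := sqrtr_ge0 _.
move: cxE cx0; move: (exp_factor _ _ _) => cx cxE cx0.
rewrite -/c1 -/u -/b in c1E c10.
rewrite !dotrE (unit_speed C) (dotrC (pos1 C s)) wg -/u.
move: seg wE wxg bx' dE uxE => _ _ _ _ _ _.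
have {bx} bx : weight1 C s ^+ 2 * (x ^+ 2 * u) = x ^+ 2 * b by rewrite mulrCA.
rewrite bx in cxE.
have second_order : weight C s * (x * c1 - cx) ^+ 2 < weight D t * (x ^+ 2 - 1).
  have pr : (x * c1 - cx) * (x * c1 + cx) = x ^+ 2 - 1.
    by rewrite -subr_sqr exprMn c1E cxE; ring.
  have sc : c1 < x * c1 + cx by rewrite ltr_wpDr// ltr_pMl.
  have s0 : 0 < x * c1 + cx by apply: lt_trans sc.
  have h : weight C s * (x ^+ 2 - 1) < weight D t * (x * c1 + cx) ^+ 2.
    apply: (@lt_trans _ _ (weight D t * c1 ^+ 2)).
      by move: etac; rewrite ltr_pdivlMr// xE; lra.
    by rewrite ltr_pM2l// ltr_sqr ?nnegrE// ltW.
  have s20 : 0 < (x * c1 + cx) ^+ 2 by rewrite exprn_gt0.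
  rewrite -(ltr_pM2r s20).
  rewrite [ltLHS](_ : _ = (x ^+ 2 - 1) * (weight C s * (x ^+ 2 - 1))); last first.
    by rewrite -{1 2}pr; ring.
  rewrite -[ltRHS]mulrA [ltRHS]mulrCA ltr_pM2l// xE; lra.
rewrite -subr_gt0.
set lhs := (X in 0 < X).
suff -> : lhs = u * (weight C s + weight D t) *
   (weight D t * (x ^+ 2 - 1) - weight C s * (x * c1 - cx) ^+ 2).
  apply: mulr_gt0; last by rewrite subr_gt0.
  by apply: mulr_gt0; rewrite ?addr_gt0.
rewrite /lhs.
have b_u : u * weight1 C s ^+ 2 = b by rewrite /b mulrC.
transitivity (weight D t ^+ 2 * x ^+ 2 * u
  - (weight C s ^+ 2 * u * (x ^+ 4 * (u * weight1 C s ^+ 2) + x ^+ 2 * cx ^+ 2)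
     + (weight C s + weight D t) ^+ 2 * u * (u * weight1 C s ^+ 2 + c1 ^+ 2)
     - 2 * (weight C s + weight D t) * weight C s * u * (x ^+ 2 * (u * weight1 C s ^+ 2) +
       x * cx * c1))).
  by field; rewrite gt_eqF.
by rewrite b_u sqrrB exprMn cxE c1E; field.
Qed.

End TwoBalls.

(** * Closed curves *)

Section Closed.
Context {R : realType} {n : nat}.
Variable C : weighted_curve R n.
Implicit Types (p : 'rV[R]_n) (s t : R).
Local Notation g := (pos C).
Local Notation g1 := (pos1 C).
Local Notation g2 := (pos2 C).
Local Notation m := (weight C).
Local Notation m1 := (weight1 C).
Local Notation L := (period C).

Lemma periodic_int (T : Type) (f : R -> T) : (forall s, f (s + L) = f s) ->
  forall (z : int) s, f (s + z%:~R * L) = f s.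
Proof.
move=> fL; have natP (k : nat) s : f (s + k%:R * L) = f s.
  elim: k s => [|k IH] s; first by rewrite mul0r addr0.
  by rewrite -[in LHS]natr1 mulrDl mul1r addrA fL.
move=> [k|k] s; first by rewrite natP.
by rewrite NegzE mulrNz mulNr -[in RHS](subrK (k.+1%:R * L) s) natP.
Qed.

Lemma pos1_periodic s : g1 (s + L) = g1 s.
Proof.
have Ds : is_derive s 1 (fun t : R => t + L) 1.
  by eapply derive_eq; [der|rewrite addr0].
have := derive_vcomp (f := g) (g := fun t => t + L) (derive_pos C (s + L)) Ds.
rewrite (_ : (fun _ => _) = g); last by apply/funext => t; rewrite pos_periodic.
by move=> /(derive_uniq (derive_pos C s)) ->; rewrite scale1r.
Qed.

Lemma weight1_periodic s : m1 (s + L) = m1 s.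
Proof.
have Ds : is_derive s 1 (fun t : R => t + L) 1.
  by eapply derive_eq; [der|rewrite addr0].
have := derive_scomp (f := m) (g := fun t => t + L) (derive_weight C (s + L)) Ds.
rewrite (_ : (fun _ => _) = m); last by apply/funext => t; rewrite weight_periodic.
by move=> /(derive_uniq (derive_weight C s)) ->; rewrite mulr1.
Qed.

Lemma wsqdist_periodic p (z : int) s : wsqdist C p (s + z%:~R * L) = wsqdist C p s.
Proof.
rewrite /wsqdist /sqdist (periodic_int (pos_periodic C)).
by rewrite (periodic_int (weight_periodic C)).
Qed.

Lemma slope_periodic p (z : int) s : slope C p (s + z%:~R * L) = slope C p s.
Proof.
rewrite /slope /sqdist (periodic_int (pos_periodic C)) (periodic_int pos1_periodic).
by rewrite (periodic_int (weight_periodic C)) (periodic_int weight1_periodic).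
Qed.

Lemma reduce_period a s : exists z : int, a <= s + z%:~R * L < a + L.
Proof.
exists (- Num.floor ((s - a) / L)); rewrite mulrNz mulNr.
have L0 := period_gt0 C.
have /andP[f1 f2] := floor_itv ((s - a) / L).
rewrite ler_pdivlMr// in f1; rewrite ltr_pdivrMr// intrD mulrDl mul1r in f2.
by apply/andP; split; lra.
Qed.

Lemma periodic_bounded (f : R -> R) : (forall s, f (s + L) = f s) ->
  continuous f -> exists M, forall s, f s <= M.
Proof.
move=> fL fc; have [||c _ fM] := @EVT_max R f 0 L; first exact/ltW/period_gt0.
  exact: continuous_subspaceT.
exists (f c) => s; have [z /andP[z1 z2]] := reduce_period 0 s.
rewrite -(periodic_int fL z); apply: fM; rewrite in_itv/= z1/=.
by rewrite add0r in z2; exact: ltW.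
Qed.

Lemma nearest_point p : exists t, slope C p t = 0 /\
  forall t', wsqdist C p t <= wsqdist C p t'.
Proof.
have [||c _ minc] := @EVT_min R (wsqdist C p) 0 L; first exact/ltW/period_gt0.
  apply: derivable_within_continuous => x _.
  by have [] := derive_wsqdist C p x.
have minC t : wsqdist C p c <= wsqdist C p t.
  have [z /andP[z1 z2]] := reduce_period 0 t.
  rewrite -(wsqdist_periodic p z t); apply: minc; rewrite in_itv/= z1/=.
  by rewrite add0r in z2; exact: ltW.
exists c; split => //; apply: (@min_slope0 _ _ C p (c - 1) (c + 1)).
  by apply/andP; split; lra.
by move=> t _; exact: minC.
Qed.

(** A straight curve would be monotone in the direction of its tangent. *)
Lemma curved : exists s, g2 s != 0.
Proof.
apply/not_existsP => H; have g20 s : g2 s = 0.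
  by apply/eqP; have := H s; move/negP; rewrite negbK.
have g1c x : g1 x = g1 0.
  apply: (@derive0_vcst _ _ g1 (- `|x| - 1) (`|x| + 1)) => [y _||].
  - by apply: derive_eq (derive_pos1 C y) (g20 y).
  - by have := ler_norm x; have := ler_norm (- x); rewrite normrN => *; apply/andP; split; lra.
  - by have := normr_ge0 x; move=> *; apply/andP; split; lra.
have : dotr (g 0) (g1 0) < dotr (g L) (g1 0).
  apply: (@derive_lt _ (fun s => dotr (g s) (g1 0)) (fun=> 1)).
  - exact: period_gt0.
  - move=> x _; have Dg := derive_pos C; eapply derive_eq; first by der.
    by cbv beta; rewrite dotr0r addr0 g1c unit_speed.
  - by move=> *; exact: ltr01.
by rewrite -[L]add0r pos_periodic ltxx.
Qed.

(** At a curved point the tangent and the second derivative are orthogonal and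
    nonzero, so that they are not both parallel to a given tangent. *)
Lemma normal_exists s : exists nu : 'rV[R]_n, dotr nu nu = 1 /\ dotr nu (g1 s) = 0.
Proof.
have proj (u : 'rV[R]_n) : dotr (u - dotr u (g1 s) *: g1 s) (g1 s) = 0.
  by rewrite !dotrE unit_speed mulr1 subrr.
suff [v [v0 vg]] : exists v : 'rV[R]_n, v != 0 /\ dotr v (g1 s) = 0.
  have e0 : 0 < enorm v by rewrite sqrtr_gt0 dotr_gt0.
  exists ((enorm v)^-1 *: v); split; last by rewrite dotrZl vg mulr0.
  by rewrite dotrZl dotrZr -enorm_sqr; field; exact: lt0r_neq0.
have [s0 g20] := curved.
have [u0|] := eqVneq (g1 s0 - dotr (g1 s0) (g1 s) *: g1 s) 0; last first.
  by move=> H; eexists; split; [exact: H|exact: proj].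
have [v0|] := eqVneq (g2 s0 - dotr (g2 s0) (g1 s) *: g1 s) 0; last first.
  by move=> H; eexists; split; [exact: H|exact: proj].
exfalso; move/eqP: u0 v0; rewrite subr_eq0 => /eqP u0 /eqP; rewrite subr_eq0 => /eqP v0.
have := dotr_g12 C s0; rewrite {1}u0 {1}v0 !dotrE unit_speed mulr1 => /eqP.
rewrite mulf_eq0 => /orP[] /eqP z.
  have := unit_speed C s0; rewrite u0 z scale0r dotr0l; lra.
by move: g20; rewrite v0 z scale0r eqxx.
Qed.

(** Where the curvature vanishes, any unit normal will do. *)
Lemma curvature_normal s : exists nu : 'rV[R]_n,
  [/\ dotr nu nu = 1, dotr nu (g1 s) = 0 & g2 s = enorm (g2 s) *: nu].
Proof.
have [g0|g0] := eqVneq (g2 s) 0.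
  have [nu [n1 n2]] := normal_exists s; exists nu; split => //.
  by rewrite g0 /enorm dotr0l sqrtr0 scale0r.
have e0 : 0 < enorm (g2 s) by rewrite sqrtr_gt0 dotr_gt0.
exists ((enorm (g2 s))^-1 *: g2 s); split.
- by rewrite dotrZl dotrZr -enorm_sqr; field; exact: lt0r_neq0.
- by rewrite dotrZl dotrC dotr_g12 mulr0.
- by rewrite scalerA divff ?scale1r// gt_eqF.
Qed.

End Closed.

Section Window.
Context {R : realType} {n : nat}.
Variable C : weighted_curve R n.
Local Notation L := (period C).

Lemma int_mul_period (z : int) : 0 < z%:~R * L < L -> False.
Proof.
have L0 := period_gt0 C; rewrite pmulr_lgt0// ltr0z => /andP[z0].
by rewrite -[ltRHS]mul1r ltr_pM2r// ltrz1 ltNge -gtz0_ge1 z0.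
Qed.

Lemma int_mul_period0 (z : int) : - L < z%:~R * L < L -> z%:~R * L = 0.
Proof.
move=> /andP[z1 z2]; have [z0|z0|->//] := ltgtP (z%:~R * L) 0.
  exfalso; apply: (@int_mul_period (- z)); rewrite mulrNz mulNr.
  by apply/andP; split; lra.
by exfalso; apply: (@int_mul_period z); rewrite z0.
Qed.

(** Up to the period, a parameter is either close to [s0] or in a fixed compact
    segment, on which [near_segment] applies. *)
Lemma window s0 e t : 0 < e ->
  (exists z : int, s0 - e < t + z%:~R * L < s0 + e) \/
  (exists z : int, s0 + e <= t + z%:~R * L <= s0 - e + L).
Proof.
move=> e0; have L0 := period_gt0 C.
have [z /andP[z1 z2]] := reduce_period C (s0 - e) t.
have [h|h] := leP (s0 + e) (t + z%:~R * L).
  by right; exists z; rewrite h ltW.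
move: z1; rewrite le_eqVlt => /predU1P[z1|z1]; last by left; exists z; rewrite z1.
have zE : t + (z + 1)%:~R * L = s0 - e + L.
  by rewrite intrD mulrDl mul1r addrA -z1.
have [h'|h'] := leP (s0 + e) (s0 - e + L).
  by right; exists (z + 1); rewrite zE h' lexx.
by left; exists (z + 1); rewrite zE h' andbT; lra.
Qed.

Lemma cvg_exp_at (T : Type) (F : set_system T) (FF : Filter F)
    (S : T -> R) (W : T -> 'rV[R]_n) s0 w0 :
  S z @[z --> F] --> s0 -> W z @[z --> F] --> w0 ->
  exp_at C (S z) (W z) @[z --> F] --> exp_at C s0 w0.
Proof.
move=> Ss Ww.
have mz := cvg_along FF Ss (derive_weight C s0).
have m1z := cvg_along FF Ss (derive_weight1 C s0).
have gz := cvg_along FF Ss (derive_pos C s0).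
have g1z := cvg_along FF Ss (derive_pos1 C s0).
have wwz : dotr (W z) (W z) @[z --> F] --> dotr w0 w0 by exact: cvg_dotr.
have cz : exp_factor C (S z) (dotr (W z) (W z)) @[z --> F] --> exp_factor C s0 (dotr w0 w0).
  have h : 1 - weight1 C (S z) ^+ 2 * dotr (W z) (W z) @[z --> F] -->
     1 - weight1 C s0 ^+ 2 * dotr w0 w0.
    by apply: cvgB; [exact: cvg_cst|apply: cvgM => //; apply: cvgM].
  exact: continuous_cvg (@sqrt_continuous R _) h.
apply: cvgD; last by apply: cvgZ => //; exact: cvgM.
by apply: cvgB => //; apply: cvgZ; [exact: cvgM|exact: cvgZ].
Qed.

Lemma cvg_log_at (T : Type) (F : set_system T) (FF : Filter F)
    (P : T -> 'rV[R]_n) (S : T -> R) p0 s0 :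
  P z @[z --> F] --> p0 -> S z @[z --> F] --> s0 ->
  weight1 C s0 ^+ 2 * wsqdist C p0 s0 < 1 ->
  log_at C (P z) (S z) @[z --> F] --> log_at C p0 s0.
Proof.
move=> Pp Ss mw.
have mz := cvg_along FF Ss (derive_weight C s0).
have m1z := cvg_along FF Ss (derive_weight1 C s0).
have g1z := cvg_along FF Ss (derive_pos1 C s0).
have dz := cvg_chord FF Pp Ss.
have wz := cvg_wsqdist FF Pp Ss.
have cz : exp_factor C (S z) (wsqdist C (P z) (S z)) @[z --> F] --> exp_factor C s0
  (wsqdist C p0 s0).
  have h : 1 - weight1 C (S z) ^+ 2 * wsqdist C (P z) (S z) @[z --> F] -->
     1 - weight1 C s0 ^+ 2 * wsqdist C p0 s0.
    by apply: cvgB; [exact: cvg_cst|apply: cvgM => //; apply: cvgM].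
  exact: continuous_cvg (@sqrt_continuous R _) h.
apply: cvgZ.
  apply: cvgV; last exact: cvgM.
  by rewrite mulf_neq0 ?gt_eqF ?weight_gt0// exp_factor_gt0.
by apply: cvgB => //; apply: cvgZ => //; exact: cvg_dotr.
Qed.

Lemma log_at_periodic p (z : int) s : log_at C p (s + z%:~R * L) = log_at C p s.
Proof.
rewrite /log_at /normal_part /exp_factor wsqdist_periodic.
rewrite (periodic_int (pos_periodic C)) (periodic_int (pos1_periodic C)).
by rewrite (periodic_int (weight_periodic C)) (periodic_int (weight1_periodic C)).
Qed.

End Window.

Section PeriodicSecond.
Context {R : realType} {n : nat}.
Variable C : weighted_curve R n.
Local Notation L := (period C).

Lemma pos2_periodic s : pos2 C (s + L) = pos2 C s.
Proof.
have Ds : is_derive s 1 (fun t : R => t + L) 1.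
  by eapply derive_eq; [der|rewrite addr0].
have := derive_vcomp (f := pos1 C) (g := fun t => t + L) (derive_pos1 C (s + L)) Ds.
rewrite (_ : (fun _ => _) = pos1 C); last by apply/funext => t; rewrite pos1_periodic.
by move=> /(derive_uniq (derive_pos1 C s)) ->; rewrite scale1r.
Qed.

Lemma weight2_periodic s : weight2 C (s + L) = weight2 C s.
Proof.
have Ds : is_derive s 1 (fun t : R => t + L) 1.
  by eapply derive_eq; [der|rewrite addr0].
have := derive_scomp (f := weight1 C) (g := fun t => t + L) (derive_weight1 C (s + L)) Ds.
rewrite (_ : (fun _ => _) = weight1 C); last by apply/funext => t; rewrite weight1_periodic.
by move=> /(derive_uniq (derive_weight1 C s)) ->; rewrite mulr1.
Qed.

Lemma focal_sqr_periodic s : focal_sqr C (s + L) = focal_sqr C s.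
Proof.
rewrite /focal_sqr /focal pos2_periodic weight2_periodic weight1_periodic.
by rewrite (weight_periodic C).
Qed.

Lemma focal_sqr_bounded : exists M, forall s, focal_sqr C s <= M.
Proof.
apply: (periodic_bounded focal_sqr_periodic) => s.
exact: (@cvg_focal_sqr _ _ C _ (nbhs s) _ id s (@cvg_id _ _)).
Qed.

Lemma weight1_sqr_bounded : exists M, forall s, `|weight1 C s| ^+ 2 <= M.
Proof.
apply: (@periodic_bounded _ _ C) => [s|s]; first by rewrite weight1_periodic.
have w1 : weight1 C t @[t --> s] --> weight1 C s by exact: derive_cont (derive_weight1 C s).
by apply: cvgM; exact: cvg_norm.
Qed.

(** For a constant weight, [focal] is a positive multiple of the squared
    curvature. *)
Lemma focal_sqr_gt0_ex : (forall s, weight1 C s = 0) -> exists s, 0 < focal C s /\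
  0 < focal_sqr C s.
Proof.
move=> m10; have [s g20] := curved C; exists s.
have m20 : weight2 C s = 0.
  apply: (@local_cst_derive _ (weight1 C) (s - 1) (s + 1) s _ _ _ (derive_weight1 C s)).
    by apply/andP; split; lra.
  by move=> x _; rewrite !m10.
have k0 : 0 < dotr (pos2 C s) (pos2 C s) by exact: dotr_gt0.
have m0 := weight_gt0 C s.
have f0 : 0 < focal C s by rewrite /focal m20 add0r !mulr_gt0 ?invr_gt0.
split => //; apply: lt_le_trans (collapse_le_focal C s).
by rewrite /collapse_sqr ltr_wpDl ?sqr_ge0// !mulr_gt0 ?invr_gt0// exprn_gt0.
Qed.

End PeriodicSecond.

(** * Links and their disc bundles *)

Section Link.
Context {R : realType} {n m : nat}.
Variables (L : 'I_m -> R) (gamma : 'I_m -> R -> 'rV[R]_n) (mu : 'rV[R]_n -> R).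
Hypothesis gamma_link : unit_speed_link L gamma.
Hypothesis mu_gt0 : forall q, carrier gamma q -> 0 < mu q.
Hypothesis mu_C3 : forall i, class_C 3 (mu_s gamma mu i).

Lemma link_derive i k (s : R) :
  is_derive s 1 (derive1n k (gamma i)) (derive1n k.+1 (gamma i) s).
Proof.
have [H _] := link_smooth gamma_link i k.+1.
by apply: DeriveDef; [exact: H|rewrite derive1nS derive1E].
Qed.

Lemma link_weight_derive i k (s : R) : (k < 3)%N ->
  is_derive s 1 (derive1n k (mu_s gamma mu i)) (derive1n k.+1 (mu_s gamma mu i) s).
Proof.
move=> k3; have [H _] := mu_C3 i.
by apply: DeriveDef; [exact: H|rewrite derive1nS derive1E].
Qed.

Lemma link_weight_continuous2 i : continuous (derive1n 2 (mu_s gamma mu i)).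
Proof. by move=> s; exact: derive_cont (@link_weight_derive i 2 s isT). Qed.

Lemma link_speed i s :
  dotr (derive1n 1 (gamma i) s) (derive1n 1 (gamma i) s) = 1.
Proof. by rewrite -enorm_sqr (link_unit_speed gamma_link) expr1n. Qed.

Lemma link_weight_gt0 i s : 0 < mu_s gamma mu i s.
Proof. by apply: mu_gt0; exists i, s. Qed.

Lemma link_weight_periodic i s : mu_s gamma mu i (s + L i) = mu_s gamma mu i s.
Proof. by rewrite /mu_s (link_periodic gamma_link). Qed.

(** The i-th component as a weighted curve. *)
Definition strand i : weighted_curve R n := WeightedCurve
  (link_derive i 0) (link_derive i 1) (link_derive i 2)
  (@link_weight_derive i 0 ^~ isT) (@link_weight_derive i 1 ^~ isT)
  (@link_weight_continuous2 i) (link_speed i) (link_weight_gt0 i)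
  (link_length_gt0 gamma_link i) (link_periodic gamma_link i) (link_weight_periodic i).

Lemma strand_inj i j s t : pos (strand i) s = pos (strand j) t ->
  i = j /\ exists z : int, s = t + z%:~R * period (strand i).
Proof.
move=> /(link_simple_disjoint gamma_link)[ij [z st]]; split => //.
by exists z; rewrite -[RHS]/(t + z%:~R * L i) -st addrC subrK.
Qed.

Lemma curv2E i s : curvature gamma i s ^+ 2 = curv2 (strand i) s.
Proof. exact: enorm_sqr. Qed.

Lemma focal_discE i s : focal_disc gamma mu i s = focal (strand i) s.
Proof. by rewrite /focal_disc curv2E. Qed.

Lemma derive2_weight_sqr i s : derive1n 2 (fun t => mu_s gamma mu i t ^+ 2) s =
  2 * (weight1 (strand i) s ^+ 2 + weight (strand i) s * weight2 (strand i) s).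
Proof.
have Dm := derive_weight (strand i); have Dm1 := derive_weight1 (strand i).
have d1 (t : R) : is_derive t 1 (fun t => weight (strand i) t ^+ 2) (2 * weight (strand i)
  t * weight1 (strand i) t).
  exact: derive_exp2.
have -> : derive1n 2 (fun t => mu_s gamma mu i t ^+ 2) =
    derive1 (fun t => 2 * weight (strand i) t * weight1 (strand i) t).
  rewrite derive1nS derive1n1; congr derive1; apply/funext => t.
  by rewrite derive1E; have [_ ->] := d1 t.
rewrite derive1E; apply: derive_val.
by eapply derive_eq; [der|cbv beta; ring].
Qed.

Lemma LambdaE i s : 0 < focal (strand i) s ->
  Lambda gamma mu i s = focal_sqr (strand i) s.
Proof.
move=> f0; rewrite /Lambda focal_discE derive2_weight_sqr curv2E /focal_sqr.
have mf : 0 <= weight (strand i) s * focal (strand i) s by rewrite mulr_ge0// ltW// weight_gt0.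
have := sqr_sqrtr mf.
rewrite -[mu_s gamma mu i s]/(weight (strand i) s) -[curvature gamma i s]/(enorm (pos2
  (strand i) s)).
rewrite {2}/focal -/(curv2 (strand i) s) /curv2 -!enorm_sqr.
move: (Num.sqrt (_ * focal _ _)) (enorm (pos2 _ _)) => S k SE.
transitivity (weight1 (strand i) s ^+ 2 + (2^-1 * k * weight (strand i) s) ^+ 2 +
  k * weight (strand i) s * S + S ^+ 2).
  by rewrite SE; field.
by field.
Qed.

Lemma gradE i s : grad gamma mu (pos (strand i) s) = weight1 (strand i) s *: pos1 (strand i) s.
Proof.
rewrite /grad; case: xgetP => [v _ [j [t [gE ->]]]|]; last first.
  by move=> /(_ (weight1 (strand i) s *: pos1 (strand i) s)); case; exists i, s.
have [ij [z sE]] := @strand_inj i j s t gE; subst j.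
by rewrite sE (periodic_int (weight1_periodic (strand i))) (periodic_int (pos1_periodic
  (strand i))).
Qed.

Lemma enorm_grad i s : enorm (grad gamma mu (pos (strand i) s)) = `|weight1 (strand i) s|.
Proof.
by rewrite gradE enormZ /enorm unit_speed sqrtr1 mulr1.
Qed.

Lemma exp_muE i s (w : 'rV[R]_n) :
  exp_mu gamma mu (pos (strand i) s, w) = exp_at (strand i) s w.
Proof.
rewrite /exp_mu/= enorm_grad real_normK ?num_real// enorm_sqr gradE.
by rewrite /exp_at /exp_factor.
Qed.

Definition grad_bounds (r : R) := forall i, grad_bound (strand i) r.

Lemma disc_bundleP r (q w : 'rV[R]_n) : 0 < r -> disc_bundle gamma r (q, w) <->
  exists i s, [/\ q = pos (strand i) s, dotr w (pos1 (strand i) s) = 0 &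
    dotr w w < r ^+ 2].
Proof.
move=> r0; have wE : (enorm w < r) = (dotr w w < r ^+ 2).
  by rewrite -enorm_sqr ltr_sqr ?nnegrE ?enorm_ge0// ltW.
split=> [[[i [s [x1 x2]]] x3]|[i [s [x1 x2 x3]]]].
  by exists i, s; split => //; rewrite -wE.
by split; [exists i, s|rewrite /= wE].
Qed.

(** The domain of the exponential map is cut out by a condition on [|w|] only, and
    every parameter carries normal vectors of all lengths. *)
Lemma disc_domainP r : 0 < r ->
  disc_bundle gamma r `<=` exp_domain gamma mu <-> grad_bounds r.
Proof.
move=> r0; split=> [H i s|H [q w] /[dup] Dx [Nx xr]]; last first.
  split => // gN0; have [i [s [x1 _ x3]]] := (disc_bundleP q w r0).1 Dx.
  move: gN0; rewrite [_.1]x1 enorm_grad gradE => gN0.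
  have mN0 : weight1 (strand i) s != 0.
    by apply: contraNneq gN0 => ->; rewrite scale0r.
  have m0 : 0 < `|weight1 (strand i) s| by rewrite normr_gt0.
  apply: (le_trans (ltW xr)); rewrite -[leRHS]mul1r ler_pdivlMr//.
  rewrite -(@expr_le1 _ 2)// ?mulr_ge0 ?(ltW r0)//.
  by rewrite exprMn real_normK ?num_real// mulrC; exact: H.
have [nu [nu1 nug]] := normal_exists (strand i) s.
have [->|mN0] := eqVneq (weight1 (strand i) s) 0; first by rewrite expr0n mul0r ler01.
have m0 : 0 < `|weight1 (strand i) s| by rewrite normr_gt0.
(* Otherwise a normal vector of intermediate length is in the disc bundle and
   outside the domain. *)
suff : r <= `|weight1 (strand i) s|^-1.
  rewrite -[X in _ <= X]mul1r ler_pdivlMr// => rm.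
  rewrite -[weight1 _ _ ^+ 2]real_normK ?num_real// -exprMn mulrC.
  by rewrite expr_le1// mulr_ge0// ltW.
rewrite leNgt; apply/negP => h.
pose x := (r + `|weight1 (strand i) s|^-1) / 2.
have x0 : 0 < x by rewrite divr_gt0// addr_gt0// invr_gt0.
have xr : x < r by rewrite /x; lra.
have en : enorm (x *: nu) = x.
  by rewrite enormZ /enorm nu1 sqrtr1 mulr1 gtr0_norm.
have /H[_ /=] : disc_bundle gamma r (pos (strand i) s, x *: nu).
  split; last by rewrite /= en.
  by exists i, s; split => //=; rewrite dotrZl nug mulr0.
rewrite enorm_grad en gradE => H1.
suff : x <= `|weight1 (strand i) s|^-1 by rewrite /x; lra.
apply: H1; apply/eqP => /(congr1 (fun v => dotr v (pos1 (strand i) s))).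
cbv beta; rewrite dotrZl unit_speed mulr1 dotr0l => /eqP.
by rewrite (negPf mN0).
Qed.

(** By [disc_critical] and [critical_disc], the parameters [s] with this property are
    the feet of the preimages of [p] in the disc bundle of radius [r]. *)
Definition critical r p i s := slope (strand i) p s = 0 /\ wsqdist (strand i) p s < r ^+ 2.

Lemma disc_critical r q w : 0 < r -> grad_bounds r -> disc_bundle gamma r (q, w) ->
  exists i s, [/\ q = pos (strand i) s, w = log_at (strand i) (exp_mu gamma mu (q, w)) s,
    dotr w (pos1 (strand i) s) = 0 /\ weight1 (strand i) s ^+ 2 * dotr w w < 1,
    critical r (exp_mu gamma mu (q, w)) i s &
    wsqdist (strand i) (exp_mu gamma mu (q, w)) s = dotr w w].
Proof.
move=> r0 gr /(disc_bundleP _ _ r0)[i [s [x1 x2 x3]]].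
exists i, s; have mw : weight1 (strand i) s ^+ 2 * dotr w w < 1.
  have [->|mN0] := eqVneq (weight1 (strand i) s) 0; first by rewrite expr0n mul0r ltr01.
  by apply: lt_le_trans (gr i s); rewrite ltr_pM2l// exprn_even_gt0.
rewrite x1 exp_muE log_atK//.
by have [sl ww] := exp_at_critical x2 (ltW mw); split=> //; split=> //; rewrite ww.
Qed.

Lemma critical_grad r p i s : 0 < r -> grad_bounds r -> critical r p i s ->
  weight1 (strand i) s ^+ 2 * wsqdist (strand i) p s < 1.
Proof.
move=> r0 gr [_ pr].
have [->|mN0] := eqVneq (weight1 (strand i) s) 0; first by rewrite expr0n mul0r ltr01.
by apply: lt_le_trans (gr i s); rewrite ltr_pM2l// exprn_even_gt0.
Qed.

Lemma critical_disc r p i s : 0 < r -> grad_bounds r -> critical r p i s ->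
  disc_bundle gamma r (pos (strand i) s, log_at (strand i) p s) /\
  exp_mu gamma mu (pos (strand i) s, log_at (strand i) p s) = p.
Proof.
move=> r0 gr cr; have mw := critical_grad r0 gr cr; have [sl pr] := cr.
have [eE lg ll] := exp_atK sl mw; rewrite exp_muE; split => //.
by apply/disc_bundleP => //; exists i, s; split => //=; rewrite ll.
Qed.

(** Injectivity of the exponential map, read on critical points. *)
Definition injective_radius r := forall p i s j t,
  critical r p i s -> critical r p j t -> pos (strand i) s = pos (strand j) t.

Lemma homeo_injective r : 0 < r -> grad_bounds r ->
  homeo_between (disc_bundle gamma r)
    (exp_mu gamma mu @` disc_bundle gamma r) (exp_mu gamma mu) ->
  injective_radius r.
Proof.
move=> r0 gr [f [_ _ _ _ [fK _]]] p i s j t ci cj.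
have [Di Ei] := critical_disc r0 gr ci; have [Dj Ej] := critical_disc r0 gr cj.
have := fK _ Di; rewrite Ei -[in f _]Ej (fK _ Dj) => e.
exact: (esym (congr1 fst e)).
Qed.

(** * Topology of the exponential map *)

Lemma carrierP q : carrier gamma q <-> exists i s, pos (strand i) s = q.
Proof. by split=> [[i [s qE]]|[i [s qE]]]; exists i, s. Qed.

(** The rest of the link is compact and misses the point [pos (strand i) s0]. *)
Lemma link_near i s0 e : 0 < e -> \forall q \near pos (strand i) s0,
  forall j t, pos (strand j) t = q ->
    j = i /\ exists z : int, s0 - e < t + z%:~R * period (strand i) < s0 + e.
Proof.
move=> e0; pose q0 := pos (strand i) s0; have L0 := period_gt0 (strand i).
have sq_cvg j t : sqdist (strand j) z.1 z.2 @[z --> (q0, t)] --> sqdist (strand j) q0 t.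
  by apply: cvg_sqdist; [exact: cvg_fst|exact: cvg_snd].
have sq0 j t : sqdist (strand j) q0 t = 0 -> pos (strand i) s0 = pos (strand j) t.
  by move=> /dotr_eq0/eqP; rewrite subr_eq0 => /eqP.
have N1 : \forall q \near q0, forall t, s0 + e <= t <= s0 - e + period (strand i) ->
    0 < sqdist (strand i) q t.
  apply: (@near_segment _ _ (sqdist (strand i))) => // t /andP[t1 t2];
    rewrite lt_def sqdist_ge0 andbT.
  apply/eqP => /sq0/strand_inj[_ [z zE]].
  by apply: (@int_mul_period _ _ (strand i) (- z)); rewrite mulrNz mulNr; apply/andP; split; lra.
have N2 : \forall q \near q0, forall j, j != i ->
    forall t, 0 <= t <= period (strand j) -> 0 < sqdist (strand j) q t.
  suff H j : \forall q \near q0, j != i -> forall t,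
      0 <= t <= period (strand j) -> 0 < sqdist (strand j) q t.
    exact: (@filter_forall _ _ _ (nbhs q0) _ H).
  have [->|ji] := eqVneq j i.
    exact: filterE.
  have : \forall q \near q0, forall t, 0 <= t <= period (strand j) -> 0 < sqdist (strand j) q t.
    apply: (@near_segment _ _ (sqdist (strand j))) => // t _; rewrite lt_def sqdist_ge0 andbT.
    by apply/eqP => /sq0/strand_inj[ij _]; rewrite ij eqxx in ji.
  by apply: filterS => q H _.
near=> q => j t tq.
have q1 : forall t, s0 + e <= t <= s0 - e + period (strand i) -> 0 < sqdist (strand i) q t.
  by near: q; exact: N1.
have q2 : forall j, j != i -> forall t, 0 <= t <= period (strand j) -> 0 < sqdist (strand j) q t.
  by near: q; exact: N2.
have sq (k : 'I_m) x : pos (strand k) x = q -> sqdist (strand k) q x = 0.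
  by move=> xq; rewrite /sqdist xq subrr dotr0l.
have [ji|ji] := eqVneq j i; last first.
  exfalso; have [z /andP[z1 z2]] := reduce_period (strand j) 0 t.
  have := q2 j ji (t + z%:~R * period (strand j)).
  rewrite add0r in z2; rewrite z1 (ltW z2) sq ?ltxx => [/(_ isT)//|].
  by rewrite (periodic_int (pos_periodic (strand j))).
subst j; split => //; have [//|[z zE]] := window (strand i) s0 t e0.
have := q1 _ zE; rewrite sq ?ltxx//.
by rewrite (periodic_int (pos_periodic (strand i))).
Unshelve. all: by end_near. Qed.

(** A continuous local inverse of the parametrization. *)
Lemma chart i s0 : exists S : 'rV[R]_n -> R,
  S q @[q --> within (carrier gamma) (nbhs (pos (strand i) s0))] --> s0 /\
  \forall q \near within (carrier gamma) (nbhs (pos (strand i) s0)), pos (strand i) (S q) = q.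
Proof.
have L0 := period_gt0 (strand i); pose h := period (strand i) / 2.
have h0 : 0 < h by rewrite divr_gt0.
pose S q := xget s0 [set s | pos (strand i) s = q /\ s0 - h < s < s0 + h].
have SP e : 0 < e -> e <= h -> \forall q \near pos (strand i) s0, carrier gamma q ->
    pos (strand i) (S q) = q /\ s0 - e < S q < s0 + e.
  move=> e0 eh; apply: filterS (link_near i s0 e0) => q H.
  move=> /carrierP[j [t tq]]; have [ji [z /andP[z1 z2]]] := H j t tq; subst j.
  have tq' : pos (strand i) (t + z%:~R * period (strand i)) = q.
    by rewrite (periodic_int (pos_periodic (strand i))).
  have [SE /andP[S1 S2]] : pos (strand i) (S q) = q /\ s0 - h < S q < s0 + h.
    apply: (@xgetPex _ s0 [set s | pos (strand i) s = q /\ s0 - h < s < s0 + h]).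
    by exists (t + z%:~R * period (strand i)); split => //; apply/andP; split; lra.
  split => //; suff -> : S q = t + z%:~R * period (strand i) by rewrite z1.
  have := SE; rewrite -[in RHS]tq' => /strand_inj[_ [y yE]].
  have : y%:~R * period (strand i) = 0.
    by apply: int_mul_period0; apply/andP; split; move: S1 S2; rewrite /h in eh *; lra.
  by move: yE => /[swap] ->; rewrite addr0.
exists S; split; last first.
  by rewrite near_withinE; apply: filterS (SP h h0 (lexx _)) => q H /H[].
apply/cvgrPdist_lt => e e0; rewrite near_withinE.
have m0 : 0 < Num.min e h by rewrite lt_min e0.
have me : Num.min e h <= e by rewrite ge_min lexx.
have mh : Num.min e h <= h by rewrite ge_min lexx orbT.
apply: filterS (SP _ m0 mh) => q H /H[_ /andP[S1 S2]].
by rewrite ltr_distlC; apply/andP; split; lra.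
Qed.

Lemma exp_mu_continuous x : normal_bundle gamma x ->
  exp_mu gamma mu y @[y --> within (normal_bundle gamma) (nbhs x)] --> exp_mu gamma mu x.
Proof.
case: x => q0 w0 [i [s0 [q0E' _]]].
have q0E : q0 = pos (strand i) s0 by exact: q0E'.
have [S [Sc SK]] := chart i s0; rewrite -q0E in Sc SK.
have fstw : y.1 @[y --> within (normal_bundle gamma) (nbhs (q0, w0))] -->
    within (carrier gamma) (nbhs q0).
  move=> A NA; exists ([set q | carrier gamma q -> A q], setT).
    by split => //; exact: filterT.
  move=> -[q w] [/= Kq _] [j [t [qE _]]]; apply: Kq; exists j, t; exact: qE.
have sndw : y.2 @[y --> within (normal_bundle gamma) (nbhs (q0, w0))] --> w0.
  exact: cvg_trans (cvg_app _ (cvg_within _)) (cvg_snd).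
have cE : exp_at (strand i) (S y.1) y.2 @[y --> within (normal_bundle gamma) (nbhs (q0, w0))]
    --> exp_mu gamma mu (q0, w0).
  rewrite q0E (exp_muE); have Sf : S y.1 @[y --> within (normal_bundle gamma) (nbhs (q0,
    w0))] --> s0.
    by move=> A /Sc; exact: fstw.
  rewrite q0E in Sf sndw.
  exact: cvg_exp_at Sf sndw.
have E : \forall y \near within (normal_bundle gamma) (nbhs (q0, w0)),
    exp_at (strand i) (S y.1) y.2 = exp_mu gamma mu y.
  have FF : Filter (within (normal_bundle gamma) (nbhs (q0, w0))) by exact: _.
  refine (@filterS _ _ FF _ _ _ (fstw _ SK)) => -[q w] qE.
  by rewrite -(exp_muE) [pos _ _]qE.
exact: (cvg_trans (near_eq_cvg E) cE).
Qed.

Lemma exp_mu_continuous_disc r : {within disc_bundle gamma r, continuous (exp_mu gamma mu)}.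
Proof.
apply/subspace_continuousP => x [Nx xr].
move=> A NA.
refine (@filterS _ (nbhs x) _ _ _ _ (exp_mu_continuous Nx NA)) => y H [Ny _].
exact: H.
Qed.

(** Continuity of the inverse of the exponential map.  A nearest point is critical,
    so that by injectivity [s0] is the only minimum of [wsqdist p0] on its strand; for
    [p] near [p0] the minimum is attained near [s0], and again by injectivity every
    critical point is this one. *)
Lemma critical_tube r p0 i s0 e : injective_radius r -> critical r p0 i s0 ->
  0 < e -> \forall p \near p0, forall j t, critical r p j t ->
    j = i /\ exists z : int, s0 - e < t + z%:~R * period (strand i) < s0 + e.
Proof.
move=> ir cr e0; have L0 := period_gt0 (strand i).
have min0 t : wsqdist (strand i) p0 s0 <= wsqdist (strand i) p0 t.
  have [c [slc cmin]] := nearest_point (strand i) p0.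
  have cc : critical r p0 i c by split => //; exact: le_lt_trans (cmin s0) cr.2.
  have [_ [z sE]] := strand_inj (ir _ _ _ _ _ cr cc).
  by rewrite sE wsqdist_periodic.
have smin0 t : s0 + e <= t <= s0 - e + period (strand i) ->
    wsqdist (strand i) p0 s0 < wsqdist (strand i) p0 t.
  move=> /andP[t1 t2]; rewrite lt_neqAle min0 andbT; apply/eqP => wE.
  have ct : critical r p0 i t.
    split; last by rewrite -wE; exact: cr.2.
    apply: (@min_slope0 _ _ _ p0 (t - 1) (t + 1)); first by apply/andP; split; lra.
    by move=> t' _; rewrite -wE; exact: min0.
  have [_ [z zE]] := strand_inj (ir _ _ _ _ _ cr ct).
  by apply: (@int_mul_period _ _ (strand i) (- z)); rewrite mulrNz mulNr; apply/andP; split; lra.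
have w_cvg t : wsqdist (strand i) z.1 z.2 @[z --> (p0, t)] --> wsqdist (strand i) p0 t.
  by apply: cvg_wsqdist; [exact: cvg_fst|exact: cvg_snd].
have w_cvg0 (t : R) : wsqdist (strand i) z.1 s0 @[z --> (p0, t)] --> wsqdist (strand i) p0 s0.
  by apply: (@cvg_wsqdist _ _ _ _ (nbhs (p0, t)) _ (fun z => z.1) (fun=> s0));
    [exact: cvg_fst|exact: cvg_cst].
have w_cvg1 : wsqdist (strand i) p s0 @[p --> p0] --> wsqdist (strand i) p0 s0.
  by apply: (@cvg_wsqdist _ _ _ _ (nbhs p0) _ id (fun=> s0)); [exact: cvg_id|exact: cvg_cst].
have N1 : \forall p \near p0, forall t, s0 + e <= t <= s0 - e + period (strand i) ->
    0 < wsqdist (strand i) p t - wsqdist (strand i) p s0.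
  apply: (@near_segment _ _ (fun p t => wsqdist (strand i) p t - wsqdist (strand i) p s0)).
    by move=> t _; apply: cvgB; [exact: w_cvg|exact: w_cvg0].
  by move=> t /smin0; rewrite subr_gt0.
near=> p => j t ct.
have p1 : forall t, s0 + e <= t <= s0 - e + period (strand i) ->
    0 < wsqdist (strand i) p t - wsqdist (strand i) p s0 by near: p; exact: N1.
have p2 : wsqdist (strand i) p s0 < r ^+ 2.
  by near: p; exact: cvgr_lt _ w_cvg1 _ cr.2.
have [c [slc cmin]] := nearest_point (strand i) p.
have cc : critical r p i c by split => //; exact: le_lt_trans (cmin s0) p2.
have [ij [z tE]] := strand_inj (ir _ _ _ _ _ cc ct); subst j; split => //.
have [//|[y yE]] := window (strand i) s0 t e0.
have := p1 _ yE; rewrite wsqdist_periodic subr_gt0 ltNge.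
have -> : wsqdist (strand i) p t = wsqdist (strand i) p c by rewrite tE wsqdist_periodic.
by rewrite cmin.
Unshelve. all: by end_near. Qed.

Lemma disc_injective r x y : 0 < r -> grad_bounds r -> injective_radius r ->
  disc_bundle gamma r x -> disc_bundle gamma r y ->
  exp_mu gamma mu x = exp_mu gamma mu y -> x = y.
Proof.
move=> r0 gr ir; case: x y => [q w] [q' w'] Dx Dy xy.
have [i [s [qE wE _ ci _]]] := disc_critical r0 gr Dx.
have [j [t [qE' wE' _ cj _]]] := disc_critical r0 gr Dy.
rewrite xy in wE ci; have [ij [z sE]] := strand_inj (ir _ _ _ _ _ ci cj); subst j.
move: wE wE'; move: (exp_mu _ _ _) => p -> ->.
by rewrite qE qE' sE log_at_periodic (periodic_int (pos_periodic (strand i))).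
Qed.

Lemma injective_homeo r : 0 < r -> grad_bounds r -> injective_radius r ->
  homeo_between (disc_bundle gamma r)
    (exp_mu gamma mu @` disc_bundle gamma r) (exp_mu gamma mu).
Proof.
move=> r0 gr ir.
pose G p := xget (0, 0) [set x | disc_bundle gamma r x /\ exp_mu gamma mu x = p].
have GP x : disc_bundle gamma r x ->
    disc_bundle gamma r (G (exp_mu gamma mu x)) /\
    exp_mu gamma mu (G (exp_mu gamma mu x)) = exp_mu gamma mu x.
  move=> Dx; apply: (@xgetPex _ _ [set y | disc_bundle gamma r y /\
    exp_mu gamma mu y = exp_mu gamma mu x]).
  by exists x.
have GK x : disc_bundle gamma r x -> G (exp_mu gamma mu x) = x.
  by move=> Dx; have [D1 E1] := GP x Dx; exact: (disc_injective r0 gr ir D1 Dx E1).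
exists G; split.
- by move=> x Dx; exists x.
- by move=> _ [x Dx <-]; have [] := GP x Dx.
- exact: exp_mu_continuous_disc.
- apply/subspace_continuousP => _ [x Dx <-]; rewrite /from_subspace GK//.
  case: x Dx => q0 w0 Dx; have [i [s0 [qE wE _ ci _]]] := disc_critical r0 gr Dx.
  move: qE wE ci; move: (exp_mu _ _ _) => p0 qE wE ci.
  move=> B nB; rewrite qE wE in nB.
  have mw := critical_grad r0 gr ci.
  have gl_cvg : (pos (strand i) z.2, log_at (strand i) z.1 z.2) @[z --> (p0, s0)]
      --> (pos (strand i) s0, log_at (strand i) p0 s0).
    have c1 : pos (strand i) z.2 @[z --> (p0, s0)] --> pos (strand i) s0.
      have zs : z.2 @[z --> (p0, s0)] --> s0 by exact: cvg_snd.
      exact: (cvg_along _ zs (derive_pos (strand i) s0)).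
    have c2 : log_at (strand i) z.1 z.2 @[z --> (p0, s0)] --> log_at (strand i) p0 s0.
      by apply: cvg_log_at => //; [exact: cvg_fst|exact: cvg_snd].
    exact: (cvg_pair c1 c2).
  have [U [e [nU e0 UB]]] := near_box (A := fun p s => B (pos (strand i) s, log_at (strand i) p s))
    (gl_cvg _ nB).
  have T := critical_tube ir ci e0.
  apply: filterS (filterI nU T) => p [Up Tp] [[q w] Dqw expqw].
  rewrite /= -expqw GK//.
  have [j [t [qE' wE' _ cj _]]] := disc_critical r0 gr Dqw.
  rewrite expqw in wE' cj.
  have [ji [z zE]] := Tp j t cj; subst j.
  rewrite qE' wE' -(log_at_periodic (strand i) p z) -(periodic_int (pos_periodic (strand i)) z).
  exact: UB.
- by split=> [x|_ [x Dx <-]]; [exact: GK|have [] := GP x Dx].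
Qed.

(** If some weighted squared distance from [p] is less than [r^2], then so is the
    minimal one, and the nearest point is critical. *)
Lemma image_open r : 0 < r -> grad_bounds r ->
  open (exp_mu gamma mu @` disc_bundle gamma r).
Proof.
move=> r0 gr; rewrite openE => _ [[q w] Dx <-].
have [i [s [_ _ _ [_ wr] _]]] := disc_critical r0 gr Dx.
move: wr; move: (exp_mu _ _ _) => p0 wr.
have w_cvg1 : wsqdist (strand i) p s @[p --> p0] --> wsqdist (strand i) p0 s.
  by apply: (@cvg_wsqdist _ _ _ _ (nbhs p0) _ id (fun=> s)); [exact: cvg_id|exact: cvg_cst].
apply: filterS (cvgr_lt _ w_cvg1 _ wr) => p ps.
have [c [slc cmin]] := nearest_point (strand i) p.
have cc : critical r p i c by split => //; exact: le_lt_trans (cmin s) ps.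
have [Dc Ec] := critical_disc r0 gr cc.
by exists (pos (strand i) c, log_at (strand i) p c).
Qed.

(** The weighted distance from the image of [(q, w)] to the whole link is [|w|]. *)
Definition minimizing r := forall i s (w : 'rV[R]_n), dotr w (pos1 (strand i) s) = 0 ->
  dotr w w < r ^+ 2 -> forall j t, dotr w w <= wsqdist (strand j) (exp_at (strand i) s w) t.

(** If the image of [(q, w)] had a closer point on the link, so would, by density, the
    image [p] of an element [(q1, w1)] of [U]; the nearest point then gives a second
    preimage [x2] of [p] with a shorter vector.  Elements of [U] near [x2] are
    mapped close to [p], and the continuous inverse sends their images both near [x2]
    and near [(q1, w1)]. *)
Lemma dense_homeo_minimizing r (U : set ('rV[R]_n * 'rV[R]_n)) (U0 : set 'rV[R]_n) :
  0 < r -> grad_bounds r -> (exists2 O, open O & U = O `&` disc_bundle gamma r) ->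
  disc_bundle gamma r `<=` closure U -> homeo_between U U0 (exp_mu gamma mu) ->
  minimizing r.
Proof.
move=> r0 gr [V _ UE] DU [G [UU0 _ _ Gc [GK _]]] i s w wg wr j t.
rewrite leNgt; apply/negP => lt.
have UD : U `<=` disc_bundle gamma r by rewrite UE => x [].
have Dqw : disc_bundle gamma r (pos (strand i) s, w).
  by apply/(disc_bundleP _ _ r0); exists i, s.
have Nqw : normal_bundle gamma (pos (strand i) s, w) := Dqw.1.
have near_nonmin : \forall x \near (pos (strand i) s, w), disc_bundle gamma r x ->
    wsqdist (strand j) (exp_mu gamma mu x) t < dotr x.2 x.2.
  have ec := (subspace_continuousP _ _).1 (@exp_mu_continuous_disc r) _ Dqw.
  have wc : wsqdist (strand j) (exp_mu gamma mu x) t - dotr x.2 x.2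
     @[x --> within (disc_bundle gamma r) (nbhs (pos (strand i) s, w))] -->
     wsqdist (strand j) (exp_at (strand i) s w) t - dotr w w.
    apply: cvgB.
      apply: (@cvg_wsqdist _ _ _ _ _ _ (exp_mu gamma mu) (fun=> t)); last exact: cvg_cst.
      by rewrite -(exp_muE).
    have s2 : x.2 @[x --> within (disc_bundle gamma r) (nbhs (pos (strand i) s, w))] --> w.
      exact: cvg_trans (cvg_app _ (cvg_within _)) (cvg_snd).
    exact: cvg_dotr.
  have lt0 : wsqdist (strand j) (exp_at (strand i) s w) t - dotr w w < 0 by rewrite subr_lt0.
  have H := within_lt wc lt0.
  refine (@filterS _ (nbhs (pos (strand i) s, w)) _ _ _ _ H) => x Hx Dx.
  by have := Hx Dx; rewrite subr_lt0.
have [[q1 w1] [U1 N1]] := DU _ Dqw _ near_nonmin.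
have D1 := UD _ U1; have {}N1 := N1 D1.
have [i1 [s1 [q1E w1E _ c1 ww1]]] := disc_critical r0 gr D1.
set p := exp_mu gamma mu (q1, w1) in N1 w1E c1 ww1.
have [c [slc cmin]] := nearest_point (strand j) p.
have cw : wsqdist (strand j) p c < dotr w1 w1 by exact: le_lt_trans (cmin t) N1.
have cc : critical r p j c.
  by split => //; apply: lt_trans cw _; rewrite -ww1; exact: c1.2.
have [D2 E2] := critical_disc r0 gr cc.
set x2 := (_, _) in D2 E2.
have [_ _ ll] := exp_atK slc (critical_grad r0 gr cc).
(* Separates the two preimages by the length of their vectors. *)
pose M := (dotr w1 w1 + wsqdist (strand j) p c) / 2.
have [M1 M2] : M < dotr w1 w1 /\ wsqdist (strand j) p c < M by rewrite /M; split; lra.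
have Up : U0 p by exact: UU0.
have Gp : G p = (q1, w1) by exact: GK.
have near1 : \forall p' \near p, U0 p' -> M < dotr (G p').2 (G p').2.
  have Gc' := (subspace_continuousP _ _).1 Gc p Up; rewrite /from_subspace Gp in Gc'.
  have G2 : (G p').2 @[p' --> within U0 (nbhs p)] --> w1.
    exact: (cvg_comp _ _ Gc' cvg_snd).
  exact: within_gt (cvg_dotr _ G2 G2) M1.
have near2 : \forall x \near x2, disc_bundle gamma r x ->
    U0 (exp_mu gamma mu x) -> M < dotr (G (exp_mu gamma mu x)).2 (G (exp_mu gamma mu x)).2.
  have ec := (subspace_continuousP _ _).1 (@exp_mu_continuous_disc r) _ D2.
  rewrite /from_subspace E2 in ec.
  exact: ec near1.
have near3 : \forall x \near x2, dotr x.2 x.2 < M.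
  have s2 : x.2 @[x --> x2] --> log_at (strand j) p c by exact: cvg_snd.
  by apply: cvgr_lt _ (cvg_dotr _ s2 s2) _ _; rewrite ll.
have [u [Uu [n2 n3]]] := DU _ D2 _ (filterI near2 near3).
have := n2 (UD _ Uu) (UU0 _ Uu); rewrite GK// => n4.
by move: (lt_trans n3 n4); rewrite ltxx.
Qed.

(** * Focal radius *)

Definition focal_set i := [set Lambda gamma mu i s | s in [set s | 0 < focal_disc gamma mu i s]].
Definition grad_set i := range (fun s => `|derive1 (mu_s gamma mu i) s| ^+ 2).

Lemma focal_setP i y : focal_set i y -> exists s, 0 < focal (strand i) s /\
  y = focal_sqr (strand i) s.
Proof.
move=> [s /=]; rewrite (focal_discE) => f0 <-.
by exists s; split => //; exact: LambdaE.
Qed.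

Lemma mem_focal_set i s : 0 < focal (strand i) s -> focal_set i (focal_sqr (strand i) s).
Proof.
move=> f0; exists s; last exact: LambdaE.
by rewrite /= (focal_discE).
Qed.

Lemma focal_set_le_sup i s : 0 < focal (strand i) s -> focal_sqr (strand i) s <= sup (focal_set i).
Proof.
move=> f0; apply: sup_upper_bound; last exact: mem_focal_set.
split; first by eexists; exact: mem_focal_set f0.
have [M HM] := focal_sqr_bounded (strand i).
by exists M => _ /focal_setP[t [_ ->]]; exact: HM.
Qed.

Lemma grad_le_sup i s : weight1 (strand i) s ^+ 2 <= sup (grad_set i).
Proof.
apply: (@le_trans _ _ (`|weight1 (strand i) s| ^+ 2)).
  by rewrite real_normK ?num_real.
apply: sup_upper_bound; last by exists s.
split; first by exists (`|weight1 (strand i) s| ^+ 2), s.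
have [M HM] := weight1_sqr_bounded (strand i).
by exists M => _ [t _ <-]; exact: HM.
Qed.

Lemma FocRad_bounds i r : 0 < r -> r <= FocRadm_comp gamma mu i ->
  focal_bound (strand i) r /\ grad_bound (strand i) r.
Proof.
rewrite /FocRadm_comp -/(focal_set i) -/(grad_set i); set M := Num.max _ _ => r0 rM.
have M0 : 0 < Num.sqrt M by rewrite -invr_gt0 (lt_le_trans r0).
have {}rM : M * r ^+ 2 <= 1.
  have M1 : 0 < M by rewrite -sqrtr_gt0.
  rewrite -(sqr_sqrtr (ltW M1)) -exprMn expr_le1// ?mulr_ge0 ?(ltW M0) ?(ltW r0)//.
  by rewrite mulrC -ler_pdivlMr// mul1r.
have r20 : 0 <= r ^+ 2 by rewrite sqr_ge0.
split=> [s f0|s]; apply: le_trans rM; apply: ler_wpM2r => //.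
  by rewrite le_max focal_set_le_sup.
by rewrite le_max grad_le_sup orbT.
Qed.

(** A value of [Lambda] greater than [1 / r^2] is refuted by [focal_nonmin].  The
    maximum defining the focal radius is moreover positive, without which its inverse
    square root would be 0 instead of infinity: a component with constant weight has
    a curved point. *)
Lemma minimizing_FocRad i r : 0 < r -> grad_bounds r -> minimizing r ->
  r <= FocRadm_comp gamma mu i.
Proof.
move=> r0 gr mr; rewrite /FocRadm_comp -/(focal_set i) -/(grad_set i).
have r20 : 0 < r ^+ 2 by rewrite exprn_gt0.
have B0 : sup (grad_set i) <= (r ^+ 2)^-1.
  apply: ge_sup; first by exists (`|weight1 (strand i) 0| ^+ 2), 0.
  move=> _ [s _ <-]; rewrite real_normK ?num_real//.
  by rewrite -[leRHS]mul1r ler_pdivlMr//; exact: gr.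
have A0 : sup (focal_set i) <= (r ^+ 2)^-1.
  have [[x fx]|/set0P/negP/negPn/eqP ->] := pselect (focal_set i !=set0); last first.
    by rewrite sup0 invr_ge0 ltW.
  apply: ge_sup; first by exists x.
  move=> _ /focal_setP[s [f0 ->]].
  rewrite -[leRHS]mul1r ler_pdivlMr// leNgt; apply/negP => q1.
  have [nu [nu1 nug kE]] := curvature_normal (strand i) s.
  have [w [wg wr mw ds]] := focal_nonmin r0 (gr i s) f0 q1 nu1 nug kE.
  have [sl ww] := exp_at_critical wg mw.
  have [t] := dslope_nonmin sl ds.
  by rewrite ww ltNge mr.
set M := Num.max _ _.
have Mr : M <= (r ^+ 2)^-1 by rewrite ge_max A0.
have M0 : 0 < M.
  rewrite lt_max; have [[s s0]|H] := pselect (exists s, weight1 (strand i) s <> 0).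
    apply/orP; right; apply: lt_le_trans (grad_le_sup i s).
    by rewrite exprn_even_gt0//=; exact/eqP.
  have [s|s [f0 q0]] := focal_sqr_gt0_ex (C := strand i).
    by apply: contrapT => ?; apply: H; exists s.
  by rewrite (lt_le_trans q0)// focal_set_le_sup.
have S0 : 0 < Num.sqrt M by rewrite sqrtr_gt0.
rewrite -[leLHS]invrK lef_pV2 ?posrE ?invr_gt0//.
rewrite -(@ler_sqr _ (Num.sqrt M)) ?nnegrE ?invr_ge0 ?(ltW r0) ?sqrtr_ge0//.
by rewrite sqr_sqrtr ?(ltW M0)// exprVn.
Qed.

(** * Double critical pairs *)

(** The point of the segment between two points of the link at equal weighted
    distance from both ([wsqdist_meet]). *)
Definition meet_point i s j t : 'rV[R]_n :=
  pos (strand i) s + (weight (strand i) s / (weight (strand i) s + weight (strand j) t)) *: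
     (pos (strand j) t - pos (strand i) s).

(** The value of [Sigma] at a pair of points of the link. *)
Definition ratio2 i s j t : R :=
  dotr (pos (strand i) s - pos (strand j) t) (pos (strand i) s - pos (strand j) t)
  / (weight (strand i) s + weight (strand j) t) ^+ 2.

Lemma weightD_gt0 i s j t : 0 < weight (strand i) s + weight (strand j) t.
Proof. by rewrite addr_gt0 ?weight_gt0. Qed.

Lemma meet_pointC i s j t : meet_point i s j t = meet_point j t i s.
Proof.
rewrite /meet_point; have := weightD_gt0 i s j t.
rewrite (addrC (weight (strand j) t)).
move: (weight (strand i) s) (weight (strand j) t) => a b ab; apply/rowP => k; rewrite !mxE.
by field; exact: lt0r_neq0.
Qed.

Lemma ratio2C i s j t : ratio2 i s j t = ratio2 j t i s.
Proof.
rewrite /ratio2 (addrC (weight (strand j) t)); congr (_ / _).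
by rewrite -[in RHS]opprB dotrNl dotrNr opprK.
Qed.

Lemma meet_pointB i s j t : meet_point i s j t - pos (strand i) s =
  - (weight (strand i) s / (weight (strand i) s +
    weight (strand j) t)) *: (pos (strand i) s - pos (strand j) t).
Proof. by rewrite /meet_point -[pos (strand j) t - _]opprB scalerN scaleNr addrC addKr. Qed.

Lemma wsqdist_meet i s j t : wsqdist (strand i) (meet_point i s j t) s = ratio2 i s j t.
Proof.
have ab := weightD_gt0 i s j t; have a0 := weight_gt0 (strand i) s.
rewrite /wsqdist /sqdist /ratio2 meet_pointB !dotrZl !dotrZr.
move: (dotr (_ - _) (_ - _)) => d; field.
by rewrite !gt_eqF.
Qed.

Lemma slope_meet i s j t : slope (strand i) (meet_point i s j t) s =
  (weight (strand i) s / (weight (strand i) s + weight (strand j) t)) ^+ 2 *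
  (dotr (pos (strand i) s - pos (strand j) t) (pos1 (strand i) s) * (weight (strand i) s +
    weight (strand j) t)
   - dotr (pos (strand i) s - pos (strand j) t) (pos (strand i) s -
     pos (strand j) t) * weight1 (strand i) s).
Proof.
have ab := weightD_gt0 i s j t; have a0 := weight_gt0 (strand i) s.
rewrite /slope /sqdist meet_pointB !dotrZl !dotrZr.
move: (dotr _ (pos1 _ _)) (dotr (_ - _) (_ - _)) => c d; field.
by rewrite !gt_eqF.
Qed.

Lemma partial_Sigma i s j t (x := pos (strand i) s) (y := pos (strand j) t)
    (a := weight (strand i) s) (b := weight (strand j) t) :
  is_derive s 1 (fun u => Sigma mu (gamma i u) (gamma j t))
    (2 * (dotr (x - y) (pos1 (strand i) s) * (a + b) - dotr (x - y) (x - y) * weight1 (strand i) s)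
       / (a + b) ^+ 3).
Proof.
have Dg := derive_pos (strand i); have Dm := derive_weight (strand i).
have ab : (a + b) ^+ 2 != 0 by rewrite expf_neq0// gt_eqF// weightD_gt0.
have -> : (fun u => Sigma mu (gamma i u) (gamma j t)) =
    (fun u => dotr (pos (strand i) u - y) (pos (strand i) u - y) * ((weight (strand i) u +
      b) ^+ 2)^-1).
  by apply/funext => u; rewrite /Sigma enorm_sqr.
have D1 : is_derive s 1 (fun u => dotr (pos (strand i) u - y) (pos (strand i) u - y))
   (2 * dotr (x - y) (pos1 (strand i) s)).
  eapply derive_eq; first by der.
  by cbv beta; rewrite -/x addr0 (dotrC (pos1 _ _)); ring.
have D2 : is_derive s 1 (fun u => (weight (strand i) u + b) ^+ 2) (2 * (a +
  b) * weight1 (strand i) s).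
  eapply derive_eq; first by der.
  by cbv beta; rewrite -/a addr0.
apply: derive_eq (derive_mul D1 (derive_inv (f := fun u => (weight (strand i) u +
  b) ^+ 2) ab D2)) _.
have abp : a + b != 0 by rewrite gt_eqF// weightD_gt0.
cbv beta; rewrite -/x -/a; move: (dotr _ (pos1 _ _)) (dotr (_ - _) (_ - _)) (weight1 _ _) => c d e.
by field.
Qed.

Lemma Sigma_differentiable i j s t :
  differentiable (fun p : R * R => Sigma mu (gamma i p.1) (gamma j p.2)) (s, t).
Proof.
have d1 (f : R -> R) (a : R) : is_derive s 1 f a ->
    differentiable (fun p : R * R => f p.1) (s, t).
  move=> [/derivable1_diffP fd _].
  apply: (@differentiable_comp _ _ _ _ fst f) => //.
  by apply: linear_differentiable => x; exact: cvg_fst.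
have d2 (f : R -> R) (a : R) : is_derive t 1 f a ->
    differentiable (fun p : R * R => f p.2) (s, t).
  move=> [/derivable1_diffP fd _].
  apply: (@differentiable_comp _ _ _ _ snd f) => //.
  by apply: linear_differentiable => x; exact: cvg_snd.
have -> : (fun p : R * R => Sigma mu (gamma i p.1) (gamma j p.2)) =
   (fun p => (\sum_(k < n) (fun p => (pos (strand i) p.1 0 k - pos (strand j) p.2 0 k)
       * (pos (strand i) p.1 0 k - pos (strand j) p.2 0 k))) p *
     (((fun p => weight (strand i) p.1 + weight (strand j) p.2) * (fun p =>
       weight (strand i) p.1 + weight (strand j) p.2)) p)^-1).
  apply/funext => p; rewrite /Sigma enorm_sqr fct_sumE /dotr.
  by congr (_ * _); apply: eq_bigr => k _; rewrite !mxE.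
apply: differentiableM.
  apply: differentiable_sum => k.
  have dk : differentiable (fun p : R * R => pos (strand i) p.1 0 k -
    pos (strand j) p.2 0 k) (s, t).
    apply: differentiableB.
      exact: (d1 (fun u => pos (strand i) u 0 k) _ (derive_coord k (derive_pos (strand i) s))).
    exact: (d2 (fun u => pos (strand j) u 0 k) _ (derive_coord k (derive_pos (strand j) t))).
  exact: differentiableM.
have dm : differentiable (fun p : R * R => weight (strand i) p.1 + weight (strand j) p.2) (s, t).
  apply: differentiableD; first exact: (d1 (weight (strand i)) _ (derive_weight (strand i) s)).
  exact: (d2 (weight (strand j)) _ (derive_weight (strand j) t)).
have m0 : weight (strand i) s + weight (strand j) t != 0 by rewrite gt_eqF// addr_gt0 ?weight_gt0.
have N0 := mulf_neq0 m0 m0.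
by apply: differentiableV => //; exact: differentiableM.
Qed.

(** The partial derivatives of [Sigma] are positive multiples of the slopes at the
    meeting point, so that double critical pairs are pairs of critical points of a
    particular kind. *)
Lemma Sigma_critical i j s t :
  is_diff (s, t) (fun p : R * R => Sigma mu (gamma i p.1) (gamma j p.2)) (fun=> 0 : R)
  <-> slope (strand i) (meet_point i s j t) s = 0 /\ slope (strand j) (meet_point i s j t) t = 0.
Proof.
have p1 := partial_Sigma i s j t.
have p2 := partial_Sigma j t i s.
have SC x y : Sigma mu x y = Sigma mu y x.
  by rewrite /Sigma !enorm_sqr (addrC (mu x)) -(opprB y x) dotrNl dotrNr opprK.
rewrite (_ : (fun u => _) = (fun u => Sigma mu (gamma i s) (gamma j u))) in p2; last first.
  by apply/funext => u; exact: SC.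
rewrite (is_diff0P (Sigma_differentiable i j s t) p1 p2).
have ab := weightD_gt0 i s j t.
have ab' := weightD_gt0 j t i s.
rewrite {2}meet_pointC !slope_meet.
have E (a b c : R) : 0 < a -> 0 < b ->
    2 * c / (a + b) ^+ 3 = 0 <-> (a / (a + b)) ^+ 2 * c = 0.
  move=> a0 b0; have abp : a + b != 0 by rewrite gt_eqF// addr_gt0.
  split=> /eqP; rewrite !mulf_eq0 ?expf_eq0 ?invr_eq0 ?mulf_eq0 ?expf_eq0 ?invr_eq0
    ?(gt_eqF a0) ?(negPf abp) ?pnatr_eq0/= ?orbF => /eqP ->.
    by rewrite mulr0.
  by rewrite mulr0 mul0r.
by rewrite !E ?weight_gt0.
Qed.

Lemma ratio_sqr i s j t :
  (enorm (pos (strand i) s - pos (strand j) t) / (mu (pos (strand i) s) +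
    mu (pos (strand j) t))) ^+ 2
  = ratio2 i s j t.
Proof. by rewrite exprMn enorm_sqr exprVn. Qed.

Lemma half_DCSD_critical r i s j t : 0 < r -> (r%:E <= half_DCSD gamma mu)%E ->
  pos (strand i) s <> pos (strand j) t ->
  slope (strand i) (meet_point i s j t) s = 0 -> slope (strand j) (meet_point i s j t) t = 0 ->
  r ^+ 2 <= ratio2 i s j t.
Proof.
move=> r0 rD st s1 s2; rewrite -ratio_sqr.
have d0 : 0 < mu (pos (strand i) s) + mu (pos (strand j) t) by exact: (weightD_gt0 i s j t).
rewrite ler_sqr ?nnegrE ?(ltW r0) ?divr_ge0 ?enorm_ge0 ?(ltW d0)//.
rewrite -lee_fin; apply: (le_trans rD); rewrite /half_DCSD; apply: ereal_inf_lbound.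
exists (pos (strand i) s), (pos (strand j) t); split => //; split => //.
by exists i, j, s, t; split => //; apply/Sigma_critical.
Qed.

(** Otherwise the meeting point of a double critical pair is in the image of the disc
    bundle with room to spare, and [double_critical_nonmin] applies. *)
Lemma minimizing_half_DCSD r : 0 < r -> grad_bounds r -> minimizing r ->
  (r%:E <= half_DCSD gamma mu)%E.
Proof.
move=> r0 gr mr; apply: le_ereal_inf_tmp => _ [q1 [q2 [[q12 [i [j [s [t [E1 E2 dc]]]]]] ->]]].
have {}E1 : q1 = pos (strand i) s by [].
have {}E2 : q2 = pos (strand j) t by [].
subst q1 q2; rewrite lee_fin.
have d0 : 0 < mu (pos (strand i) s) + mu (pos (strand j) t) by exact: (weightD_gt0 i s j t).
rewrite -ler_sqr ?nnegrE ?(ltW r0) ?divr_ge0 ?enorm_ge0 ?(ltW d0)// ratio_sqr.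
rewrite leNgt; apply/negP => rr.
have [s1 s2] := (Sigma_critical i j s t).1 dc.
have c1 : critical r (meet_point i s j t) i s.
  by split => //; rewrite wsqdist_meet.
have [eE lg ll] := exp_atK s1 (critical_grad r0 gr c1).
have mw := critical_grad r0 gr c1; rewrite wsqdist_meet in ll mw.
have r20 : 0 < ratio2 i s j t.
  rewrite divr_gt0 ?exprn_gt0 ?weightD_gt0//; apply: dotr_gt0.
  by rewrite subr_eq0; exact/eqP.
rewrite -ll in mw; have lpos := r20; rewrite -ll in lpos.
have e1 : 1 < r ^+ 2 / ratio2 i s j t by rewrite ltr_pdivlMr// mul1r.
have [|x [x1 xe mx lt]] := double_critical_nonmin (D := strand j) (t := t) lg lpos mw _ e1.
  have ab := weightD_gt0 i s j t.
  rewrite eE meet_pointB; apply/rowP => k; rewrite !mxE; field.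
  by rewrite gt_eqF.
have xg : dotr (x *: log_at (strand i) (meet_point i s j t) s) (pos1 (strand i) s) = 0.
  by rewrite dotrZl lg mulr0.
have xr : dotr (x *: log_at (strand i) (meet_point i s j t) s)
    (x *: log_at (strand i) (meet_point i s j t) s) < r ^+ 2.
  by rewrite dotrZl dotrZr ll mulrA -expr2 -ltr_pdivlMr.
by move: lt; rewrite ltNge (mr i s _ xg xr j t).
Qed.

(** * Injectivity below the upper radius *)

(** Stewart's theorem for the triangle formed by [p] and the two points of the
    link. *)
Lemma meet_identity i s j t p (M : R) :
  wsqdist (strand i) p s <= M -> wsqdist (strand j) p t <= M ->
  dotr (p - meet_point i s j t) (p - meet_point i s j t) <=
  weight (strand i) s * weight (strand j) t * (M - ratio2 i s j t).
Proof.
have ab := weightD_gt0 i s j t.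
have a0 := weight_gt0 (strand i) s; have b0 := weight_gt0 (strand j) t.
rewrite /wsqdist !ler_pdivrMr ?exprn_gt0// /sqdist /ratio2 /meet_point.
move: (weight (strand i) s) (weight (strand j) t) (pos (strand i) s) (pos (strand j) t) ab a0 b0.
move=> a b x y ab a0 b0.
have -> : x - y = (p - y) - (p - x) by apply/rowP => k; rewrite !mxE; ring.
have -> : p - (x + (a / (a + b)) *: (y - x)) =
    (b / (a + b)) *: (p - x) + (a / (a + b)) *: (p - y).
  by apply/rowP => k; rewrite !mxE; field; exact: lt0r_neq0.
move: (p - x) (p - y) => u v; rewrite !dotrE (dotrC v u).
move: (dotr u u) (dotr v v) (dotr u v) => P Q c PM QM.
rewrite -subr_ge0.
rewrite [leRHS](_ : _ = (b * (M * a ^+ 2 - P) + a * (M * b ^+ 2 - Q)) / (a + b)); last first.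
  by field; exact: lt0r_neq0.
by rewrite divr_ge0 ?(ltW ab)// addr_ge0// mulr_ge0 ?(ltW a0) ?(ltW b0)// subr_ge0.
Qed.

(** The hypotheses say that [r1] exceeds neither the focal radius, nor any collapsing
    radius, nor half of the double critical self distance. *)
Section Below.
Variables (r1 : R).
Hypothesis focal_r1 : forall i, focal_bound (strand i) r1.
Hypothesis no_collapse_r1 : forall i, no_collapse (strand i) r1.
Hypothesis double_critical_r1 : forall i s j t, pos (strand i) s <> pos (strand j) t ->
  slope (strand i) (meet_point i s j t) s = 0 ->
  slope (strand j) (meet_point i s j t) t = 0 -> r1 ^+ 2 <= ratio2 i s j t.

Section Pair.
Variables (i j : 'I_m) (rho : R).
Hypothesis rho_lt : rho ^+ 2 < r1 ^+ 2.

(** A point is encoded by its difference from the first foot: over the compact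
    parameter intervals this difference is bounded. *)
Let P (z : (R * R) * 'rV[R]_n) := pos (strand i) z.1.1 + z.2.

Definition double_points : set ((R * R) * 'rV[R]_n) := [set z |
  [/\ 0 <= z.1.1 <= period (strand i), 0 <= z.1.2 <= period (strand j),
      slope (strand i) (P z) z.1.1 = 0, slope (strand j) (P z) z.1.2 = 0 &
      [/\ wsqdist (strand i) (P z) z.1.1 <= rho ^+ 2,
          wsqdist (strand j) (P z) z.1.2 <= rho ^+ 2 &
          pos (strand i) z.1.1 <> pos (strand j) z.1.2]]].

Lemma double_points_bounded : exists c : R, double_points `<=`
  (`[0, period (strand i)] `*` `[0, period (strand j)]) `*` [set v | dotr v v <= c].
Proof.
have [M HM] : exists M, forall s, weight (strand i) s ^+ 2 <= M.
  apply: (@periodic_bounded _ _ (strand i)) => [s|s]; first by rewrite (weight_periodic (strand i)).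
  have w0 : weight (strand i) t @[t --> s] --> weight (strand i) s by exact: derive_cont
    (derive_weight (strand i) s).
  by apply: cvgM.
exists (rho ^+ 2 * M) => -[[s t] v] [z1 z2 _ _ [z5 _ _]].
split; first by split; rewrite /= in_itv.
have e : P ((s, t), v) - pos (strand i) s = v by rewrite /P [X in X +
  _ - _]/(pos (strand i) s) addrC addKr.
have : wsqdist (strand i) (P ((s, t), v)) s <= rho ^+ 2 by exact: z5.
rewrite /wsqdist ler_pdivrMr ?exprn_gt0 ?weight_gt0// /sqdist e.
move=> vc; apply: (le_trans vc).
by rewrite ler_wpM2l ?sqr_ge0.
Qed.

Let z1_cvg (z : (R * R) * 'rV[R]_n) : y.1.1 @[y --> z] --> z.1.1.
Proof.
have h1 : y.1 @[y --> z] --> z.1 by exact: cvg_fst.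
have h2 : x.1 @[x --> z.1] --> z.1.1 by exact: cvg_fst.
by move=> A nA; exact: h1 (h2 _ nA).
Qed.

Let z2_cvg (z : (R * R) * 'rV[R]_n) : y.1.2 @[y --> z] --> z.1.2.
Proof.
have h1 : y.1 @[y --> z] --> z.1 by exact: cvg_fst.
have h2 : x.2 @[x --> z.1] --> z.1.2 by exact: cvg_snd.
by move=> A nA; exact: h1 (h2 _ nA).
Qed.

Let P_cvg (z : (R * R) * 'rV[R]_n) : P y @[y --> z] --> P z.
Proof.
have c1 : pos (strand i) y.1.1 @[y --> z] --> pos (strand i) z.1.1.
  exact: (cvg_along _ (@z1_cvg z) (derive_pos (strand i) z.1.1)).
have c2 : y.2 @[y --> z] --> z.2 by exact: cvg_snd.
exact: (cvgD c1 c2).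
Qed.

(** The only condition which is not closed is that the two feet are distinct; it is
    preserved in the limit because, by [slope_trapping], a point near the limit has at
    most one critical point near the limit foot. *)
Lemma double_points_compact : compact double_points.
Proof.
have [c Bc] := double_points_bounded.
apply: subclosed_compact Bc; last first.
  by apply: compact_setX; [apply: compact_setX; exact: segment_compact|exact: compact_dotr_le].
move=> z zT.
have le_cl (f : (R * R) * 'rV[R]_n -> R) k : f y @[y --> z] --> f z ->
   (forall y, double_points y -> f y <= k) -> f z <= k := closure_le zT.
have s1 : slope (strand i) (P y) y.1.1 @[y --> z] --> slope (strand i) (P z) z.1.1.
  by apply: cvg_slope; [exact: P_cvg|exact: z1_cvg].
have s2 : slope (strand j) (P y) y.1.2 @[y --> z] --> slope (strand j) (P z) z.1.2.
  by apply: cvg_slope; [exact: P_cvg|exact: z2_cvg].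
have sl1 : slope (strand i) (P z) z.1.1 = 0.
  apply/eqP; rewrite -sqrf_eq0 eq_le sqr_ge0 andbT.
  apply: (le_cl (fun y => slope (strand i) (P y) y.1.1 ^+ 2)); first exact: cvgM.
  by move=> y [_ _ ->]; rewrite expr0n.
have sl2 : slope (strand j) (P z) z.1.2 = 0.
  apply/eqP; rewrite -sqrf_eq0 eq_le sqr_ge0 andbT.
  apply: (le_cl (fun y => slope (strand j) (P y) y.1.2 ^+ 2)); first exact: cvgM.
  by move=> y [_ _ _ ->]; rewrite expr0n.
have w1 : wsqdist (strand i) (P z) z.1.1 <= rho ^+ 2.
  apply: (le_cl (fun y => wsqdist (strand i) (P y) y.1.1)).
    by apply: cvg_wsqdist; [exact: P_cvg|exact: z1_cvg].
  by move=> y [_ _ _ _ []].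
have w2 : wsqdist (strand j) (P z) z.1.2 <= rho ^+ 2.
  apply: (le_cl (fun y => wsqdist (strand j) (P y) y.1.2)).
    by apply: cvg_wsqdist; [exact: P_cvg|exact: z2_cvg].
  by move=> y [_ _ _ _ []].
split=> //.
- apply/andP; split; last first.
    by apply: (le_cl (fun y => y.1.1)) => [|y [/andP[]]]; first exact: z1_cvg.
  rewrite -oppr_le0; apply: (le_cl (fun y => - y.1.1)).
    by apply: cvgN; exact: z1_cvg.
  by move=> y [/andP[+ _]] _ _ _; rewrite oppr_le0.
- apply/andP; split; last first.
    by apply: (le_cl (fun y => y.1.2)) => [|y [_ /andP[]]]; first exact: z2_cvg.
  rewrite -oppr_le0; apply: (le_cl (fun y => - y.1.2)).
    by apply: cvgN; exact: z2_cvg.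
  by move=> y [_ /andP[+ _]] _ _ _; rewrite oppr_le0.
split => // e; have [ij [k kE]] := strand_inj e.
have wr : wsqdist (strand i) (P z) z.1.1 < r1 ^+ 2 by exact: le_lt_trans rho_lt.
have [U [e0 [nU e_gt0 H]]] := slope_trapping (@focal_r1 i) (@no_collapse_r1 i) sl1 wr.
have N1 : \forall y \near z, U (P y) by exact: P_cvg nU.
have N2 : \forall y \near z, z.1.1 - e0 < y.1.1 by apply: cvgr_gt _ (@z1_cvg z) _ _; lra.
have N3 : \forall y \near z, y.1.1 < z.1.1 + e0 by apply: cvgr_lt _ (@z1_cvg z) _ _; lra.
have N4 : \forall y \near z, z.1.2 - e0 < y.1.2 by apply: cvgr_gt _ (@z2_cvg z) _ _; lra.
have N5 : \forall y \near z, y.1.2 < z.1.2 + e0 by apply: cvgr_lt _ (@z2_cvg z) _ _; lra.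
have [y [[_ _ y1 y2 [_ _ y3]] [[[[n1 n2] n3] n4] n5]]] :=
  zT _ (filterI (filterI (filterI (filterI N1 N2) N3) N4) N5).
apply: y3.
have y2' : slope (strand i) (P y) (y.1.2 + k%:~R * period (strand i)) = 0.
  by rewrite slope_periodic; rewrite -ij in y2.
have -> : pos (strand j) y.1.2 = pos (strand i) (y.1.2 + k%:~R * period (strand i)).
  by rewrite (periodic_int (pos_periodic (strand i))) ij.
congr pos; have [lt|lt|//] := ltgtP y.1.1 (y.1.2 + k%:~R * period (strand i)).
  suff : 0 < slope (strand i) (P y) (y.1.2 + k%:~R * period (strand i)) by rewrite y2' ltxx.
  by apply: (H _ n1 y.1.1) => //; rewrite ?y1//; move: kE n5; lra.
suff : 0 < slope (strand i) (P y) y.1.1 by rewrite y1 ltxx.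
by apply: (H _ n1 (y.1.2 + k%:~R * period (strand i))) => //; rewrite ?y2'//; move: kE n4; lra.
Qed.

Let f z := Num.max (wsqdist (strand i) (P z) z.1.1) (wsqdist (strand j) (P z) z.1.2).

Lemma double_points_reduce p s t : slope (strand i) p s = 0 -> slope (strand j) p t = 0 ->
  wsqdist (strand i) p s <= rho ^+ 2 -> wsqdist (strand j) p t <= rho ^+ 2 ->
  pos (strand i) s <> pos (strand j) t ->
  exists2 z, double_points z &
    f z = Num.max (wsqdist (strand i) p s) (wsqdist (strand j) p t).
Proof.
move=> s1 t1 ws wt' st.
have [k /andP[k1 k2]] := reduce_period (strand i) 0 s.
have [l /andP[l1 l2]] := reduce_period (strand j) 0 t.
pose z := ((s + k%:~R * period (strand i), t + l%:~R * period (strand j)),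
   p - pos (strand i) (s + k%:~R * period (strand i))).
have Pz : P z = p by rewrite /P /= addrC subrK.
exists z; last first.
  by rewrite /f Pz [z.1.1]/(s + _) [z.1.2]/(t + _) !wsqdist_periodic.
rewrite add0r in k2; rewrite add0r in l2; split.
- by apply/andP; split; [exact: k1|exact: ltW k2].
- by apply/andP; split; [exact: l1|exact: ltW l2].
- by rewrite Pz [z.1.1]/(s + k%:~R * period (strand i)) slope_periodic.
- by rewrite Pz [z.1.2]/(t + l%:~R * period (strand j)) slope_periodic.
rewrite Pz [z.1.1]/(s + k%:~R * period (strand i)) [z.1.2]/(t + l%:~R * period (strand j)).
rewrite !wsqdist_periodic; split => //.
by rewrite (periodic_int (pos_periodic (strand i))) (periodic_int (pos_periodic (strand j))).
Qed.

(** The meeting point of the two feet has both weighted squared distances equal to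
    [ratio2], which [meet_identity] bounds by the larger of the two values, strictly
    unless [p] is the meeting point of a double critical pair.  As squared distance is
    convex, moving [p] slightly towards the meeting point brings both values below the
    larger one, and the two critical points persist as distinct minima. *)
Lemma double_points_descent z : double_points z -> exists2 y, double_points y & f y < f z.
Proof.
move=> [_ _ s1 s2 [w1 w2 st]]; move: s1 s2 w1 w2 st; rewrite /f.
move: (P z) z.1.1 z.1.2 => p s t s1 t1 ws wt' st.
set M := Num.max _ _.
have Ma : wsqdist (strand i) p s <= M by rewrite le_max lexx.
have Mb : wsqdist (strand j) p t <= M by rewrite le_max lexx orbT.
have Mr : M <= rho ^+ 2 by rewrite ge_max ws.
have id := meet_identity Ma Mb.
have ab0 : 0 < weight (strand i) s * weight (strand j) t by rewrite mulr_gt0 ?weight_gt0.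
have rM : ratio2 i s j t <= M.
  by rewrite -subr_ge0 -(pmulr_rge0 _ ab0) (le_trans _ id)// dotr_ge0.
have {}rM : ratio2 i s j t < M.
  rewrite lt_neqAle rM andbT; apply/eqP => rE.
  rewrite rE subrr mulr0 in id.
  have pE : p = meet_point i s j t.
    apply/eqP; rewrite -subr_eq0; apply/eqP/dotr_eq0/eqP.
    by rewrite eq_le id dotr_ge0.
  have := double_critical_r1 st; rewrite -pE rE => /(_ s1 t1); apply/negP; rewrite -ltNge.
  exact: le_lt_trans Mr rho_lt.
have trap_i := slope_trapping (@focal_r1 i) (@no_collapse_r1 i) s1 (le_lt_trans ws rho_lt).
have trap_j := slope_trapping (@focal_r1 j) (@no_collapse_r1 j) t1 (le_lt_trans wt' rho_lt).
(* Windows around the feet in which the persisting minima remain distinct. *)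
have [d d0 Hd] : exists2 d, 0 < d & forall x y, s - d < x < s + d -> t - d < y < t + d ->
    pos (strand i) x <> pos (strand j) y.
  have cv : dotr (pos (strand i) y.1 - pos (strand j) y.2) (pos (strand i) y.1 - pos (strand j) y.2)
      @[y --> (s, t)] --> dotr (pos (strand i) s - pos (strand j) t) (pos (strand i) s -
        pos (strand j) t).
    have f1 : y.1 @[y --> (s, t)] --> s by exact: cvg_fst.
    have f2 : y.2 @[y --> (s, t)] --> t by exact: cvg_snd.
    have c1 := cvg_along _ f1 (derive_pos (strand i) s).
    have c2 := cvg_along _ f2 (derive_pos (strand j) t).
    by apply: cvg_dotr; apply: cvgB; [exact: c1|exact: c2|exact: c1|exact: c2].
  have lt0 : 0 < dotr (pos (strand i) s - pos (strand j) t) (pos (strand i) s - pos (strand j) t).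
    by apply: dotr_gt0; rewrite subr_eq0; exact/eqP.
  have [[A B] [nA nB] AB] := cvgr_gt _ cv _ lt0.
  have /nbhs_ballP[a a0 aA] : nbhs s A by exact: nA.
  have /nbhs_ballP[b b0 bB] : nbhs t B by exact: nB.
  exists (Num.min a b); first by rewrite lt_min a0 b0.
  move=> x y /andP[x1 x2] /andP[y1 y2] e.
  have h1 : Num.min a b <= a by rewrite ge_min lexx.
  have h2 : Num.min a b <= b by rewrite ge_min lexx orbT.
  suff : 0 < dotr (pos (strand i) x - pos (strand j) y) (pos (strand i) x - pos (strand j) y).
    by rewrite e subrr dotr0l ltxx.
  apply: (AB (x, y)); split; [apply: aA|apply: bB]; rewrite /ball/= ltr_distlC; apply/andP;
    split; lra.
have Ti := strict_min_persists s1 trap_i d0; have Tj := strict_min_persists t1 trap_j d0.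
pose q := meet_point i s j t.
(* The path towards the meeting point q. *)
pose pe (e : R) := (1 - e) *: p + e *: q.
have pe_cvg : pe e @[e --> (0 : R)^'+] --> p.
  have id0 : e @[e --> (0 : R)^'+] --> (0 : R) by exact: cvg_at_right_filter cvg_id.
  suff : pe e @[e --> (0 : R)^'+] --> (1 - 0) *: p + (0 : R) *: q.
    by rewrite subr0 scale1r scale0r addr0.
  apply: cvgD; last by apply: cvgZr_tmp.
  by apply: cvgZr_tmp; apply: cvgB => //; exact: cvg_cst.
have [e [e0 e1 [x [xs xsl xw]] [y [yt ysl yw]]]] : exists e : R, [/\ 0 < e, e < 1,
    exists x, [/\ s - d < x < s + d, slope (strand i) (pe e) x = 0 &
      wsqdist (strand i) (pe e) x <= wsqdist (strand i) (pe e) s] &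
    exists x, [/\ t - d < x < t + d, slope (strand j) (pe e) x = 0 &
      wsqdist (strand j) (pe e) x <= wsqdist (strand j) (pe e) t]].
  apply: (@filter_ex _ (0 : R)^'+); near=> e; split.
  - by near: e; exact: nbhs_right_gt.
  - by near: e; apply: nbhs_right_lt.
  - by near: e; exact: (pe_cvg _ Ti).
  - by near: e; exact: (pe_cvg _ Tj).
have e01 : 0 <= e <= 1 by rewrite !ltW.
have conv (C : weighted_curve R n) u : wsqdist C p u <= M -> wsqdist C q u < M ->
    wsqdist C (pe e) u < M.
  move=> pu qu; have m2 : 0 < weight C u ^+ 2 by rewrite exprn_gt0 ?weight_gt0.
  apply: (@le_lt_trans _ _ ((1 - e) * wsqdist C p u + e * wsqdist C q u)).
    rewrite /wsqdist [leRHS](_ : _ = ((1 - e) * sqdist C p u +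
      e * sqdist C q u) / weight C u ^+ 2); last by field; rewrite gt_eqF ?weight_gt0.
    rewrite ler_pM2r ?invr_gt0// /sqdist.
    rewrite (_ : pe e - _ = (1 - e) *: (p - pos C u) + e *: (q - pos C u)).
      exact: dotr_convex.
    by apply/rowP => k; rewrite !mxE; ring.
  have h1 : (1 - e) * wsqdist C p u <= (1 - e) * M by rewrite ler_wpM2l// subr_ge0 ltW.
  have h2 : e * wsqdist C q u < e * M by rewrite ltr_pM2l.
  by lra.
have wi : wsqdist (strand i) (pe e) s < M by apply: conv => //; rewrite wsqdist_meet.
have wj : wsqdist (strand j) (pe e) t < M.
  by apply: conv => //; rewrite /q meet_pointC wsqdist_meet ratio2C.
have xM := le_lt_trans xw wi; have yM := le_lt_trans yw wj.
have [z' zp zE] := double_points_reduce xsl ysl (ltW (lt_le_trans xM Mr)) (ltW (lt_le_trans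
  yM Mr)) (Hd x y xs yt).
by exists z' => //; rewrite -/(f z') zE gt_max xM.
Unshelve. all: by end_near. Qed.

Lemma double_points_empty : double_points = set0.
Proof.
have [->//|/set0P pN] := eqVneq double_points set0.
exfalso; have [|z zT zmin] := compact_EVT_min pN double_points_compact (f := f).
  apply: continuous_subspaceT => z.
  apply: (@continuous_max R _ (fun z => wsqdist (strand i) (P z) z.1.1)
     (fun z => wsqdist (strand j) (P z) z.1.2) z).
    by apply: cvg_wsqdist; [exact: P_cvg|exact: z1_cvg].
  by apply: cvg_wsqdist; [exact: P_cvg|exact: z2_cvg].
rewrite inE in zT; have [y yT] := double_points_descent zT.
by rewrite ltNge zmin// inE.
Qed.

End Pair.

Lemma injective_below rho : 0 < rho -> rho < r1 -> injective_radius rho.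
Proof.
move=> rho0 rr p i s j t [s1 ws] [t1 wt'].
have rho_lt : rho ^+ 2 < r1 ^+ 2.
  by rewrite ltr_sqr ?nnegrE ?(ltW rho0)// (ltW (lt_trans rho0 rr)).
apply: contrapT => st.
have [z zp _] := double_points_reduce s1 t1 (ltW ws) (ltW wt') st.
by move: zp; rewrite double_points_empty.
Qed.

End Below.

(** * Collapsing radii and the injectivity radii *)

Lemma collapse_compatible i k r a b : collapse_on (strand i) k r a b ->
  compatible_arc gamma mu r.
Proof.
move=> co; have [k0 r0 ab _] := co.
have [a0 [c [e1 [e2 [e11 e22 e12 H]]]]] := collapse_circle co.
exists k, a0, (a + (b - a) / 3), (b - (b - a) / 3), c, e1, e2.
split => //; first by lra.
move=> s /andP[s1 s2]; have sab : a < s < b by apply/andP; split; lra.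
have [gE mE] := H s sab; rewrite -gE; split; first by exists i, s.
by rewrite -mE.
Qed.

(** The arc is given as a subset of the link; [chart] and [arc_param] turn it into an
    interval of the arclength of one component. *)
Lemma compatible_collapse r : 0 < r -> compatible_arc gamma mu r ->
  exists i k a b, collapse_on (strand i) k r a b.
Proof.
move=> r0 [k [a0 [s0 [s1 [c [e1 [e2 [k0 s01 [e11 e22 e12] H]]]]]]]].
have {}H s : s0 <= s <= s1 -> carrier gamma (circle k c e1 e2 s) /\
    mu (circle k c e1 e2 s) = 2 / (k * r) * cos (k * s / 2 + a0) := H s.
pose t0 := (s0 + s1) / 2.
have t01 : s0 <= t0 <= s1 by apply/andP; rewrite /t0; split; lra.
have [[i [x xE]] _] := H t0 t01.
have {}xE : circle k c e1 e2 t0 = pos (strand i) x by exact: xE.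
have [S [Sc SK]] := chart i x.
pose th s := S (circle k c e1 e2 s).
have K0 : \forall s \near t0, carrier gamma (circle k c e1 e2 s).
  have t01' : t0 \in `]s0, s1[%R by rewrite in_itv/= /t0; apply/andP; split; lra.
  apply: filterS (near_in_itvoo t01') => s; rewrite /= in_itv/= => /andP[h1 h2].
  by apply: (H s _).1; rewrite !ltW.
have arcc : circle k c e1 e2 s @[s --> t0] --> pos (strand i) x.
  by rewrite -xE; exact: derive_cont (derive_circle c e1 e2 k0 t0).
have arcw (A : set 'rV[R]_n) : within (carrier gamma) (nbhs (pos (strand i) x)) A ->
    \forall s \near t0, A (circle k c e1 e2 s).
  move=> wA; have A1 : \forall s \near t0, carrier gamma (circle k c e1 e2 s) ->
      A (circle k c e1 e2 s) by exact: arcc _ wA.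
  by apply: filterS (filterI A1 K0) => s [h1 h2]; exact: h1.
have thc : th s @[s --> t0] --> x by move=> A nA; exact: arcw (Sc _ nA).
have thx : th t0 = x.
  apply/eqP/negPn/negP => ne.
  have d0 : 0 < `|th t0 - x| by rewrite normr_gt0 subr_eq0.
  have /cvgrPdist_lt/(_ _ d0) N := thc.
  by have := nbhs_singleton N; rewrite distrC ltxx.
have [e e0 He] := near_itvP (arcw _ SK).
pose e' := Num.min e ((s1 - s0) / 2).
have e'0 : 0 < e' by rewrite lt_min e0 divr_gt0// subr_gt0.
have h1 : e' <= e by rewrite ge_min lexx.
have h2 : e' <= (s1 - s0) / 2 by rewrite ge_min lexx orbT.
have [||d [s0' [a [b [d2 ab Hd]]]]] := arc_param (C := strand i) (c := c) (th := th) (t0 :=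
  t0) k0 e11 e22 e12 e'0.
- by rewrite thx.
- by move=> s /andP[sa sb]; apply: He; apply/andP; split; lra.
exists i, k, a, b; apply: (@arc_collapse _ _ (strand i) k r a0 c e1 e2 a b d s0') => // y yab.
have [gE /andP[y1 y2]] := Hd y yab; split => //.
have -> : weight (strand i) y = mu (pos (strand i) y) by [].
rewrite gE; apply: (H _ _).2.
by rewrite /t0 in y1 y2; apply/andP; split; lra.
Qed.

(** All the points of the arc are critical for the point of [collapse_center]. *)
Lemma collapse_not_injective i k r a b r' : collapse_on (strand i) k r a b ->
  r < r' -> injective_radius r' -> False.
Proof.
move=> co rr' ir; have [k0 r0 ab _] := co; have [p Hp] := collapse_center co.
have cr s : a < s < b -> critical r' p i s.
  move=> /Hp[sl wE]; split; first exact: sl.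
  by rewrite wE ltr_sqr ?nnegrE ?(ltW r0) ?(ltW (lt_trans r0 rr')).
pose c := (a + b) / 2; have cab : a < c < b by rewrite /c; apply/andP; split; lra.
have gc s : a < s < b -> pos (strand i) s = pos (strand i) c.
  by move=> sab; apply: (ir p); exact: cr.
have g0 := eq_on_derive gc cab (derive_pos (strand i) c) (derive_vconst (pos (strand i) c) c).
by have := unit_speed (strand i) c; rewrite g0 dotr0l; lra.
Qed.

Lemma collapse_interior i k r a b : collapse_on (strand i) k r a b ->
  (r%:E < UR gamma mu)%E -> (collapsing_set gamma mu i)^° !=set0.
Proof.
move=> [k0 r0 ab H] rU; pose c := (a + b) / 2; exists c.
have cab : c \in `]a, b[%R by rewrite in_itv/= /c; apply/andP; split; lra.
have kapE x : a < x < b -> curvature gamma i x = k.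
  move=> /H[kE _ _ _]; apply/eqP; rewrite -(@eqrXn2 _ 2)// ?enorm_ge0 ?(ltW k0)//.
  by rewrite (curv2E) kE.
apply: filterS (near_in_itvoo cab) => s; rewrite /= in_itv/= => sab.
have [kE gE mE qE] := H s sab; split.
- rewrite (focal_discE) /focal -/(curv2 (strand i) s) kE mE.
  by field.
- rewrite kapE//; split => //; rewrite derive1E.
  have : is_derive s 1 (curvature gamma i) 0.
    have sab' : s \in `]a, b[%R by rewrite in_itv.
    apply: near_eq_is_derive (derive_const k s).
    by apply: filterS (near_in_itvoo sab') => y; rewrite /= in_itv/= => /kapE.
  by case.
- rewrite (curv2E) kE.
  have -> : derive1n 3 (gamma i) s = - k ^+ 2 *: pos1 (strand i) s by exact: gE.
  by rewrite scaleNr; exact: addNr.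
exists r; split => //.
transitivity (weight1 (strand i) s ^+ 2 - weight (strand i) s * weight2 (strand i) s) => //.
by rewrite mE div1r -qE /collapse_sqr kE; field.
Qed.

(** The conditions defining the collapsing set are pointwise; on an interval they
    force the curvature, and then the radius [r], to be constant. *)
Lemma interior_collapse i : (collapsing_set gamma mu i)^° !=set0 ->
  exists k r a b, (r%:E < UR gamma mu)%E /\ collapse_on (strand i) k r a b.
Proof.
move=> [s0 /near_itvP[e e0 H]].
pose a := s0 - e; pose b := s0 + e; have ab : a < b by rewrite /a /b; lra.
have s0ab : a < s0 < b by rewrite /a /b; apply/andP; split; lra.
have g3E s : a < s < b -> pos3 (strand i) s = - curv2 (strand i) s *: pos1 (strand i) s.
  move=> /H[_ _ + _]; rewrite (curv2E) scaleNr.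
  by move=> E; apply/eqP; rewrite -addr_eq0; apply/eqP; exact: E.
have m2E s : a < s < b -> weight2 (strand i) s = - (curv2 (strand i) s / 4) * weight (strand i) s.
  move=> /H[+ _ _ _]; rewrite (focal_discE) /focal -/(curv2 _ _).
  by move: (weight2 _ _) (curv2 _ _) (weight _ _) => *; lra.
have KE : forall s t, a < s < b -> a < t < b -> curv2 (strand i) s = curv2 (strand i) t.
  apply: derive0_cst => s sab; have D := derive_pos2 (strand i).
  rewrite /curv2; eapply derive_eq; first by der.
  by cbv beta; rewrite g3E// !dotrZl !dotrZr (dotrC (pos2 _ _)) dotr_g12; ring.
pose K := curv2 (strand i) s0.
have K0 : 0 < K.
  have [_ [_ k0] _ _] := H s0 s0ab.
  by rewrite /K -(curv2E) exprn_gt0.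
have QE : forall s t, a < s < b -> a < t < b ->
    weight1 (strand i) s ^+ 2 + K / 4 * weight (strand i) s ^+ 2 = weight1 (strand i) t ^+
      2 + K / 4 * weight (strand i) t ^+ 2.
  apply: derive0_cst => s sab; have D := derive_weight (strand i);
    have D1 := derive_weight1 (strand i).
  eapply derive_eq; first by der.
  by cbv beta; rewrite m2E// (KE s s0)//; rewrite -/K; field.
have [_ _ _ [r [r0 rU rE]]] := H s0 s0ab.
exists (Num.sqrt K), r, a, b; split => //; split => //; first by rewrite sqrtr_gt0.
have KS : Num.sqrt K ^+ 2 = K by rewrite sqr_sqrtr// ltW.
have {}rE : weight1 (strand i) s0 ^+ 2 - weight (strand i) s0 * weight2 (strand i) s0 = (r ^+ 2)^-1.
  by rewrite -div1r; exact: rE.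
move=> s sab; have kE : curv2 (strand i) s = K by exact: KE.
rewrite KS; split; [exact: kE|by rewrite (g3E s sab) kE|by rewrite (m2E s sab) kE|].
rewrite /collapse_sqr kE -rE (m2E s0 s0ab) -/K.
transitivity (weight1 (strand i) s ^+ 2 + K / 4 * weight (strand i) s ^+ 2); first by field.
by rewrite (QE s s0 sab s0ab); field.
Qed.

Lemma collapsing_interior : collapsing_radii gamma mu = set0 <->
  (forall i, (collapsing_set gamma mu i)^° = set0).
Proof.
split=> [H i|H].
  have [//|/set0P/interior_collapse[k [r [a [b [rU co]]]]]] :=
    eqVneq ((collapsing_set gamma mu i)^°) set0.
  have : collapsing_radii gamma mu r.
    by have [_ r0 _ _] := co; split => //; exact: collapse_compatible co.
  by rewrite H.
rewrite -subset0 => r [r0 rU /(compatible_collapse r0)[i [k [a [b co]]]]].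
by have := collapse_interior co rU; rewrite H => -[].
Qed.

Lemma UR_bounds r : 0 < r -> (r%:E <= UR gamma mu)%E ->
  [/\ forall i, focal_bound (strand i) r, grad_bounds r & (r%:E <= half_DCSD gamma mu)%E].
Proof.
move=> r0; rewrite /UR le_min => /andP[rD rF].
have rFi i : r <= FocRadm_comp gamma mu i.
  by rewrite -lee_fin; apply: (le_trans rF); apply: ereal_inf_lbound; exists i.
split => // i; have [] := FocRad_bounds r0 (rFi i) => //.
Qed.

Lemma UR_ge0 : (0 <= UR gamma mu)%E.
Proof.
rewrite /UR le_min; apply/andP; split; apply: le_ereal_inf_tmp.
  move=> _ [q1 [q2 [[_ [i [j [s [t [-> -> _]]]]]] ->]]].
  rewrite lee_fin divr_ge0 ?enorm_ge0// ltW//.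
  exact: (weightD_gt0 i s j t).
by move=> _ [i _ <-]; rewrite lee_fin invr_ge0 sqrtr_ge0.
Qed.

Lemma disc_bundle0 r : r <= 0 -> disc_bundle gamma r = set0.
Proof.
move=> r0; rewrite -subset0 => -[q w] [_ /=]; rewrite ltNge.
by rewrite (le_trans r0)// enorm_ge0.
Qed.

Lemma TIR_le_AIR : (TIR gamma mu <= AIR gamma mu)%E.
Proof.
apply: le_ereal_sup => _ [r [DW ho] <-]; exists r => //; split => //.
exists (disc_bundle gamma r), (exp_mu gamma mu @` disc_bundle gamma r); split => //.
- by exists setT; [exact: openT|rewrite setTI].
- exact: subset_closure.
have [r0|r0] := leP r 0; first by rewrite disc_bundle0// image_set0; exact: open0.
have gr : grad_bounds r by exact/disc_domainP.
exact: image_open r0 gr.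
Qed.

Lemma AIR_le_UR : (AIR gamma mu <= UR gamma mu)%E.
Proof.
apply: ge_ereal_sup => _ [r [DW [U [U0 [UO DU _ ho]]]] <-].
have [r0|r0] := leP r 0.
  by apply: le_trans UR_ge0; rewrite lee_fin.
have gr : grad_bounds r by exact/disc_domainP.
have mr := dense_homeo_minimizing r0 gr UO DU ho.
rewrite /UR le_min (minimizing_half_DCSD r0 gr mr)/=.
apply: le_ereal_inf_tmp => _ [i _ <-]; rewrite lee_fin.
exact: (minimizing_FocRad _ r0 gr mr).
Qed.

Lemma TIR_le_collapsing r : collapsing_radii gamma mu r -> (TIR gamma mu <= r%:E)%E.
Proof.
move=> [r0 rU /(compatible_collapse r0)[i [k [a [b co]]]]].
apply: ge_ereal_sup => _ [r' [DW ho] <-]; rewrite lee_fin leNgt; apply/negP => rr'.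
have r'0 := lt_trans r0 rr'.
have gr : grad_bounds r' by exact/disc_domainP.
exact: (collapse_not_injective co rr' (homeo_injective r'0 gr ho)).
Qed.

Lemma homeo_set0 (f : 'rV[R]_n * 'rV[R]_n -> 'rV[R]_n) : homeo_between set0 set0 f.
Proof.
by exists (fun=> (0, 0)); split => //; apply/subspace_continuousP.
Qed.

Lemma TIR_ge0 : (0 <= TIR gamma mu)%E.
Proof.
apply: ereal_sup_ubound; exists 0 => //; split; rewrite (disc_bundle0 (lexx _))//.
by rewrite image_set0; exact: homeo_set0.
Qed.

(** Below [r1] nothing collapses, since by [degenerate_collapse] an interval of
    critical points of value less than [r1^2] yields a collapsing radius less than
    [r1]. *)
Lemma TIR_ge r1 : 0 < r1 -> (r1%:E <= UR gamma mu)%E ->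
  (forall r, collapsing_radii gamma mu r -> r1 <= r) -> (r1%:E <= TIR gamma mu)%E.
Proof.
move=> r10 rU H; have [fb gb rD] := UR_bounds r10 rU.
have nc i : no_collapse (strand i) r1.
  move=> p a b ab Hp.
  have [k [r [rr co]]] := degenerate_collapse (fb i) (gb i) r10 ab Hp.
  have [_ r0 _ _] := co.
  have : collapsing_radii gamma mu r.
    split => //; last exact: collapse_compatible co.
    by apply: lt_le_trans rU; rewrite lte_fin.
  by move=> /H; rewrite leNgt rr.
have inj rho : 0 < rho -> rho < r1 -> injective_radius rho.
  apply: injective_below => // i s j t st s1 s2.
  exact: half_DCSD_critical rD st s1 s2.
apply/lee_subgt0Pr => e e0; have [re|re] := leP (r1 - e) 0.
  by apply: le_trans TIR_ge0; rewrite -EFinB lee_fin.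
have rr1 : r1 - e < r1 by lra.
have gr : grad_bounds (r1 - e).
  move=> i s; apply: le_trans (gb i s); rewrite ler_wpM2l ?sqr_ge0//.
  by rewrite ler_sqr ?nnegrE ltW.
apply: ereal_sup_ubound; exists (r1 - e) => //; split.
  exact: ((disc_domainP re).2 gr).
exact: injective_homeo re gr (inj _ re rr1).
Qed.

End Link.

Theorem theorem3 (R : realType) (n m : nat) (L : 'I_m -> R)
    (gamma : 'I_m -> R -> 'rV[R]_n) (mu : 'rV[R]_n -> R)
    (gamma_link : unit_speed_link L gamma)
    (mu_gt0 : forall q, carrier gamma q -> 0 < mu q)
    (mu_C3 : forall i, class_C 3 (mu_s gamma mu i)) :
  [/\ (TIR gamma mu < UR gamma mu)%E ->
        collapsing_radii gamma mu !=set0 /\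
        TIR gamma mu = ereal_inf [set r%:E | r in collapsing_radii gamma mu],
      collapsing_radii gamma mu = set0 <->
        (forall i, (collapsing_set gamma mu i)^° = set0)
    & (forall i, (collapsing_set gamma mu i)^° = set0) ->
        TIR gamma mu = AIR gamma mu /\ AIR gamma mu = UR gamma mu].
Proof.
have TA := TIR_le_AIR gamma_link mu_gt0 mu_C3.
have AU := AIR_le_UR gamma_link mu_gt0 mu_C3.
have TX r := @TIR_le_collapsing _ _ _ _ _ _ gamma_link mu_gt0 mu_C3 r.
have TG r := @TIR_ge _ _ _ _ _ _ gamma_link mu_gt0 mu_C3 r.
have XI := collapsing_interior gamma_link mu_gt0 mu_C3.
set X := collapsing_radii gamma mu in TX TG XI *.
pose I := ereal_inf [set r%:E | r in X].
have T0 : (0 <= TIR gamma mu)%E := TIR_ge0 gamma mu.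
have min_le_TIR : (Order.min (UR gamma mu) I <= TIR gamma mu)%E.
  rewrite leNgt; apply/negP => /(ereal_between T0)[r Tr].
  rewrite lt_min => /andP[rU rI].
  have r0 : 0 < r by rewrite -lte_fin (le_lt_trans T0).
  have : (r%:E <= TIR gamma mu)%E.
    apply: TG => //; first exact: ltW.
    move=> s Xs; rewrite -lee_fin; apply: (le_trans (ltW rI)).
    by apply: ereal_inf_lbound; exists s.
  by rewrite leNgt Tr.
have TI : (TIR gamma mu <= I)%E.
  by apply: le_ereal_inf_tmp => _ [r Xr <-]; exact: TX.
have empty_case : X = set0 -> (UR gamma mu <= TIR gamma mu)%E.
  move=> X0; apply: le_trans min_le_TIR; rewrite le_min lexx/=.
  by rewrite /I X0 image_set0 ereal_inf0 leey.
split.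
- move=> TU; split.
    by apply/set0P/eqP => /empty_case; rewrite leNgt TU.
  apply/le_anti/andP; split; first exact: TI.
  by move: min_le_TIR; rewrite ge_min leNgt TU.
- exact: XI.
move=> /XI/empty_case UT; split; apply/le_anti/andP; split => //.
  exact: le_trans AU UT.
exact: le_trans UT TA.
Qed.
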